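(* Let $N\ge 1$ be an integer, let $z\neq 0$ be complex, let $\theta=\arg z$, and let $R_N(z)$ be the remainder function defined in the context. Consider the equation \[ (2N+3)\cos(3\varphi^\ast-2\theta)=(2N-1)\cos(\varphi^\ast-2\theta) \qquad (\ast) \] in the unknown real number $\varphi^\ast$. (i) If $\frac{\pi}{4}<\theta<\pi$, then \[ |R_N(z)|\le\frac{\csc(2(\theta-\varphi^\ast))}{\cos^{2N+1}\varphi^\ast}\,\frac{|B_{2N+2}|}{2N(2N+1)(2N+2)|z|^{2N}}, \] where $0<\varphi^\ast<\frac{\pi}{2}$ is the unique solution of $(\ast)$ that satisfies $-\frac{\pi}{2}+\theta<\varphi^\ast<\frac{\pi}{2}$ if $\frac{3\pi}{4}\le\theta<\pi$; $-\frac{\pi}{2}+\theta<\varphi^\ast<-\frac{\pi}{4}+\theta$ if $\frac{\pi}{2}\le\theta<\frac{3\pi}{4}$; and $0<\varphi^\ast<-\frac{\pi}{4}+\theta$ if $\frac{\pi}{4}<\theta<\frac{\pi}{2}$. (ii) If $-\pi<\theta<-\frac{\pi}{4}$, then \[ |R_N(z)|\le-\frac{\csc(2(\theta-\varphi^\ast))}{\cos^{2N+1}\varphi^\ast}\,\frac{|B_{2N+2}|}{2N(2N+1)(2N+2)|z|^{2N}}, \] where $-\frac{\pi}{2}<\varphi^\ast<0$ is the unique solution of $(\ast)$ that satisfies $-\frac{\pi}{2}<\varphi^\ast<\frac{\pi}{2}+\theta$ if $-\pi<\theta\le-\frac{3\pi}{4}$; $\frac{\pi}{4}+\theta<\varphi^\ast<\frac{\pi}{2}+\theta$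 if $-\frac{3\pi}{4}<\theta\le-\frac{\pi}{2}$; and $\frac{\pi}{4}+\theta<\varphi^\ast<0$ if $-\frac{\pi}{2}<\theta<-\frac{\pi}{4}$.
   Context: $B_n$ denotes the $n$th Bernoulli number. $\arg$ and $\log z$ denote principal values. The Barnes $G$-function is the entire function given by \[ G(z+1)=(2\pi)^{z/2}e^{-[z(z+1)+\gamma z^2]/2}\prod_{n=1}^\infty\left[\left(1+\frac{z}{n}\right)^n e^{-z+z^2/(2n)}\right], \] where $\gamma$ is the Euler–Mascheroni constant. For $|\arg z|<\pi$, $\log G(z+1)$ and $\log\Gamma(z+1)$ denote the analytic branches on $\mathbb{C}\setminus(-\infty,0]$ that are real for $z>0$. The Glaisher–Kinkelin constant $A$ is given by $\log A=\frac{1}{12}-\zeta'(-1)$, where $\zeta$ is the Riemann zeta function. For $|\arg z|<\pi$ and $N\ge 1$ the remainder $R_N(z)$ is defined by \[ \log G(z+1)=\frac14 z^2+z\log\Gamma(z+1)-\left(\frac12 z(z+1)+\frac1{12}\right)\log z-\log A+\sum_{n=1}^{N-1}\frac{B_{2n+2}}{2n(2n+1)(2n+2)z^{2n}}+R_N(z), \] where empty sums are zero. *)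

(* Defs.v *)
From Stdlib Require Import Reals Lra Lia Psatz Arith.
From Coquelicot Require Import Coquelicot.

Local Open Scope R_scope.

(* [bernoulli_table n] lists B_0, ..., B_n, computed from
   sum_(0 <= j <= n) binom(n+1, j) B_j = 0 for n >= 1; in particular B_1 = -1/2. *)
Fixpoint bernoulli_table (n : nat) : nat -> R :=
  match n with
  | O => fun _ => 1
  | S m =>
      let b := bernoulli_table m in
      fun k =>
        if (k <=? m)%nat then b k
        else - sum_f_R0 (fun j => Binomial.C (S (S m)) j * b j) m / INR (S (S m))
  end.

Definition bernoulli (n : nat) : R := bernoulli_table n n.

Lemma bernoulli_table_eq (n k : nat) :
  (k <= n)%nat -> bernoulli_table n k = bernoulli k.
Proof.
  induction n as [|n IH]; intros Hk.
  - now replace k with 0%nat by lia.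
  - destruct (Nat.eq_dec k (S n)) as [->|Hne]; [reflexivity|].
    simpl. replace (k <=? n)%nat with true by (symmetry; apply Nat.leb_le; lia).
    apply IH; lia.
Qed.

Lemma bernoulli_0 : bernoulli 0 = 1.
Proof. reflexivity. Qed.

Lemma bernoulli_rec (n : nat) :
  (1 <= n)%nat -> sum_f_R0 (fun j => Binomial.C (S n) j * bernoulli j) n = 0.
Proof.
  destruct n as [|m]; [lia|]. intros _.
  rewrite tech5.
  assert (Hlast : Binomial.C (S (S m)) (S m) = INR (S (S m))).
  { unfold Binomial.C. replace (S (S m) - S m)%nat with 1%nat by lia.
    rewrite (fact_simpl (S m)), mult_INR.
    change (INR (Factorial.fact 1)) with 1.
    field. apply INR_fact_neq_0. }
  rewrite Hlast.
  unfold bernoulli at 2. cbn [bernoulli_table].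
  replace (S m <=? m)%nat with false by (symmetry; apply Nat.leb_gt; lia).
  rewrite (sum_eq (fun j => Binomial.C (S (S m)) j * bernoulli_table m j)
                  (fun j => Binomial.C (S (S m)) j * bernoulli j)).
  - field. apply not_0_INR; lia.
  - intros i Hi. now rewrite bernoulli_table_eq.
Qed.

Definition Cexp (z : C) : C := (exp (Re z) * cos (Im z), exp (Re z) * sin (Im z)).

(* Principal value, in ]-PI, PI]; meaningful for z <> 0. *)
Definition Carg (z : C) : R :=
  if Rle_dec 0 (Im z) then acos (Re z / Cmod z) else - acos (Re z / Cmod z).

Definition Clog (z : C) : C := (ln (Cmod z), Carg z).

Lemma Carg_spec (z : C) :
  z <> 0 ->
  - PI < Carg z <= PI /\
  Re z = Cmod z * cos (Carg z) /\ Im z = Cmod z * sin (Carg z).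
Proof.
  intros Hz.
  assert (Hr : 0 < Cmod z) by now apply Cmod_gt_0.
  pose proof (Cmod2_alt z) as H2.
  set (r := Cmod z) in *. set (x := Re z) in *. set (y := Im z) in *.
  assert (Hx : -1 <= x / r <= 1).
  { split; [apply Rmult_le_reg_r with r | apply Rmult_le_reg_r with r];
      try assumption; unfold Rdiv; rewrite Rmult_assoc, Rinv_l; nra. }
  assert (Hs : sin (acos (x / r)) = Rabs y / r).
  { rewrite sin_acos by assumption.
    replace (1 - (x / r)²) with ((y / r)²).
    - rewrite sqrt_Rsqr_abs. unfold Rdiv. rewrite Rabs_mult.
      now rewrite (Rabs_pos_eq (/ r)) by (left; now apply Rinv_0_lt_compat).
    - unfold Rsqr. apply Rmult_eq_reg_r with (r ^ 2); [|nra].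
      replace (y / r * (y / r) * r ^ 2) with (y ^ 2) by (field; lra).
      replace ((1 - x / r * (x / r)) * r ^ 2) with (r ^ 2 - x ^ 2) by (field; lra).
      lra. }
  pose proof (acos_bound (x / r)) as Hb.
  pose proof PI_RGT_0 as HPI.
  unfold Carg. fold x y r. destruct (Rle_dec 0 y) as [Hy|Hy].
  - rewrite Hs, cos_acos, Rabs_pos_eq by assumption.
    repeat split; try lra; field; lra.
  - rewrite cos_neg, sin_neg, Hs, cos_acos, Rabs_left by lra.
    repeat split; try lra; try (field; lra).
    destruct (Req_dec (acos (x / r)) PI) as [He|He]; [|lra].
    exfalso. rewrite He, sin_PI in Hs.
    apply Hy. right. symmetry in Hs.
    assert (HR : Rabs y = 0).
    { replace (Rabs y) with (Rabs y / r * r) by (field; lra). rewrite Hs; ring. }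
    destruct (Req_dec y 0) as [->|Hn]; [reflexivity|].
    now apply Rabs_no_R0 in Hn.
Qed.

Fixpoint Cprod (f : nat -> C) (n : nat) : C :=
  match n with
  | O => 1%R
  | S m => (Cprod f m * f (S m))%C
  end.

(* prod_(n >= 1) f n; a junk value if the partial products diverge. *)
Definition Cinf_prod (f : nat -> C) : C :=
  (real (Lim_seq (fun n => Re (Cprod f n))), real (Lim_seq (fun n => Im (Cprod f n)))).

Definition analytic_at (f : C -> C) (z0 : C) : Prop :=
  exists (a : nat -> C) (r : R),
    0 < r /\
    forall z : C,
      Cmod (z - z0) < r ->
      @is_pseries C_AbsRing C_NormedModule a (z - z0)%C (f z).

Definition slit_plane (z : C) : Prop := ~ (Re z <= 0 /\ Im z = 0).

(* For F positive on ]0, +oo[ and zero-free on the slit plane, these conditions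
   determine L uniquely there. *)
Definition is_log_branch (F L : C -> C) : Prop :=
  (forall z : C, slit_plane z -> analytic_at L z /\ Cexp (L z) = F z) /\
  (forall x : R, 0 < x -> Im (L x) = 0).

Definition euler_gamma : R :=
  real (Lim_seq (fun n => sum_n_m (fun k => / INR k) 1 n - ln (INR n))).

(* Weierstrass product. *)
Definition Gamma (z : C) : C :=
  (/ (z * Cexp (euler_gamma * z) *
      Cinf_prod (fun n => (1 + z / INR n) * Cexp (- (z / INR n)))))%C.

(* The defining product is given for G(z + 1). *)
Definition BarnesG_succ (z : C) : C :=
  (Cexp (z / 2 * ln (2 * PI)) *
   Cexp (- ((z * (z + 1) + euler_gamma * z ^ 2) / 2)) *
   Cinf_prod (fun n => (1 + z / INR n) ^ n * Cexp (- z + z ^ 2 / (2 * INR n))))%C.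

Definition BarnesG (z : C) : C := BarnesG_succ (z - 1)%C.

(* C minus {1} is connected, so zeta is determined off s = 1. *)
Definition is_riemann_zeta (zeta : C -> C) : Prop :=
  (forall s : C, s <> 1 -> analytic_at zeta s) /\
  (forall s : C, 1 < Re s ->
     @is_series C_AbsRing C_NormedModule
       (fun n => Cexp (- s * ln (INR (S n)))%C) (zeta s)).

Definition log_glaisher (zeta : C -> C) : C := (1 / 12 - C_derive zeta (- 1))%C.

(* [logG1] and [logGamma1] stand for z |-> log G(z+1) and z |-> log Gamma(z+1). *)
Definition barnes_remainder
    (logG1 logGamma1 zeta : C -> C) (N : nat) (z : C) : C :=
  (logG1 z -
   (1 / 4 * z ^ 2 + z * logGamma1 z
    - (1 / 2 * z * (z + 1) + 1 / 12) * Clog z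
    - log_glaisher zeta
    + @sum_n_m C_AbelianMonoid
        (fun n => bernoulli (2 * n + 2) /
           (2 * INR n * (2 * INR n + 1) * (2 * INR n + 2) * z ^ (2 * n))) 1 (N - 1)))%C.

Definition angle_equation (N : nat) (theta phi : R) : Prop :=
  (2 * INR N + 3) * cos (3 * phi - 2 * theta) =
  (2 * INR N - 1) * cos (phi - 2 * theta).

Definition csc (x : R) : R := / sin x.

(* Main.v *)
Require Import Defs.
From Stdlib Require Import Reals Lra Lia Arith Ranalysis5.
From Coquelicot Require Import Coquelicot.
Local Open Scope R_scope.

(** Write [q(z) = z (z + 1) / 2 + 1 / 12], let [B2] be the second Bernoulli polynomial, and let
      s(w) = (2 w + 1) / 4 - q(w) (log (w + 1) - log w),
    which is minus one half of the integral of [B2 x / (x + w)] over the unit interval. The proof has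
    two halves: the remainder for [N = 1] is the sum of [s(z + j)] over [j >= 0], and that sum has an
    asymptotic expansion whose error is controlled on a tilted Laplace contour.

    The sum. The logarithms of the partial products of [G (z + 1)] and [Gamma (z + 1)], combined as in
    [log G (z + 1) - z log Gamma (z + 1)], involve only sums of [(z + k) log (z + k)]. These telescope
    against the sums of [s(z + j)] ([euler_step_sum]). By Stirling's formula, the definition of Euler's
    constant and the asymptotics of the hyperfactorial, all growing terms cancel
    ([clim_euler_step_sum]). That the Weierstrass products converge locally uniformly makes their
    logarithms continuous, so they agree with the given analytic branches ([log_branch_unique]). The
    constant [log A] enters through the hyperfactorial: the Euler-Maclaurin formula of order three
    continues zeta to [Re s > -2], the identity theorem along a segment that avoids the pole identifies
    the continuation, and its derivative at [-1] is a limit of hyperfactorial sums ([hyper_seq_limit]).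

    The estimate. Put [c = 2 PI k]. The Fourier series of [B2] ([fourierB2_bound]) reduces the sum to
    the integrals of [cos (c x) / (x + w)] over the unit interval. On the ray [s = v exp (- i psi)], with
    [psi] such that [Re (z exp (- i psi)) > 0], [1 / (x + w)] is the Laplace integral of
    [exp (- (x + w) s)]. The integral over [x] is then elementary, the sum over the translates
    telescopes, and the frequency [c] contributes a multiple of the integral of [exp (- z s) s / (s ^ 2 + c ^ 2)]
    along the ray ([cos_laplace_exchange]). Expanding [1 / (s ^ 2 + c ^ 2)] in a finite geometric sum
    produces the asymptotic series, because the sums of [2 / c ^ (2 n)] over the frequencies are, up to sign,
    [B_(2 n) / (2 n)!] ([bernoulli_even_lim]). In the error term [|s ^ 2 + c ^ 2| >= c ^ 2 |sin (2 psi)|] and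
    [|exp (- z s)| = exp (- |z| |s| cos (theta - psi))], so the first omitted term appears multiplied by
    [|csc (2 psi)| / cos (theta - psi) ^ (2 N)] ([laplace_remainder_bound], [frequency_bound],
    [euler_maclaurin_bound], [remainder_bound]).

    Taking [psi = theta - phi], and using that [cos phi] is at most 1, gives the stated bound for every
    admissible [phi]. The equation for [phi] says that the bound is stationary; dividing it by
    [cos phi * sin (2 (theta - phi))] gives an equation [cot + (N + 1 / 2) tan = 0] with an increasing
    left-hand side, whence existence and uniqueness ([optimal_angle]). Negative arguments follow by
    reflecting the angles. *)

(** * Calculus of complex-valued functions of a real variable *)

Lemma Re_plus (z w : C) : Re (z + w)%C = Re z + Re w. Proof. reflexivity. Qed.
Lemma Im_plus (z w : C) : Im (z + w)%C = Im z + Im w. Proof. reflexivity. Qed.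
Lemma Re_opp (z : C) : Re (- z)%C = - Re z. Proof. reflexivity. Qed.
Lemma Im_opp (z : C) : Im (- z)%C = - Im z. Proof. reflexivity. Qed.
Lemma Re_minus (z w : C) : Re (z - w)%C = Re z - Re w. Proof. reflexivity. Qed.
Lemma Im_minus (z w : C) : Im (z - w)%C = Im z - Im w. Proof. reflexivity. Qed.
Lemma Re_mult (z w : C) : Re (z * w)%C = Re z * Re w - Im z * Im w. Proof. reflexivity. Qed.
Lemma Im_mult (z w : C) : Im (z * w)%C = Re z * Im w + Im z * Re w. Proof. reflexivity. Qed.
Lemma Re_RtoC (x : R) : Re (RtoC x) = x. Proof. reflexivity. Qed.
Lemma Im_RtoC (x : R) : Im (RtoC x) = 0. Proof. reflexivity. Qed.
Lemma Re_inv (z : C) : Re (/ z)%C = Re z / (Re z ^ 2 + Im z ^ 2). Proof. reflexivity. Qed.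
Lemma Im_inv (z : C) : Im (/ z)%C = - Im z / (Re z ^ 2 + Im z ^ 2). Proof. reflexivity. Qed.
Lemma Re_Cexp (z : C) : Re (Cexp z) = exp (Re z) * cos (Im z). Proof. reflexivity. Qed.
Lemma Im_Cexp (z : C) : Im (Cexp z) = exp (Re z) * sin (Im z). Proof. reflexivity. Qed.

Lemma C_ext (z w : C) : Re z = Re w -> Im z = Im w -> z = w.
Proof. destruct z, w; simpl; congruence. Qed.

Ltac creim :=
  repeat (rewrite ?Re_plus, ?Im_plus, ?Re_minus, ?Im_minus, ?Re_opp, ?Im_opp, ?Re_RtoC, ?Im_RtoC;
    first [rewrite Re_mult | rewrite Im_mult | fail]);
  rewrite ?Re_plus, ?Im_plus, ?Re_minus, ?Im_minus, ?Re_opp, ?Im_opp, ?Re_RtoC, ?Im_RtoC.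

Lemma Cnorm2_pos (z : C) : z <> 0 -> 0 < Re z ^ 2 + Im z ^ 2.
Proof.
  intros H. destruct (Req_dec (Re z) 0) as [Hr|Hr]; [|nra].
  destruct (Req_dec (Im z) 0) as [Hi|Hi]; [|nra].
  exfalso; apply H. now apply C_ext.
Qed.

Definition cderiv (f : R -> C) (t : R) (l : C) : Prop :=
  is_derive (fun u => Re (f u)) t (Re l) /\ is_derive (fun u => Im (f u)) t (Im l).

Definition ccont (f : R -> C) (t : R) : Prop :=
  continuous (fun u => Re (f u)) t /\ continuous (fun u => Im (f u)) t.

Lemma cderiv_eq (f : R -> C) (t : R) (l l' : C) : cderiv f t l -> l = l' -> cderiv f t l'.
Proof. now intros H <-. Qed.

Lemma cderiv_ext (f g : R -> C) (t : R) (l : C) : (forall u, f u = g u) -> cderiv f t l -> cderiv g t l.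
Proof.
  intros H [H1 H2]; split; [apply is_derive_ext with (2 := H1)|apply is_derive_ext with (2 := H2)];
    intros u; now rewrite H.
Qed.

Lemma cderiv_ccont (f : R -> C) (t : R) (l : C) : cderiv f t l -> ccont f t.
Proof. intros [H1 H2]; split; apply (ex_derive_continuous (V := R_NormedModule)); eexists; eassumption. Qed.

Lemma is_derive_const_R (c t : R) : is_derive (fun _ => c) t 0.
Proof. exact (is_derive_const (V := R_NormedModule) c t). Qed.

Lemma cderiv_const (z : C) (t : R) : cderiv (fun _ => z) t 0.
Proof. split; apply is_derive_const_R. Qed.

Lemma cderiv_real (f : R -> R) (t l : R) : is_derive f t l -> cderiv (fun u => RtoC (f u)) t l.
Proof. intros H; split; [exact H|exact (is_derive_const_R 0 t)]. Qed.

Lemma cderiv_id (t : R) : cderiv (fun u => RtoC u) t 1.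
Proof. exact (cderiv_real (fun u => u) t 1 (is_derive_id t)). Qed.

Lemma cderiv_plus (f g : R -> C) (t : R) (l m : C) :
  cderiv f t l -> cderiv g t m -> cderiv (fun u => f u + g u)%C t (l + m)%C.
Proof. intros [H1 H2] [H3 H4]; split; now apply @is_derive_plus. Qed.

Lemma cderiv_minus (f g : R -> C) (t : R) (l m : C) :
  cderiv f t l -> cderiv g t m -> cderiv (fun u => f u - g u)%C t (l - m)%C.
Proof. intros [H1 H2] [H3 H4]; split; now apply @is_derive_minus. Qed.

Lemma is_derive_mult_R (f g : R -> R) (t l m : R) :
  is_derive f t l -> is_derive g t m -> is_derive (fun u => f u * g u) t (l * g t + f t * m).
Proof. intros H1 H2. apply (is_derive_mult f g t l m H1 H2). intros; apply Rmult_comm. Qed.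

Lemma is_derive_pow2 (f : R -> R) (t l : R) :
  is_derive f t l -> is_derive (fun u => f u ^ 2) t (2 * f t * l).
Proof.
  intros H. apply (is_derive_ext (fun u => f u * f u)); [intros u; simpl; ring|].
  replace (2 * f t * l) with (l * f t + f t * l) by ring. now apply is_derive_mult_R.
Qed.

Lemma cderiv_mult (f g : R -> C) (t : R) (l m : C) :
  cderiv f t l -> cderiv g t m -> cderiv (fun u => f u * g u)%C t (l * g t + f t * m)%C.
Proof.
  intros [H1 H2] [H3 H4]; split.
  - eapply is_derive_ext; [intros u; symmetry; apply Re_mult|].
    replace (Re _) with ((Re l * Re (g t) + Re (f t) * Re m) - (Im l * Im (g t) + Im (f t) * Im m))
      by (creim; ring).
    apply @is_derive_minus; now apply is_derive_mult_R.
  - eapply is_derive_ext; [intros u; symmetry; apply Im_mult|].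
    replace (Im _) with ((Re l * Im (g t) + Re (f t) * Im m) + (Im l * Re (g t) + Im (f t) * Re m))
      by (creim; ring).
    apply @is_derive_plus; now apply is_derive_mult_R.
Qed.

Lemma cderiv_scal (z : C) (f : R -> C) (t : R) (l : C) :
  cderiv f t l -> cderiv (fun u => z * f u)%C t (z * l)%C.
Proof.
  intros H. eapply cderiv_eq; [apply cderiv_mult; [apply cderiv_const|exact H]|]. cbv beta; ring.
Qed.

Lemma cderiv_Cexp (f : R -> C) (t : R) (l : C) :
  cderiv f t l -> cderiv (fun u => Cexp (f u)) t (l * Cexp (f t))%C.
Proof.
  intros [H1 H2].
  assert (He : is_derive (fun u => exp (Re (f u))) t (Re l * exp (Re (f t)))).
  { apply (is_derive_comp exp (fun u => Re (f u))); [apply is_derive_exp|exact H1]. }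
  split.
  - eapply is_derive_ext; [intros u; symmetry; apply Re_Cexp|].
    replace (Re _) with (Re l * exp (Re (f t)) * cos (Im (f t)) +
      exp (Re (f t)) * (Im l * (- sin (Im (f t))))) by (rewrite Re_mult, Re_Cexp, Im_Cexp; ring).
    apply (is_derive_mult_R (fun u => exp (Re (f u))) (fun u => cos (Im (f u)))); [exact He|].
    apply (is_derive_comp cos (fun u => Im (f u))); [apply is_derive_cos|exact H2].
  - eapply is_derive_ext; [intros u; symmetry; apply Im_Cexp|].
    replace (Im _) with (Re l * exp (Re (f t)) * sin (Im (f t)) +
      exp (Re (f t)) * (Im l * cos (Im (f t)))) by (rewrite Im_mult, Re_Cexp, Im_Cexp; ring).
    apply (is_derive_mult_R (fun u => exp (Re (f u))) (fun u => sin (Im (f u)))); [exact He|].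
    apply (is_derive_comp sin (fun u => Im (f u))); [apply is_derive_sin|exact H2].
Qed.

Lemma cderiv_pow (f : R -> C) (t : R) (l : C) (n : nat) :
  cderiv f t l -> cderiv (fun u => f u ^ S n)%C t (INR (S n) * f t ^ n * l)%C.
Proof.
  intros H. induction n as [|n IH].
  - apply (cderiv_eq _ _ (l * 1 + f t * 0)%C).
    + apply (cderiv_mult f (fun _ => RtoC 1)); [exact H|apply cderiv_const].
    + change (INR 1) with 1. change (f t ^ 0)%C with (RtoC 1). ring.
  - apply (cderiv_eq _ _ (l * f t ^ S n + f t * (INR (S n) * f t ^ n * l))%C).
    + apply (cderiv_mult f (fun u => f u ^ S n)%C); [exact H|exact IH].
    + rewrite (S_INR (S n)), RtoC_plus, Cpow_S. ring.
Qed.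

Lemma ccont_ext (f g : R -> C) (t : R) : (forall u, f u = g u) -> ccont f t -> ccont g t.
Proof.
  intros H [H1 H2]; split; [apply continuous_ext with (2 := H1)|apply continuous_ext with (2 := H2)];
    intros u; now rewrite H.
Qed.

Lemma ccont_const (z : C) (t : R) : ccont (fun _ => z) t.
Proof. split; apply continuous_const. Qed.

Lemma ccont_real (f : R -> R) (t : R) : continuous f t -> ccont (fun u => RtoC (f u)) t.
Proof. intros H; split; [exact H|apply continuous_const]. Qed.

Lemma ccont_plus (f g : R -> C) (t : R) : ccont f t -> ccont g t -> ccont (fun u => f u + g u)%C t.
Proof.
  intros [H1 H2] [H3 H4]; split;
    [apply (continuous_plus (fun u => Re (f u)) (fun u => Re (g u)))
    |apply (continuous_plus (fun u => Im (f u)) (fun u => Im (g u)))]; assumption.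
Qed.

Lemma ccont_minus (f g : R -> C) (t : R) : ccont f t -> ccont g t -> ccont (fun u => f u - g u)%C t.
Proof.
  intros [H1 H2] [H3 H4]; split;
    [apply (continuous_minus (fun u => Re (f u)) (fun u => Re (g u)))
    |apply (continuous_minus (fun u => Im (f u)) (fun u => Im (g u)))]; assumption.
Qed.

Lemma continuous_mult_R (f g : R -> R) (t : R) :
  continuous f t -> continuous g t -> continuous (fun u => f u * g u) t.
Proof. intros; now apply (continuous_mult f g). Qed.

Lemma ccont_mult (f g : R -> C) (t : R) : ccont f t -> ccont g t -> ccont (fun u => f u * g u)%C t.
Proof.
  intros [H1 H2] [H3 H4]; split.
  - apply (continuous_minus (fun u => Re (f u) * Re (g u)) (fun u => Im (f u) * Im (g u)));
      now apply continuous_mult_R.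
  - apply (continuous_plus (fun u => Re (f u) * Im (g u)) (fun u => Im (f u) * Re (g u)));
      now apply continuous_mult_R.
Qed.

Lemma ccont_pow (f : R -> C) (t : R) (n : nat) : ccont f t -> ccont (fun u => f u ^ n)%C t.
Proof.
  intros H; induction n as [|n IH]; [apply ccont_const|now apply ccont_mult].
Qed.

Lemma ccont_Cexp (f : R -> C) (t : R) : ccont f t -> ccont (fun u => Cexp (f u)) t.
Proof.
  intros [H1 H2].
  assert (He : continuous (fun u => exp (Re (f u))) t).
  { apply (continuous_comp (fun u => Re (f u)) exp); [exact H1|apply continuous_exp]. }
  split; apply continuous_mult_R; try exact He.
  - apply (continuous_comp (fun u => Im (f u)) cos); [exact H2|apply continuous_cos].
  - apply (continuous_comp (fun u => Im (f u)) sin); [exact H2|apply continuous_sin].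
Qed.

Lemma continuous_pow2 (f : R -> R) (t : R) : continuous f t -> continuous (fun u => f u ^ 2) t.
Proof.
  intros H. apply (continuous_ext (fun u => f u * f u)); [intros u; simpl; ring|].
  now apply continuous_mult_R.
Qed.

Lemma ccont_inv (f : R -> C) (t : R) : f t <> 0 -> ccont f t -> ccont (fun u => / f u)%C t.
Proof.
  intros H0 [H1 H2].
  assert (Hn : continuous (fun u => / (Re (f u) ^ 2 + Im (f u) ^ 2)) t).
  { apply (continuous_comp (fun u => Re (f u) ^ 2 + Im (f u) ^ 2) Rinv).
    - apply (continuous_plus (fun u => Re (f u) ^ 2) (fun u => Im (f u) ^ 2));
        now apply continuous_pow2.
    - apply continuous_Rinv. apply Rgt_not_eq, Cnorm2_pos, H0. }
  split; apply continuous_mult_R; try assumption.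
  apply (continuous_opp (fun u => Im (f u))); assumption.
Qed.

Lemma ccont_div (f g : R -> C) (t : R) :
  g t <> 0 -> ccont f t -> ccont g t -> ccont (fun u => f u / g u)%C t.
Proof. intros; apply ccont_mult; [assumption|now apply ccont_inv]. Qed.

Lemma cderiv_line (a b : C) (t : R) : cderiv (fun u => a + RtoC u * b)%C t b.
Proof.
  eapply cderiv_eq.
  - apply cderiv_plus; [apply cderiv_const|].
    apply (cderiv_mult (fun u => RtoC u) (fun _ => b)); [apply cderiv_id|apply cderiv_const].
  - cbv beta; ring.
Qed.

Lemma cderiv_scaled (b : C) (t : R) : cderiv (fun u => RtoC u * b)%C t b.
Proof.
  apply cderiv_ext with (fun u => 0 + RtoC u * b)%C; [intros; ring|apply cderiv_line].
Qed.

Lemma ccont_id (t : R) : ccont (fun u => RtoC u) t.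
Proof. exact (cderiv_ccont _ _ _ (cderiv_id t)). Qed.

Lemma ccont_scaled (b : C) (t : R) : ccont (fun u => RtoC u * b)%C t.
Proof. eapply cderiv_ccont, cderiv_scaled. Qed.

Lemma ccont_scal (z : C) (f : R -> C) (t : R) : ccont f t -> ccont (fun u => z * f u)%C t.
Proof. apply (ccont_mult (fun _ => z)), ccont_const. Qed.

Lemma continuous_of_derive (f : R -> R) (t : R) : ex_derive f t -> continuous f t.
Proof. apply (ex_derive_continuous (V := R_NormedModule)). Qed.

Lemma ccont_of_derive (f : R -> R) (t : R) : ex_derive f t -> ccont (fun u => RtoC (f u)) t.
Proof. intros H. now apply ccont_real, continuous_of_derive. Qed.

(** * The complex exponential and the principal logarithm *)

Lemma Cexp_plus (z w : C) : Cexp (z + w) = (Cexp z * Cexp w)%C.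
Proof.
  apply C_ext; rewrite ?Re_mult, ?Im_mult, ?Re_Cexp, ?Im_Cexp, Re_plus, Im_plus, exp_plus.
  - rewrite cos_plus; ring.
  - rewrite sin_plus; ring.
Qed.

Lemma Cexp_0 : Cexp 0 = 1.
Proof. apply C_ext; rewrite ?Re_Cexp, ?Im_Cexp; simpl; rewrite exp_0, ?cos_0, ?sin_0; ring. Qed.

Lemma Cmod_Cexp (z : C) : Cmod (Cexp z) = exp (Re z).
Proof.
  unfold Cmod. change (fst (Cexp z)) with (exp (Re z) * cos (Im z)).
  change (snd (Cexp z)) with (exp (Re z) * sin (Im z)).
  replace (_ + _) with ((exp (Re z)) ^ 2).
  - apply sqrt_pow2. left; apply exp_pos.
  - pose proof (sin2_cos2 (Im z)) as H. unfold Rsqr in H.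
    transitivity (exp (Re z) ^ 2 * (sin (Im z) * sin (Im z) + cos (Im z) * cos (Im z))); [rewrite H|]; ring.
Qed.

Lemma Cexp_neq_0 (z : C) : Cexp z <> 0.
Proof. apply Cmod_gt_0. rewrite Cmod_Cexp. apply exp_pos. Qed.

Lemma Cexp_opp (z : C) : Cexp (- z) = (/ Cexp z)%C.
Proof.
  assert (H : (Cexp (- z) * Cexp z)%C = 1).
  { rewrite <- Cexp_plus. replace (- z + z)%C with (RtoC 0) by ring. apply Cexp_0. }
  replace (Cexp (- z)) with (Cexp (- z) * Cexp z * / Cexp z)%C by (field; apply Cexp_neq_0).
  rewrite H. field. apply Cexp_neq_0.
Qed.

Lemma Cexp_pow (z : C) (n : nat) : (Cexp z ^ n)%C = Cexp (INR n * z).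
Proof.
  induction n as [|n IH].
  - change (INR 0) with 0. rewrite Cmult_0_l, Cexp_0. reflexivity.
  - rewrite Cpow_S, IH, <- Cexp_plus, S_INR, RtoC_plus. f_equal. ring.
Qed.

Lemma Cexp_RtoC (x : R) : Cexp x = exp x.
Proof. apply C_ext; rewrite ?Re_Cexp, ?Im_Cexp, ?Re_RtoC, ?Im_RtoC, ?cos_0, ?sin_0; ring. Qed.

Lemma Cexp_Clog (z : C) : z <> 0 -> Cexp (Clog z) = z.
Proof.
  intros H. destruct (Carg_spec z H) as [_ [H1 H2]].
  apply C_ext; [rewrite Re_Cexp|rewrite Im_Cexp]; unfold Clog; simpl;
    rewrite exp_ln by (now apply Cmod_gt_0); symmetry; assumption.
Qed.

Lemma angle_unique (a b : R) :
  - (2 * PI) < a - b < 2 * PI -> cos a = cos b -> sin a = sin b -> a = b.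
Proof.
  intros Hab Hc Hs.
  assert (H1 : cos (a - b) = 1).
  { rewrite cos_minus, Hc, Hs. pose proof (sin2_cos2 b) as H. unfold Rsqr in H. lra. }
  replace (a - b) with (2 * ((a - b) / 2)) in H1 by field.
  rewrite cos_2a_sin in H1.
  assert (H0 : sin ((a - b) / 2) = 0) by nra.
  destruct (Rtotal_order ((a - b) / 2) 0) as [H|[H|H]]; [|lra|].
  - exfalso. assert (Hp : 0 < sin (- ((a - b) / 2))) by (apply sin_gt_0; lra).
    rewrite sin_neg in Hp; lra.
  - exfalso. assert (Hp : 0 < sin ((a - b) / 2)) by (apply sin_gt_0; lra). lra.
Qed.

Lemma Clog_unique (z w : C) : Cexp w = z -> - PI < Im w <= PI -> Clog z = w.
Proof.
  intros <- Hw.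
  pose proof (Cexp_neq_0 w) as H0. pose proof (Carg_spec _ H0) as [Hr [H1 H2]].
  unfold Clog. rewrite Cmod_Cexp in *. rewrite Re_Cexp in H1. rewrite Im_Cexp in H2.
  pose proof (exp_pos (Re w)) as Hp.
  apply C_ext; simpl; [apply ln_exp|].
  apply angle_unique; [lra| |];
    apply Rmult_eq_reg_l with (exp (Re w)); try lra; symmetry; assumption.
Qed.

Lemma Clog_RtoC (x : R) : 0 < x -> Clog x = ln x.
Proof.
  intros Hx. apply Clog_unique.
  - rewrite Cexp_RtoC, exp_ln by assumption. reflexivity.
  - simpl. pose proof PI_RGT_0; lra.
Qed.

Lemma Clog_scal (r : R) (z : C) : 0 < r -> z <> 0 -> Clog (r * z) = (ln r + Clog z)%C.
Proof.
  intros Hr Hz. apply Clog_unique.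
  - rewrite Cexp_plus, Cexp_Clog, Cexp_RtoC, exp_ln by assumption. reflexivity.
  - rewrite Im_plus, Im_RtoC. unfold Clog; simpl. destruct (Carg_spec z Hz) as [H _]. lra.
Qed.

Lemma slit_neq_0 (z : C) : slit_plane z -> z <> 0.
Proof. intros H ->. apply H; simpl; lra. Qed.

Lemma Carg_right (z : C) : 0 < Re z -> Carg z = atan (Im z / Re z).
Proof.
  intros H. assert (Hz : z <> 0) by (intros ->; simpl in H; lra).
  set (u := Im z / Re z).
  assert (Hs : 0 < sqrt (1 + u²)) by (apply sqrt_lt_R0; unfold Rsqr; nra).
  pose proof (atan_bound u) as Hb.
  enough (E : Clog z = (ln (Re z * sqrt (1 + u²)), atan u)) by (unfold Clog in E; congruence).
  apply Clog_unique; [|simpl; lra].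
  apply C_ext; [rewrite Re_Cexp|rewrite Im_Cexp]; simpl;
    rewrite exp_ln by (now apply Rmult_lt_0_compat); rewrite ?cos_atan, ?sin_atan.
  - field; lra.
  - unfold u at 2; field; lra.
Qed.

Lemma Carg_upper (z : C) : 0 < Im z -> Carg z = PI / 2 - atan (Re z / Im z).
Proof.
  intros H. assert (Hz : z <> 0) by (intros ->; simpl in H; lra).
  set (u := Re z / Im z).
  assert (Hs : 0 < sqrt (1 + u²)) by (apply sqrt_lt_R0; unfold Rsqr; nra).
  pose proof (atan_bound u) as Hb.
  enough (E : Clog z = (ln (Im z * sqrt (1 + u²)), PI / 2 - atan u)) by (unfold Clog in E; congruence).
  apply Clog_unique; [|simpl; lra].
  apply C_ext; [rewrite Re_Cexp|rewrite Im_Cexp]; simpl;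
    rewrite exp_ln by (now apply Rmult_lt_0_compat); rewrite ?cos_shift, ?sin_shift, ?cos_atan, ?sin_atan.
  - unfold u at 2; field; lra.
  - field; lra.
Qed.

Lemma Carg_lower (z : C) : Im z < 0 -> Carg z = - (PI / 2) - atan (Re z / Im z).
Proof.
  intros H. assert (Hz : z <> 0) by (intros ->; simpl in H; lra).
  set (u := Re z / Im z).
  assert (Hs : 0 < sqrt (1 + u²)) by (apply sqrt_lt_R0; unfold Rsqr; nra).
  pose proof (atan_bound u) as Hb.
  enough (E : Clog z = (ln (- Im z * sqrt (1 + u²)), - (PI / 2) - atan u)) by (unfold Clog in E; congruence).
  apply Clog_unique; [|simpl; lra].
  apply C_ext; [rewrite Re_Cexp|rewrite Im_Cexp]; simpl;
    rewrite exp_ln by (apply Rmult_lt_0_compat; lra);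
    replace (- (PI / 2) - atan u) with (- (PI / 2 + atan u)) by ring;
    rewrite ?cos_neg, ?sin_neg.
  - replace (cos (PI / 2 + atan u)) with (- sin (atan u)).
    + rewrite sin_atan. unfold u at 2; field; lra.
    + rewrite cos_plus, cos_PI2, sin_PI2; ring.
  - replace (sin (PI / 2 + atan u)) with (cos (atan u)).
    + rewrite cos_atan. field; lra.
    + rewrite sin_plus, cos_PI2, sin_PI2; ring.
Qed.

Lemma locally_pos (f : R -> R) (t : R) : continuous f t -> 0 < f t -> locally t (fun u => 0 < f u).
Proof. intros Hc Hp. apply (Hc (fun y => 0 < y)). now apply open_gt. Qed.

Lemma locally_neg (f : R -> R) (t : R) : continuous f t -> f t < 0 -> locally t (fun u => f u < 0).
Proof. intros Hc Hp. apply (Hc (fun y => y < 0)). now apply open_lt. Qed.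

Lemma is_derive_quot (f g : R -> R) (t l m : R) :
  is_derive f t l -> is_derive g t m -> g t <> 0 ->
  is_derive (fun u => f u / g u) t ((l * g t - f t * m) / (g t) ^ 2).
Proof.
  intros Hf Hg H0. assert (Hi := is_derive_inv _ _ _ Hg H0).
  evar_last; [apply (is_derive_mult_R f (fun u => / g u)); [exact Hf|exact Hi]|]. field; exact H0.
Qed.

Lemma is_derive_atan_comp (f : R -> R) (t l : R) :
  is_derive f t l -> is_derive (fun u => atan (f u)) t (l / (1 + f t ^ 2)).
Proof.
  intros H. evar_last; [apply (is_derive_comp atan f); [apply is_derive_atan|exact H]|].
  unfold scal; simpl; unfold mult; simpl; unfold Rsqr. field. nra.
Qed.

Lemma cderiv_Clog (f : R -> C) (t : R) (l : C) :
  slit_plane (f t) -> cderiv f t l -> cderiv (fun u => Clog (f u)) t (l / f t)%C.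
Proof.
  intros Hsl Hf. pose proof (cderiv_ccont _ _ _ Hf) as [Hc1 Hc2]. destruct Hf as [H1 H2].
  pose proof (slit_neq_0 _ Hsl) as H0. pose proof (Cnorm2_pos _ H0) as Hn.
  set (x := Re (f t)) in *. set (y := Im (f t)) in *.
  assert (Hl : (l / f t)%C = ((Re l * x + Im l * y) / (x ^ 2 + y ^ 2),
                              (Im l * x - Re l * y) / (x ^ 2 + y ^ 2))).
  { apply C_ext; unfold Cdiv; creim; rewrite Re_inv, Im_inv; fold x y; simpl; field; nra. }
  rewrite Hl. split.
  - simpl. unfold Cmod.
    assert (Hd : is_derive (fun u => Re (f u) ^ 2 + Im (f u) ^ 2) t (2 * x * Re l + 2 * y * Im l)).
    { apply @is_derive_plus; now apply is_derive_pow2. }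
    apply (is_derive_ext_loc (fun u => ln (Re (f u) ^ 2 + Im (f u) ^ 2) / 2)).
    + generalize (locally_pos (fun u => Re (f u) ^ 2 + Im (f u) ^ 2) t).
      intros HL. specialize (HL (ex_derive_continuous (V := R_NormedModule) _ _ (ex_intro _ _ Hd)) Hn).
      revert HL. apply filter_imp. intros u Hu.
      change (fst (f u)) with (Re (f u)). change (snd (f u)) with (Im (f u)).
      rewrite <- (sqrt_sqrt (Re (f u) ^ 2 + Im (f u) ^ 2)) at 1 by lra.
      rewrite ln_mult by (now apply sqrt_lt_R0). lra.
    + evar_last; [apply (is_derive_mult_R (fun u => ln (Re (f u) ^ 2 + Im (f u) ^ 2)) (fun _ => / 2));
        [apply (is_derive_comp ln); [apply is_derive_ln; exact Hn|exact Hd]|apply is_derive_const_R]|].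
      unfold scal; simpl; unfold mult; simpl. unfold x, y, Re, Im in *.
      field. simpl in Hn; lra.
  - simpl.
    destruct (Rlt_or_le 0 x) as [Hx|Hx].
    + apply (is_derive_ext_loc (fun u => atan (Im (f u) / Re (f u)))).
      * generalize (locally_pos _ t Hc1 Hx). apply filter_imp; intros u Hu. symmetry; now apply Carg_right.
      * evar_last; [apply is_derive_atan_comp, is_derive_quot; [exact H2|exact H1|fold x; lra]|].
        cbv beta; unfold x, y, Re, Im in *; simpl in *; field. split; nra.
    + destruct (Rtotal_order y 0) as [Hy|[Hy|Hy]].
      * apply (is_derive_ext_loc (fun u => - (PI / 2) - atan (Re (f u) / Im (f u)))).
        { generalize (locally_neg _ t Hc2 Hy). apply filter_imp; intros u Hu. symmetry; now apply Carg_lower. }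
        evar_last; [apply @is_derive_minus; [apply is_derive_const_R|
          apply is_derive_atan_comp, is_derive_quot; [exact H1|exact H2|fold y; lra]]|].
        cbv beta; unfold minus, plus, opp, x, y, Re, Im in *; simpl in *; field. repeat split; nra.
      * exfalso. now apply Hsl.
      * apply (is_derive_ext_loc (fun u => (PI / 2) - atan (Re (f u) / Im (f u)))).
        { generalize (locally_pos _ t Hc2 Hy). apply filter_imp; intros u Hu. symmetry; now apply Carg_upper. }
        evar_last; [apply @is_derive_minus; [apply is_derive_const_R|
          apply is_derive_atan_comp, is_derive_quot; [exact H1|exact H2|fold y; lra]]|].
        cbv beta; unfold minus, plus, opp, x, y, Re, Im in *; simpl in *; field. repeat split; nra.
Qed.

(** * Integrals and limits of complex-valued functions *)

Definition is_CInt (f : R -> C) (a b : R) (l : C) : Prop :=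
  is_RInt (fun t => Re (f t)) a b (Re l) /\ is_RInt (fun t => Im (f t)) a b (Im l).

Lemma is_CInt_unique (f : R -> C) (a b : R) (l m : C) : is_CInt f a b l -> is_CInt f a b m -> l = m.
Proof.
  intros [H1 H2] [H3 H4]. apply C_ext.
  - now rewrite <- (is_RInt_unique _ _ _ _ H1), <- (is_RInt_unique _ _ _ _ H3).
  - now rewrite <- (is_RInt_unique _ _ _ _ H2), <- (is_RInt_unique _ _ _ _ H4).
Qed.

Definition CInt (f : R -> C) (a b : R) : C :=
  (RInt (fun t => Re (f t)) a b, RInt (fun t => Im (f t)) a b).

Lemma is_CInt_value (f : R -> C) (a b : R) (l : C) : is_CInt f a b l -> CInt f a b = l.
Proof. intros [H1 H2]. apply C_ext; now apply (is_RInt_unique (V := R_CompleteNormedModule)). Qed.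

Lemma CInt_correct (f : R -> C) (a b : R) :
  a <= b -> (forall t, a <= t <= b -> ccont f t) -> is_CInt f a b (CInt f a b).
Proof.
  intros Hab H.
  split; apply (RInt_correct (V := R_CompleteNormedModule)), (ex_RInt_continuous (V := R_CompleteNormedModule));
    intros t; rewrite Rmin_left, Rmax_right by assumption; intros Ht;
    [exact (proj1 (H t Ht))|exact (proj2 (H t Ht))].
Qed.

Lemma ex_CInt (f : R -> C) (a b : R) :
  a <= b -> (forall t, a <= t <= b -> ccont f t) -> exists l, is_CInt f a b l.
Proof.
  intros Hab H. exists (CInt f a b). now apply CInt_correct.
Qed.

Lemma is_CInt_derive (f df : R -> C) (a b : R) :
  a <= b -> (forall t, a <= t <= b -> cderiv f t (df t)) -> (forall t, a <= t <= b -> ccont df t) ->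
  is_CInt df a b (f b - f a)%C.
Proof.
  intros Hab Hd Hc; split.
  - apply (is_RInt_derive (V := R_CompleteNormedModule) (fun t => Re (f t)) (fun t => Re (df t)));
      intros t; rewrite Rmin_left, Rmax_right by assumption; intros Ht;
      [exact (proj1 (Hd t Ht))|exact (proj1 (Hc t Ht))].
  - apply (is_RInt_derive (V := R_CompleteNormedModule) (fun t => Im (f t)) (fun t => Im (df t)));
      intros t; rewrite Rmin_left, Rmax_right by assumption; intros Ht;
      [exact (proj2 (Hd t Ht))|exact (proj2 (Hc t Ht))].
Qed.

Lemma is_CInt_ext (f g : R -> C) (a b : R) (l : C) :
  a <= b -> (forall t, a < t < b -> f t = g t) -> is_CInt f a b l -> is_CInt g a b l.
Proof.
  intros Hab H [H1 H2]; split; [apply is_RInt_ext with (2 := H1)|apply is_RInt_ext with (2 := H2)];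
    intros t; rewrite Rmin_left, Rmax_right by assumption; intros Ht; now rewrite H.
Qed.

Lemma is_CInt_plus (f g : R -> C) (a b : R) (l m : C) :
  is_CInt f a b l -> is_CInt g a b m -> is_CInt (fun t => f t + g t)%C a b (l + m)%C.
Proof. intros [H1 H2] [H3 H4]; split; now apply @is_RInt_plus. Qed.

Lemma is_CInt_minus (f g : R -> C) (a b : R) (l m : C) :
  is_CInt f a b l -> is_CInt g a b m -> is_CInt (fun t => f t - g t)%C a b (l - m)%C.
Proof. intros [H1 H2] [H3 H4]; split; now apply @is_RInt_minus. Qed.

Lemma is_CInt_scal (z : C) (f : R -> C) (a b : R) (l : C) :
  is_CInt f a b l -> is_CInt (fun t => z * f t)%C a b (z * l)%C.
Proof.
  intros [H1 H2]; split.
  - rewrite Re_mult. apply (is_RInt_minus (V := R_NormedModule) (fun t => Re z * Re (f t)) (fun t => Im z * Im (f t)));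
      now apply @is_RInt_scal.
  - rewrite Im_mult. apply (is_RInt_plus (V := R_NormedModule) (fun t => Re z * Im (f t)) (fun t => Im z * Re (f t)));
      now apply @is_RInt_scal.
Qed.

Lemma is_RInt_zero (a b : R) : is_RInt (fun _ => 0) a b 0.
Proof.
  evar_last; [exact (is_RInt_const (V := R_NormedModule) a b 0)|]. apply Rmult_0_r.
Qed.

Lemma is_CInt_zero (a b : R) : is_CInt (fun _ => RtoC 0) a b 0.
Proof. split; apply is_RInt_zero. Qed.

Lemma is_RInt_pow (m : nat) (t : R) : is_RInt (fun x => x ^ m) 0 t (t ^ S m / INR (S m)).
Proof.
  assert (INR (S m) <> 0) by (apply not_0_INR; lia).
  evar_last; [apply (is_RInt_derive (V := R_CompleteNormedModule) (fun x => x ^ S m / INR (S m)))|].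
  - intros x _. auto_derive; [exact I|]. change (Init.Nat.pred (S m)) with m. field. assumption.
  - intros x _. apply continuous_of_derive. auto_derive; exact I.
  - unfold minus, plus, opp; cbn -[INR]. field. assumption.
Qed.

Fixpoint Csum (f : nat -> C) (n : nat) : C :=
  match n with O => RtoC 0 | S m => (Csum f m + f m)%C end.

Lemma Csum_ext (f g : nat -> C) (n : nat) : (forall k, (k < n)%nat -> f k = g k) -> Csum f n = Csum g n.
Proof.
  induction n as [|n IH]; intros H; [reflexivity|]. simpl. rewrite IH, H by (intros; try apply H; lia).
  reflexivity.
Qed.

Lemma Csum_plus (f g : nat -> C) (n : nat) : Csum (fun k => f k + g k)%C n = (Csum f n + Csum g n)%C.
Proof. induction n as [|n IH]; simpl; [ring|rewrite IH; ring]. Qed.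

Lemma Csum_minus (f g : nat -> C) (n : nat) : Csum (fun k => f k - g k)%C n = (Csum f n - Csum g n)%C.
Proof. induction n as [|n IH]; simpl; [ring|rewrite IH; ring]. Qed.

Lemma Csum_scal (z : C) (f : nat -> C) (n : nat) : Csum (fun k => z * f k)%C n = (z * Csum f n)%C.
Proof. induction n as [|n IH]; simpl; [ring|rewrite IH; ring]. Qed.

Lemma Csum_swap (f : nat -> nat -> C) (n m : nat) :
  Csum (fun i => Csum (f i) m) n = Csum (fun j => Csum (fun i => f i j) n) m.
Proof.
  induction n as [|n IH]; simpl.
  - induction m as [|m IH]; simpl; [reflexivity|rewrite <- IH; ring].
  - rewrite IH, <- Csum_plus. reflexivity.
Qed.

Fixpoint Rsum (f : nat -> R) (n : nat) : R :=
  match n with O => 0 | S m => Rsum f m + f m end.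

Lemma Rsum_ext (f g : nat -> R) (n : nat) : (forall k, (k < n)%nat -> f k = g k) -> Rsum f n = Rsum g n.
Proof.
  induction n as [|n IH]; intros H; [reflexivity|]. simpl. rewrite IH, H by (intros; try apply H; lia).
  reflexivity.
Qed.

Lemma Rsum_scal (z : R) (f : nat -> R) (n : nat) : Rsum (fun k => z * f k) n = z * Rsum f n.
Proof. induction n as [|n IH]; simpl; [ring|rewrite IH; ring]. Qed.

Lemma Rsum_plus (f g : nat -> R) (n : nat) : Rsum (fun k => f k + g k) n = Rsum f n + Rsum g n.
Proof. induction n as [|n IH]; simpl; [ring|rewrite IH; ring]. Qed.

Lemma Rsum_le (f g : nat -> R) (n : nat) :
  (forall k, (k < n)%nat -> f k <= g k) -> Rsum f n <= Rsum g n.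
Proof.
  induction n as [|n IH]; intros H; simpl; [lra|].
  apply Rplus_le_compat; [apply IH; intros; apply H|apply H]; lia.
Qed.

Lemma RtoC_Rsum (f : nat -> R) (n : nat) : RtoC (Rsum f n) = Csum (fun k => RtoC (f k)) n.
Proof. induction n as [|n IH]; simpl; [reflexivity|now rewrite RtoC_plus, IH]. Qed.

Lemma Cmod_Csum_le (f : nat -> C) (n : nat) : Cmod (Csum f n) <= Rsum (fun k => Cmod (f k)) n.
Proof.
  induction n as [|n IH]; simpl; [rewrite Cmod_0; lra|].
  eapply Rle_trans; [apply Cmod_triangle|lra].
Qed.

Lemma is_CInt_sum (f : nat -> R -> C) (l : nat -> C) (a b : R) (n : nat) :
  (forall k, (k < n)%nat -> is_CInt (f k) a b (l k)) ->
  is_CInt (fun t => Csum (fun k => f k t) n) a b (Csum l n).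
Proof.
  induction n as [|n IH]; intros H; simpl; [apply is_CInt_zero|].
  apply is_CInt_plus; [apply IH; intros; apply H; lia|apply H; lia].
Qed.

Lemma Re_le_Cmod (z : C) : Re z <= Cmod z.
Proof. pose proof (Rmax_Cmod z). pose proof (Rmax_l (Rabs (fst z)) (Rabs (snd z))).
  pose proof (Rle_abs (Re z)). unfold Re in *; lra. Qed.

(** Pairing the integral with its own direction reduces the bound to a real integral,
    so no constant is lost. *)
Lemma is_CInt_norm_le (f : R -> C) (g : R -> R) (a b : R) (l : C) (m : R) :
  a <= b -> (forall t, a < t < b -> Cmod (f t) <= g t) ->
  is_CInt f a b l -> is_RInt g a b m -> Cmod l <= m.
Proof.
  intros Hab H Hl Hm.
  assert (H1 : is_RInt (fun t => Re (Cconj l * f t)%C) a b (Re (Cconj l * l)%C))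
    by exact (proj1 (is_CInt_scal (Cconj l) f a b l Hl)).
  assert (H2 : is_RInt (fun t => Cmod l * g t) a b (Cmod l * m))
    by exact (is_RInt_scal (V := R_NormedModule) g a b (Cmod l) m Hm).
  assert (H3 : Re (Cconj l * l)%C <= Cmod l * m).
  { apply (is_RInt_le _ _ a b _ _ Hab H1 H2). intros t Ht.
    eapply Rle_trans; [apply Re_le_Cmod|]. rewrite Cmod_mult, Cmod_conj.
    apply Rmult_le_compat_l; [apply Cmod_ge_0|apply H; lra]. }
  replace (Re (Cconj l * l)%C) with (Cmod l * Cmod l) in H3.
  - destruct (Cmod_ge_0 l) as [Hp|Hp].
    + apply Rmult_le_reg_l with (Cmod l); assumption.
    + rewrite <- Hp.
      apply (is_RInt_le _ _ a b _ _ Hab (is_RInt_zero a b) Hm). intros t Ht.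
      eapply Rle_trans; [apply Cmod_ge_0|apply H; lra].
  - pose proof (Cmod2_alt l) as E. replace (Cmod l * Cmod l) with (Cmod l ^ 2) by ring. rewrite E.
    rewrite Re_mult. simpl. unfold Re, Im; ring.
Qed.

Lemma is_CInt_norm_le_const (f : R -> C) (a b : R) (l : C) (M : R) :
  a <= b -> (forall t, a < t < b -> Cmod (f t) <= M) -> is_CInt f a b l -> Cmod l <= (b - a) * M.
Proof.
  intros Hab H Hl. apply (is_CInt_norm_le f (fun _ => M) a b); try assumption.
  apply @is_RInt_const.
Qed.

Lemma cderiv_bound (f df : R -> C) (a b M : R) :
  a <= b -> (forall t, a <= t <= b -> cderiv f t (df t)) -> (forall t, a <= t <= b -> ccont df t) ->
  (forall t, a <= t <= b -> Cmod (df t) <= M) -> Cmod (f b - f a) <= (b - a) * M.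
Proof.
  intros Hab Hd Hc HM. apply (is_CInt_norm_le_const df); [assumption|intros; apply HM; lra|].
  now apply is_CInt_derive.
Qed.

(** Differentiating under the integral sign: both sides have the same derivative in [d]. Two
    integrations are thereby exchanged, without double integrals. *)
Lemma RInt_exchange (F f : R -> R -> R) (g : R -> R) (a' a b c d : R) :
  a' < a -> a <= b -> c <= d ->
  (forall v x, a' < x -> is_derive (fun u => F u x) v (f v x)) ->
  (forall v x, a' < x -> continuity_2d_pt f v x) ->
  (forall v, ex_RInt (F v) a b) ->
  (forall v, is_RInt (f v) a b (g v)) ->
  (forall v, continuous g v) ->
  is_RInt g c d (RInt (F d) a b - RInt (F c) a b).
Proof.
  intros Ha Hab Hcd HF Hf Hex Hg Hgc.
  apply (is_RInt_derive (V := R_CompleteNormedModule) (fun v => RInt (F v) a b));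
    [|intros; apply Hgc].
  intros v _.
  replace (g v) with (RInt (fun x => Derive (fun u => F u x) v) a b).
  - apply is_derive_RInt_param.
    + exists (mkposreal 1 Rlt_0_1). intros u _ x. rewrite Rmin_left by assumption.
      intros Hx. eexists. apply HF; lra.
    + intros x. rewrite Rmin_left by assumption. intros Hx.
      apply continuity_2d_pt_ext_loc with f; [|apply Hf; lra].
      assert (Hd : 0 < x - a') by lra.
      exists (mkposreal _ Hd). simpl. intros u y _ Hy. symmetry. apply is_derive_unique, HF.
      apply Rabs_lt_between in Hy. lra.
    + exists (mkposreal 1 Rlt_0_1). intros u _. apply Hex.
  - rewrite <- (is_RInt_unique _ _ _ _ (Hg v)). apply RInt_ext.
    intros x. rewrite Rmin_left by assumption. intros Hx. apply is_derive_unique, HF; lra.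
Qed.

Definition clim (u : nat -> C) (l : C) : Prop :=
  is_lim_seq (fun n => Re (u n)) (Re l) /\ is_lim_seq (fun n => Im (u n)) (Im l).

Lemma clim_ext (u v : nat -> C) (l : C) : (forall n, u n = v n) -> clim u l -> clim v l.
Proof. intros H [H1 H2]; split; [eapply is_lim_seq_ext with (2 := H1)|eapply is_lim_seq_ext with (2 := H2)];
  intros n; simpl; now rewrite H. Qed.

Lemma clim_eq (u : nat -> C) (l m : C) : clim u l -> l = m -> clim u m.
Proof. now intros H <-. Qed.

Lemma clim_const (z : C) : clim (fun _ => z) z.
Proof. split; apply is_lim_seq_const. Qed.

Lemma clim_plus (u v : nat -> C) (l m : C) : clim u l -> clim v m -> clim (fun n => u n + v n)%C (l + m)%C.
Proof. intros [H1 H2] [H3 H4]; split; now apply is_lim_seq_plus'. Qed.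

Lemma clim_minus (u v : nat -> C) (l m : C) : clim u l -> clim v m -> clim (fun n => u n - v n)%C (l - m)%C.
Proof. intros [H1 H2] [H3 H4]; split; now apply is_lim_seq_minus'. Qed.

Lemma clim_mult (u v : nat -> C) (l m : C) : clim u l -> clim v m -> clim (fun n => u n * v n)%C (l * m)%C.
Proof.
  intros [H1 H2] [H3 H4]; split; [apply is_lim_seq_minus'|apply is_lim_seq_plus'];
    now apply is_lim_seq_mult'.
Qed.

Lemma clim_scal (z : C) (u : nat -> C) (l : C) : clim u l -> clim (fun n => z * u n)%C (z * l)%C.
Proof. intros; now apply clim_mult; [apply clim_const|]. Qed.

Lemma clim_real (u : nat -> R) (l : R) : is_lim_seq u l -> clim (fun n => RtoC (u n)) l.
Proof. intros H; split; [exact H|apply is_lim_seq_const]. Qed.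

Lemma clim_unique (u : nat -> C) (l m : C) : clim u l -> clim u m -> l = m.
Proof.
  intros [H1 H2] [H3 H4].
  apply is_lim_seq_unique in H1, H2, H3, H4. rewrite H1 in H3. rewrite H2 in H4.
  injection H3; injection H4; intros; now apply C_ext.
Qed.

Lemma clim_incr (u : nat -> C) (l : C) (k : nat) : clim u l <-> clim (fun n => u (n + k)%nat) l.
Proof.
  split; intros [H1 H2]; split.
  - now apply (is_lim_seq_incr_n (fun n => Re (u n))).
  - now apply (is_lim_seq_incr_n (fun n => Im (u n))).
  - now apply (is_lim_seq_incr_n (fun n => Re (u n)) k).
  - now apply (is_lim_seq_incr_n (fun n => Im (u n)) k).
Qed.

Lemma Cmod_le_ReIm (z : C) : Cmod z <= Rabs (Re z) + Rabs (Im z).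
Proof.
  replace z with (RtoC (Re z) + Ci * RtoC (Im z))%C at 1.
  - eapply Rle_trans; [apply Cmod_triangle|]. rewrite Cmod_mult, Cmod_Ci, !Cmod_R. lra.
  - apply C_ext; simpl; unfold Re, Im; ring.
Qed.

Lemma Rabs_Re_le (z : C) : Rabs (Re z) <= Cmod z.
Proof. pose proof (Rmax_Cmod z). pose proof (Rmax_l (Rabs (fst z)) (Rabs (snd z))). unfold Re; lra. Qed.

Lemma Rabs_Im_le (z : C) : Rabs (Im z) <= Cmod z.
Proof. pose proof (Rmax_Cmod z). pose proof (Rmax_r (Rabs (fst z)) (Rabs (snd z))). unfold Im; lra. Qed.

Lemma is_lim_seq_abs_le (u b : nat -> R) (l : R) :
  (forall n, Rabs (u n - l) <= b n) -> is_lim_seq b 0 -> is_lim_seq u l.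
Proof.
  intros H Hb.
  apply is_lim_seq_le_le with (u := fun n => l - b n) (w := fun n => l + b n).
  - intros n. specialize (H n). apply Rabs_le_between in H. lra.
  - replace (Finite l) with (Finite (l - 0)) by (f_equal; ring).
    apply is_lim_seq_minus'; [apply is_lim_seq_const|exact Hb].
  - replace (Finite l) with (Finite (l + 0)) by (f_equal; ring).
    apply is_lim_seq_plus'; [apply is_lim_seq_const|exact Hb].
Qed.

Lemma clim_le (u : nat -> C) (b : nat -> R) (l : C) :
  (forall n, Cmod (u n - l) <= b n) -> is_lim_seq b 0 -> clim u l.
Proof.
  intros H Hb; split; apply is_lim_seq_abs_le with b; try assumption; intros n.
  - rewrite <- Re_minus. eapply Rle_trans; [apply Rabs_Re_le|apply H].
  - rewrite <- Im_minus. eapply Rle_trans; [apply Rabs_Im_le|apply H].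
Qed.

Lemma clim_zero_le (u : nat -> C) (b : nat -> R) :
  (forall n, Cmod (u n) <= b n) -> is_lim_seq b 0 -> clim u 0.
Proof.
  intros H Hb. apply clim_le with b; [|exact Hb]. intros n. unfold Cminus. rewrite Copp_0, Cplus_0_r. apply H.
Qed.

Lemma clim_Cmod (u : nat -> C) (l : C) : clim u l -> is_lim_seq (fun n => Cmod (u n - l)) 0.
Proof.
  intros [H1 H2].
  apply is_lim_seq_le_le with (u := fun _ => 0) (w := fun n => Rabs (Re (u n) - Re l) + Rabs (Im (u n) - Im l)).
  - intros n; split; [apply Cmod_ge_0|]. apply (Cmod_le_ReIm (u n - l)).
  - apply is_lim_seq_const.
  - replace (Finite 0) with (Finite (Rabs (Re l - Re l) + Rabs (Im l - Im l)))
      by (f_equal; rewrite !Rminus_diag, Rabs_R0; ring).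
    apply is_lim_seq_plus';
      apply (is_lim_seq_abs _ (Finite _)); apply is_lim_seq_minus'; try assumption; apply is_lim_seq_const.
Qed.

Lemma clim_Cmod_le (u : nat -> C) (b : nat -> R) (l : C) (m : R) :
  clim u l -> is_lim_seq b m -> (forall n, Cmod (u n) <= b n) -> Cmod l <= m.
Proof.
  intros Hu Hb H.
  assert (H' := is_lim_seq_plus' _ _ _ _ (clim_Cmod _ _ Hu) Hb).
  assert (Hl : Rbar_le (Cmod l) (0 + m)).
  { apply (is_lim_seq_le (fun _ => Cmod l) (fun n => Cmod (u n - l) + b n)); [|apply is_lim_seq_const|exact H'].
    intros n. specialize (H n).
    replace l with (u n - (u n - l))%C at 1 by ring.
    eapply Rle_trans; [apply Cmod_triangle|]. rewrite Cmod_opp. lra. }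
  simpl in Hl. lra.
Qed.

Lemma clim_Csum (u : nat -> nat -> C) (l : nat -> C) (n : nat) :
  (forall j, (j < n)%nat -> clim (fun K => u K j) (l j)) -> clim (fun K => Csum (u K) n) (Csum l n).
Proof.
  induction n as [|n IH]; intros H; simpl; [apply clim_const|].
  apply clim_plus; [apply IH; intros; apply H; lia|apply H; lia].
Qed.

Lemma clim_Cexp (u : nat -> C) (l : C) : clim u l -> clim (fun n => Cexp (u n)) (Cexp l).
Proof.
  intros [H1 H2].
  assert (He : is_lim_seq (fun n => exp (Re (u n))) (exp (Re l))).
  { apply (is_lim_seq_continuous exp); [apply derivable_continuous_pt, derivable_pt_exp|exact H1]. }
  split; apply is_lim_seq_mult'; try exact He.
  - apply (is_lim_seq_continuous cos); [apply continuity_cos|exact H2].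
  - apply (is_lim_seq_continuous sin); [apply continuity_sin|exact H2].
Qed.

Lemma is_lim_seq_div_INR (M : R) : is_lim_seq (fun n => M / INR n) 0.
Proof.
  replace (Finite 0) with (Rbar_mult M 0) by (simpl; f_equal; ring).
  apply is_lim_seq_scal_l. apply (is_lim_seq_inv _ p_infty); [apply is_lim_seq_INR|discriminate].
Qed.

(** The bounds telescope, so the partial sums form a Cauchy sequence. *)
Lemma Csum_converges_telescope (f : nat -> C) (v : nat -> R) (K0 : nat) :
  (forall k, (K0 <= k)%nat -> Cmod (f k) <= v k - v (S k)) -> is_lim_seq v 0 ->
  exists l, clim (Csum f) l /\ forall m, (K0 <= m)%nat -> Cmod (l - Csum f m) <= v m.
Proof.
  intros H Hv.
  assert (HT : forall m n, (K0 <= m)%nat -> (m <= n)%nat -> Cmod (Csum f n - Csum f m) <= v m - v n).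
  { intros m n Hm Hn. induction Hn as [|n Hn IH].
    - unfold Cminus. rewrite Cplus_opp_r, Cmod_0. lra.
    - simpl Csum. replace (Csum f n + f n - Csum f m)%C with ((Csum f n - Csum f m) + f n)%C by ring.
      eapply Rle_trans; [apply Cmod_triangle|]. specialize (H n ltac:(lia)). lra. }
  assert (HC : forall (p : C -> R), (forall z w, Rabs (p z - p w) <= Cmod (z - w)) ->
     ex_finite_lim_seq (fun n => p (Csum f n))).
  { intros p Hp. apply ex_lim_seq_cauchy_corr. intros eps.
    assert (HN := Hv). apply is_lim_seq_spec in HN.
    assert (He : 0 < eps / 4) by (pose proof (cond_pos eps); lra).
    destruct (HN (mkposreal _ He)) as [N HN']. clear HN; rename HN' into HN. simpl in HN.
    set (M := Nat.max N K0).
    assert (HX : forall n, (M <= n)%nat -> Rabs (p (Csum f n) - p (Csum f M)) < eps / 2).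
    { intros n Hn. eapply Rle_lt_trans; [apply Hp|]. eapply Rle_lt_trans; [apply HT; unfold M in *; lia|].
      assert (H1 := HN M (Nat.le_max_l _ _)). assert (H2 := HN n ltac:(unfold M in *; lia)).
      rewrite Rminus_0_r in H1, H2. apply Rabs_lt_between in H1, H2. lra. }
    exists M. intros n m Hn Hm.
    pose proof (HX n Hn) as H1. pose proof (HX m Hm) as H2.
    apply Rabs_lt_between in H1, H2. apply Rabs_lt_between. lra. }
  destruct (HC Re) as [l1 H1].
  { intros z w. rewrite <- Re_minus. apply Rabs_Re_le. }
  destruct (HC Im) as [l2 H2].
  { intros z w. rewrite <- Im_minus. apply Rabs_Im_le. }
  assert (HL : clim (Csum f) (l1, l2)) by (split; assumption).
  exists (l1, l2). split; [exact HL|].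
  intros m Hm.
  apply (clim_Cmod_le (fun n => Csum f (n + m) - Csum f m)%C (fun n => v m - v (n + m)%nat)).
  - apply clim_minus; [|apply clim_const]. now apply clim_incr.
  - replace (Finite (v m)) with (Finite (v m - 0)) by (f_equal; ring).
    apply is_lim_seq_minus'; [apply is_lim_seq_const|now apply is_lim_seq_incr_n].
  - intros n. apply HT; lia.
Qed.

Lemma Csum_converges (f : nat -> C) (M : R) (K0 : nat) :
  (1 <= K0)%nat -> 0 <= M -> (forall k, (K0 <= k)%nat -> Cmod (f k) <= M / (INR k * INR (S k))) ->
  exists l, clim (Csum f) l /\ forall m, (K0 <= m)%nat -> Cmod (l - Csum f m) <= M / INR m.
Proof.
  intros HK HM H. apply (Csum_converges_telescope f (fun k => M / INR k)); [|apply is_lim_seq_div_INR].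
  intros k Hk. eapply Rle_trans; [now apply H|]. right. rewrite S_INR.
  assert (0 < INR k) by (apply lt_0_INR; lia). field. lra.
Qed.

Lemma Rsum_converges (f : nat -> R) (M : R) (K0 : nat) :
  (1 <= K0)%nat -> 0 <= M -> (forall k, (K0 <= k)%nat -> Rabs (f k) <= M / (INR k * INR (S k))) ->
  exists l : R, is_lim_seq (Rsum f) l /\ forall m, (K0 <= m)%nat -> Rabs (l - Rsum f m) <= M / INR m.
Proof.
  intros HK HM H. destruct (Csum_converges (fun k => RtoC (f k)) M K0 HK HM) as [l [[Hl _] Hb]].
  - intros k Hk. rewrite Cmod_R. now apply H.
  - exists (Re l). split.
    + apply is_lim_seq_ext with (2 := Hl). intros n. now rewrite <- RtoC_Rsum.
    + intros m Hm. eapply Rle_trans; [|exact (Hb m Hm)]. rewrite <- RtoC_Rsum.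
      exact (Rabs_Re_le (l - RtoC (Rsum f m))%C).
Qed.

Lemma Rsum_shift2 (f : nat -> R) (n : nat) :
  Rsum f (S (S n)) = f 0%nat + f 1%nat + Rsum (fun j => f (S (S j))) n.
Proof. induction n as [|n IH]; [simpl; ring|]. simpl in *. rewrite IH. ring. Qed.

Lemma Rsum_swap (f : nat -> nat -> R) (n m : nat) :
  Rsum (fun i => Rsum (f i) m) n = Rsum (fun j => Rsum (fun i => f i j) n) m.
Proof.
  induction n as [|n IH]; simpl.
  - induction m as [|m IH]; simpl; [reflexivity|rewrite <- IH; ring].
  - rewrite IH, <- Rsum_plus. reflexivity.
Qed.

Lemma is_RInt_Rsum (f : nat -> R -> R) (l : nat -> R) (a b : R) (n : nat) :
  (forall k, (k < n)%nat -> is_RInt (f k) a b (l k)) ->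
  is_RInt (fun t => Rsum (fun k => f k t) n) a b (Rsum l n).
Proof.
  induction n as [|n IH]; intros H; simpl; [apply is_RInt_zero|].
  apply @is_RInt_plus; [apply IH; intros; apply H; lia|apply H; lia].
Qed.

Lemma is_lim_seq_Rsum (u : nat -> nat -> R) (l : nat -> R) (n : nat) :
  (forall j, (j < n)%nat -> is_lim_seq (fun K => u K j) (l j)) ->
  is_lim_seq (fun K => Rsum (u K) n) (Rsum l n).
Proof.
  induction n as [|n IH]; intros H; simpl; [apply is_lim_seq_const|].
  apply is_lim_seq_plus'; [apply IH; intros; apply H; lia|apply H; lia].
Qed.

Lemma ccont_locally (f : R -> C) (t : R) :
  ccont f t <-> forall eps, 0 < eps -> locally t (fun u => Cmod (f u - f t) < eps).
Proof.
  split.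
  - intros [H1 H2] eps Heps. assert (He : 0 < eps / 2) by lra.
    assert (L1 := proj1 (filterlim_locally (fun u => Re (f u)) _) H1 (mkposreal _ He)).
    assert (L2 := proj1 (filterlim_locally (fun u => Im (f u)) _) H2 (mkposreal _ He)).
    generalize (filter_and _ _ L1 L2). apply filter_imp. intros u [B1 B2].
    change (Rabs (Re (f u) - Re (f t)) < eps / 2) in B1. change (Rabs (Im (f u) - Im (f t)) < eps / 2) in B2.
    eapply Rle_lt_trans; [apply Cmod_le_ReIm|]. rewrite Re_minus, Im_minus. lra.
  - intros H. split; apply filterlim_locally; intros eps; generalize (H eps (cond_pos eps)); apply filter_imp; intros u Hu.
    + exact (Rle_lt_trans _ _ _ (Rabs_Re_le (f u - f t)) Hu).
    + exact (Rle_lt_trans _ _ _ (Rabs_Im_le (f u - f t)) Hu).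
Qed.

(** * The optimal angle *)

(** A multiple of the logarithmic derivative of [csc (2 * (theta - p)) / cos p ^ (2 * N + 1)], cleared
    of denominators: the equation for the angle is the stationarity condition of the bound. *)
Definition angle_gap (N : nat) (theta p : R) : R :=
  4 * cos p * cos (2 * (theta - p)) + (4 * INR N + 2) * sin p * sin (2 * (theta - p)).

Lemma angle_equation_gap (N : nat) (theta p : R) :
  angle_equation N theta p <-> angle_gap N theta p = 0.
Proof.
  unfold angle_equation, angle_gap.
  replace (3 * p - 2 * theta) with (p - 2 * (theta - p)) by ring.
  replace (p - 2 * theta) with (- (p + 2 * (theta - p))) by ring.
  rewrite cos_neg, cos_minus, cos_plus. split; intros H; lra.
Qed.

Lemma angle_equation_opp (N : nat) (theta p : R) :
  angle_equation N (- theta) (- p) <-> angle_equation N theta p.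
Proof.
  unfold angle_equation.
  replace (3 * - p - 2 * - theta) with (- (3 * p - 2 * theta)) by ring.
  replace (- p - 2 * - theta) with (- (p - 2 * theta)) by ring.
  rewrite !cos_neg. reflexivity.
Qed.

(** Divided by [cos p * sin (2 * (theta - p))], the equation [angle_gap N theta p = 0] says that an
    increasing function of [p], a combination of [tan p] and [cot (2 * (theta - p))], vanishes. *)
Lemma angle_gap_unique_lt (N : nat) (theta p q : R) :
  0 < p < PI / 2 -> 0 < q < PI / 2 -> 0 < theta - p < PI / 2 -> 0 < theta - q < PI / 2 ->
  angle_gap N theta p = 0 -> angle_gap N theta q = 0 -> p < q -> False.
Proof.
  intros Hp Hq Htp Htq Ep Eq Hlt. unfold angle_gap in *.
  pose proof (pos_INR N) as HN.
  assert (C1 : 0 < cos p) by (apply cos_gt_0; lra).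
  assert (C2 : 0 < cos q) by (apply cos_gt_0; lra).
  assert (S1 : 0 < sin (2 * (theta - p))) by (apply sin_gt_0; lra).
  assert (S2 : 0 < sin (2 * (theta - q))) by (apply sin_gt_0; lra).
  assert (D1 : 0 < sin (2 * (theta - p) - 2 * (theta - q))) by (apply sin_gt_0; lra).
  assert (D2 : 0 < sin (q - p)) by (apply sin_gt_0; lra).
  rewrite sin_minus in D1, D2.
  set (cp := cos p) in *. set (cq := cos q) in *. set (sp := sin p) in *. set (sq := sin q) in *.
  set (a := sin (2 * (theta - p))) in *. set (b := sin (2 * (theta - q))) in *.
  set (u := cos (2 * (theta - p))) in *. set (v := cos (2 * (theta - q))) in *.
  assert (E : 4 * (a * v - u * b) * (cp * cq) + (4 * INR N + 2) * (a * b) * (sq * cp - cq * sp) = 0).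
  { transitivity ((4 * cq * v + (4 * INR N + 2) * sq * b) * (cp * a) - (4 * cp * u + (4 * INR N + 2) * sp * a) * (cq * b)); [ring|].
    rewrite Ep, Eq. ring. }
  assert (0 < (a * v - u * b) * (cp * cq)) by (repeat apply Rmult_lt_0_compat; lra).
  assert (0 < (4 * INR N + 2) * (a * b) * (sq * cp - cq * sp)) by (repeat apply Rmult_lt_0_compat; lra).
  lra.
Qed.

Lemma angle_gap_unique (N : nat) (theta p q : R) :
  0 < p < PI / 2 -> 0 < q < PI / 2 -> 0 < theta - p < PI / 2 -> 0 < theta - q < PI / 2 ->
  angle_gap N theta p = 0 -> angle_gap N theta q = 0 -> p = q.
Proof.
  intros. destruct (Rtotal_order p q) as [Hl|[He|Hl]]; [exfalso|exact He|exfalso].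
  - now apply (angle_gap_unique_lt N theta p q).
  - now apply (angle_gap_unique_lt N theta q p).
Qed.

Lemma angle_gap_exists (N : nat) (theta : R) :
  PI / 4 < theta < PI ->
  exists p, 0 < p < PI / 2 /\ theta - PI / 2 < p < theta - PI / 4 /\ angle_gap N theta p = 0.
Proof.
  intros Ht. pose proof PI_RGT_0 as HPI. pose proof (pos_INR N) as HN.
  set (a := Rmax 0 (theta - PI / 2)). set (b := Rmin (PI / 2) (theta - PI / 4)).
  assert (Ha : angle_gap N theta a < 0).
  { unfold a, angle_gap. unfold Rmax. destruct (Rle_dec 0 (theta - PI / 2)) as [H|H].
    - replace (2 * (theta - (theta - PI / 2))) with PI by field. rewrite cos_PI, sin_PI.
      assert (0 < cos (theta - PI / 2)) by (apply cos_gt_0; lra). lra.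
    - rewrite Rminus_0_r, cos_0, sin_0.
      assert (cos (2 * theta) < 0) by (apply cos_lt_0; lra). lra. }
  assert (Hb : 0 < angle_gap N theta b).
  { unfold b, angle_gap. unfold Rmin. destruct (Rle_dec (PI / 2) (theta - PI / 4)) as [H|H].
    - rewrite cos_PI2, sin_PI2.
      assert (0 < sin (2 * (theta - PI / 2))) by (apply sin_gt_0; lra). nra.
    - replace (2 * (theta - (theta - PI / 4))) with (PI / 2) by field. rewrite cos_PI2, sin_PI2.
      assert (0 < sin (theta - PI / 4)) by (apply sin_gt_0; lra). nra. }
  assert (Hab : a < b).
  { unfold a, b. apply Rmax_lub_lt; apply Rmin_glb_lt; lra. }
  destruct (IVT (angle_gap N theta) a b) as [p [Hp E]]; try assumption.
  { unfold angle_gap. intros x. apply continuity_pt_filterlim.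
    apply (ex_derive_continuous (V := R_NormedModule) (fun p => 4 * cos p * cos (2 * (theta - p)) +
      (4 * INR N + 2) * sin p * sin (2 * (theta - p)))). auto_derive. exact I. }
  assert (a <> p) by (intros ->; lra). assert (b <> p) by (intros ->; lra).
  assert (0 <= a /\ theta - PI / 2 <= a) by (unfold a; split; [apply Rmax_l|apply Rmax_r]).
  assert (b <= PI / 2 /\ b <= theta - PI / 4) by (unfold b; split; [apply Rmin_l|apply Rmin_r]).
  exists p. repeat split; try lra.
Qed.

Lemma optimal_angle (N : nat) (theta : R) :
  PI / 4 < theta < PI ->
  exists phi, unique (fun p : R =>
         0 < p < PI / 2 /\
         (3 * PI / 4 <= theta < PI -> - (PI / 2) + theta < p < PI / 2) /\
         (PI / 2 <= theta < 3 * PI / 4 ->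
            - (PI / 2) + theta < p < - (PI / 4) + theta) /\
         (PI / 4 < theta < PI / 2 -> 0 < p < - (PI / 4) + theta) /\
         angle_equation N theta p) phi /\
    0 < phi < PI / 2 /\ 0 < theta - phi < PI / 2.
Proof.
  intros Ht. pose proof PI_RGT_0 as HPI.
  destruct (angle_gap_exists N theta Ht) as [p [Hp [Hp' E]]].
  exists p. repeat split; try lra; try (now apply angle_equation_gap).
  intros q [Hq [H1 [H2 [H3 Eq]]]].
  apply angle_equation_gap in Eq.
  apply (angle_gap_unique N theta); try assumption; try lra.
Qed.

Lemma optimal_angle_neg (N : nat) (theta : R) :
  - PI < theta < - (PI / 4) ->
  exists phi, unique (fun p : R =>
         - (PI / 2) < p < 0 /\
         (- PI < theta <= - (3 * PI / 4) -> - (PI / 2) < p < PI / 2 + theta) /\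
         (- (3 * PI / 4) < theta <= - (PI / 2) ->
            PI / 4 + theta < p < PI / 2 + theta) /\
         (- (PI / 2) < theta < - (PI / 4) -> PI / 4 + theta < p < 0) /\
         angle_equation N theta p) phi /\
    - (PI / 2) < phi < 0 /\ - (PI / 2) < theta - phi < 0.
Proof.
  intros Ht. destruct (optimal_angle N (- theta) ltac:(lra)) as [q [[[H1 [H2 [H3 [H4 E]]]] Hu] [Hq Hd]]].
  exists (- q). split; [split|lra].
  - repeat split; try lra; try (intros H; lra || (specialize (H2 ltac:(lra)); lra) ||
      (specialize (H3 ltac:(lra)); lra) || (specialize (H4 ltac:(lra)); lra)).
    apply angle_equation_opp. now rewrite Ropp_involutive.
  - intros p [K1 [K2 [K3 [K4 K5]]]].
    rewrite (Hu (- p)); [ring|]. repeat split; try lra; try (intros H; lra || (specialize (K2 ltac:(lra)); lra) ||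
      (specialize (K3 ltac:(lra)); lra) || (specialize (K4 ltac:(lra)); lra)).
    now apply angle_equation_opp.
Qed.

(** * The Fourier series of the second Bernoulli polynomial *)

Definition freq (k : nat) : R := 2 * PI * INR (S k).

Definition B2 (x : R) : R := x ^ 2 - x + 1 / 6.

Definition fourierB2 (K : nat) (x : R) : R := Rsum (fun k => 4 * cos (freq k * x) / freq k ^ 2) K.

Lemma freq_pos (k : nat) : 0 < freq k.
Proof.
  unfold freq. apply Rmult_lt_0_compat; [pose proof PI_RGT_0; lra|apply lt_0_INR; lia].
Qed.

Lemma freq_ge (k : nat) : INR (S k) <= freq k / 2.
Proof.
  unfold freq. assert (1 <= INR (S k)) by (apply (le_INR 1); lia). pose proof PI2_1. nra.
Qed.

Lemma cos_freq_1 (k : nat) : cos (freq k) = 1.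
Proof.
  unfold freq. replace (2 * PI * INR (S k)) with (0 + 2 * INR (S k) * PI) by ring.
  now rewrite cos_period, cos_0.
Qed.

Lemma sin_freq_1 (k : nat) : sin (freq k) = 0.
Proof.
  unfold freq. replace (2 * PI * INR (S k)) with (0 + 2 * INR (S k) * PI) by ring.
  now rewrite sin_period, sin_0.
Qed.

Lemma Dirichlet_kernel (K : nat) (x : R) :
  sin (PI * x) * (1 + 2 * Rsum (fun k => cos (freq k * x)) K) = sin ((2 * INR K + 1) * (PI * x)).
Proof.
  induction K as [|K IH].
  - simpl. rewrite !Rmult_0_r, Rplus_0_l, Rplus_0_r, !Rmult_1_l. ring.
  - simpl Rsum. rewrite S_INR.
    replace ((2 * (INR K + 1) + 1) * (PI * x)) with (freq K * x + PI * x) by (unfold freq; rewrite S_INR; ring).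
    rewrite sin_plus.
    transitivity (sin (PI * x) * (1 + 2 * Rsum (fun k => cos (freq k * x)) K) + 2 * sin (PI * x) * cos (freq K * x)); [ring|].
    rewrite IH.
    replace ((2 * INR K + 1) * (PI * x)) with (freq K * x - PI * x) by (unfold freq; rewrite S_INR; ring).
    rewrite sin_minus. ring.
Qed.

Lemma is_derive_Rsum (f : nat -> R -> R) (l : nat -> R) (x : R) (K : nat) :
  (forall k, is_derive (f k) x (l k)) -> is_derive (fun y => Rsum (fun k => f k y) K) x (Rsum l K).
Proof.
  intros H; induction K as [|K IH]; simpl; [apply is_derive_const_R|].
  now apply @is_derive_plus.
Qed.

Definition fourier_error (K : nat) (x : R) : R := B2 x - fourierB2 K x.
Definition fourier_error' (K : nat) (x : R) : R :=
  2 * x - 1 + Rsum (fun k => 4 * sin (freq k * x) / freq k) K.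

Lemma is_derive_fourier_error (K : nat) (x : R) :
  is_derive (fourier_error K) x (fourier_error' K x).
Proof.
  unfold fourier_error, fourier_error', B2, fourierB2.
  replace (2 * x - 1 + Rsum (fun k => 4 * sin (freq k * x) / freq k) K)
    with ((2 * x - 1) - Rsum (fun k => - (4 * sin (freq k * x) / freq k)) K).
  - apply @is_derive_minus; [auto_derive; [exact I|ring]|].
    apply (is_derive_Rsum (fun k y => 4 * cos (freq k * y) / freq k ^ 2)). intros k.
    pose proof (freq_pos k). auto_derive; [exact I|]. field. lra.
  - rewrite (Rsum_ext _ (fun k => - 1 * (4 * sin (freq k * x) / freq k))) by (intros; ring).
    rewrite Rsum_scal. ring.
Qed.

Lemma is_derive_fourier_error' (K : nat) (x : R) :
  is_derive (fourier_error' K) x (2 * (1 + 2 * Rsum (fun k => cos (freq k * x)) K)).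
Proof.
  unfold fourier_error'.
  replace (2 * (1 + 2 * Rsum (fun k => cos (freq k * x)) K)) with (2 + Rsum (fun k => 4 * cos (freq k * x)) K)
    by (rewrite Rsum_scal; ring).
  apply @is_derive_plus; [auto_derive; [exact I|ring]|].
  apply (is_derive_Rsum (fun k y => 4 * sin (freq k * y) / freq k)). intros k.
  pose proof (freq_pos k). auto_derive; [exact I|]. field. lra.
Qed.

Lemma cos_odd_half (K : nat) : cos ((2 * INR K + 1) * (PI * (1 / 2))) = 0.
Proof.
  replace ((2 * INR K + 1) * (PI * (1 / 2))) with (INR K * PI + PI / 2) by field.
  rewrite cos_plus, cos_PI2, sin_PI2.
  assert (H : sin (INR K * PI) = 0); [|rewrite H; ring].
  induction K as [|K IH]; [simpl; rewrite Rmult_0_l; apply sin_0|].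
  rewrite S_INR, Rmult_plus_distr_r, Rmult_1_l, neg_sin, IH. ring.
Qed.

Lemma fourier_error'_half (K : nat) : fourier_error' K (1 / 2) = 0.
Proof.
  unfold fourier_error'.
  rewrite (Rsum_ext _ (fun k => 0 * 0)); [rewrite Rsum_scal; lra|].
  intros k _. replace (freq k * (1 / 2)) with (INR (S k) * PI) by (unfold freq; field).
  assert (H : forall n, sin (INR n * PI) = 0).
  { induction n as [|n IH]; [simpl; rewrite Rmult_0_l; apply sin_0|].
    rewrite S_INR, Rmult_plus_distr_r, Rmult_1_l, neg_sin, IH. ring. }
  rewrite H. pose proof (freq_pos k). field. lra.
Qed.

(** Away from the integers the derivative of the error is [O(1/K)]: the oscillating primitive
    of the Dirichlet kernel is extracted by one integration by parts. *)
Lemma fourier_error'_bound (K : nat) (d x : R) :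
  0 < d -> d <= x <= 1 / 2 ->
  Rabs (fourier_error' K x) <= 3 / sin (PI * d) ^ 2 / (2 * INR K + 1).
Proof.
  intros Hd Hx. set (M := 2 * INR K + 1).
  assert (HM : 1 <= M) by (unfold M; pose proof (pos_INR K); lra).
  pose proof PI_RGT_0 as HPI. pose proof PI2_1 as HP1.
  set (w := fun y => fourier_error' K y + 2 * cos (M * (PI * y)) / (M * PI * sin (PI * y))).
  set (dw := fun y => - (2 / M) * cos (M * (PI * y)) * cos (PI * y) / sin (PI * y) ^ 2).
  assert (Hs : forall y, d <= y <= 1 / 2 -> sin (PI * d) <= sin (PI * y)).
  { intros y Hy. apply sin_incr_1; nra. }
  assert (Hs0 : 0 < sin (PI * d)) by (apply sin_gt_0; nra).
  assert (Hs1 : sin (PI * d) <= 1) by apply SIN_bound.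
  assert (Hcos : forall u, Rabs (cos u) <= 1).
  { intros u. apply Rabs_le. destruct (COS_bound u); lra. }
  assert (HW : Rabs (w x - w (1 / 2)) <= (2 / M / sin (PI * d) ^ 2) * (1 / 2)).
  { assert (Hdw : forall y, d <= y <= 1 / 2 -> is_derive w y (dw y)).
    { intros y Hy. assert (Hsy := Hs y Hy).
      unfold w. replace (dw y) with (2 * (1 + 2 * Rsum (fun k => cos (freq k * y)) K) +
        (dw y - 2 * (1 + 2 * Rsum (fun k => cos (freq k * y)) K))) by ring.
      apply @is_derive_plus; [apply is_derive_fourier_error'|].
      replace (1 + 2 * Rsum (fun k => cos (freq k * y)) K) with (sin (M * (PI * y)) / sin (PI * y))
        by (unfold M; rewrite <- Dirichlet_kernel; field; lra).
      auto_derive; [apply Rmult_integral_contrapositive_currified; nra|].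
      unfold dw. field. repeat split; lra. }
    destruct (MVT_gen w (1 / 2) x dw) as [c [Hc E]].
    - intros y Hy. rewrite Rmin_right, Rmax_left in Hy by lra. apply Hdw; lra.
    - intros y Hy. rewrite Rmin_right, Rmax_left in Hy by lra.
      apply continuity_pt_filterlim, continuous_of_derive. eexists. apply Hdw; lra.
    - rewrite Rmin_right, Rmax_left in Hc by lra. rewrite E, Rabs_mult.
      assert (Hsc := Hs c ltac:(lra)).
      apply Rmult_le_compat; try apply Rabs_pos.
      + unfold dw, Rdiv. rewrite !Rabs_mult, Rabs_Ropp.
        rewrite (Rabs_pos_eq (2 * / M)) by (apply Rmult_le_pos; [lra|left; apply Rinv_0_lt_compat; lra]).
        rewrite (Rabs_pos_eq (/ _ ^ 2)) by (left; apply Rinv_0_lt_compat; nra).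
        apply Rmult_le_compat.
        * apply Rmult_le_pos; [|apply Rabs_pos]. apply Rmult_le_pos; [|apply Rabs_pos].
          apply Rmult_le_pos; [lra|left; apply Rinv_0_lt_compat; lra].
        * left; apply Rinv_0_lt_compat; nra.
        * assert (0 < / M) by (apply Rinv_0_lt_compat; lra).
          pose proof (Hcos (M * (PI * c))). pose proof (Hcos (PI * c)).
          pose proof (Rabs_pos (cos (M * (PI * c)))). pose proof (Rabs_pos (cos (PI * c))).
          rewrite Rmult_assoc. rewrite <- (Rmult_1_r (2 * / M)) at 2.
          apply Rmult_le_compat_l; [lra|]. nra.
        * apply Rinv_le_contravar; nra.
      + apply Rabs_le. lra. }
  assert (Hw0 : w (1 / 2) = 0).
  { unfold w. rewrite fourier_error'_half. unfold M. rewrite cos_odd_half. unfold Rdiv; ring. }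
  rewrite Hw0, Rminus_0_r in HW.
  assert (Hsx := Hs x Hx).
  replace (fourier_error' K x) with (w x - 2 * cos (M * (PI * x)) / (M * PI * sin (PI * x))) by (unfold w; ring).
  assert (HR : Rabs (2 * cos (M * (PI * x)) / (M * PI * sin (PI * x))) <= 2 / M / sin (PI * d) ^ 2).
  { unfold Rdiv. rewrite !Rabs_mult, (Rabs_pos_eq 2) by lra.
    rewrite (Rabs_pos_eq (/ _)) by (left; apply Rinv_0_lt_compat; apply Rmult_lt_0_compat; nra).
    replace (2 * / M * / sin (PI * d) ^ 2) with (2 * (1 * (/ M * / sin (PI * d) ^ 2))) by ring.
    rewrite Rmult_assoc. apply Rmult_le_compat_l; [lra|].
    apply Rmult_le_compat; [apply Rabs_pos| |apply Hcos|].
    - left; apply Rinv_0_lt_compat; apply Rmult_lt_0_compat; nra.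
    - rewrite <- Rinv_mult. apply Rinv_le_contravar; [apply Rmult_lt_0_compat; nra|].
      rewrite Rmult_assoc. apply Rmult_le_compat_l; [lra|]. 
      assert (sin (PI * d) ^ 2 <= sin (PI * d)) by nra. nra. }
  eapply Rle_trans; [apply Rabs_triang|]. rewrite Rabs_Ropp.
  replace (3 / sin (PI * d) ^ 2 / M) with (2 / M / sin (PI * d) ^ 2 * (1 / 2) + 2 / M / sin (PI * d) ^ 2)
    by (field; lra).
  lra.
Qed.

Lemma fourier_error_bound (K : nat) (d : R) :
  0 < d -> d <= 1 / 2 ->
  Rabs (fourier_error K d - fourier_error K (1 / 2)) <= 3 / sin (PI * d) ^ 2 / (2 * INR K + 1).
Proof.
  intros Hd Hd2.
  destruct (MVT_gen (fourier_error K) (1 / 2) d (fourier_error' K)) as [c [Hc E]].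
  - intros; apply is_derive_fourier_error.
  - intros y _. apply derivable_continuous_pt. exists (fourier_error' K y).
    apply is_derive_Reals, is_derive_fourier_error.
  - rewrite Rmin_right, Rmax_left in Hc by lra. rewrite E, Rabs_mult.
    rewrite <- Rmult_1_r. apply Rmult_le_compat; try apply Rabs_pos.
    + now apply fourier_error'_bound.
    + apply Rabs_le. lra.
Qed.

Lemma fourierB2_tail (x : R) : exists l : R, is_lim_seq (fun K => fourierB2 K x) l /\
  forall K, (1 <= K)%nat -> Rabs (l - fourierB2 K x) <= 1 / INR K.
Proof.
  destruct (Csum_converges (fun k => RtoC (4 * cos (freq k * x) / freq k ^ 2)) 1 1) as [l [Hl Hb]].
  - lia.
  - lra.
  - intros k Hk. rewrite Cmod_R. unfold Rdiv. rewrite Rabs_mult.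
    pose proof (freq_pos k) as Hf. pose proof (freq_ge k) as Hg.
    assert (H0 : 0 < INR k) by (apply lt_0_INR; lia). rewrite S_INR in *.
    rewrite (Rabs_pos_eq (/ _)) by (left; apply Rinv_0_lt_compat; nra).
    rewrite Rabs_mult, (Rabs_pos_eq 4) by lra.
    assert (Rabs (cos (freq k * x)) <= 1) by (apply Rabs_le; destruct (COS_bound (freq k * x)); lra).
    apply Rle_trans with (4 * / freq k ^ 2).
    + apply Rmult_le_compat_r; [left; apply Rinv_0_lt_compat; nra|lra].
    + apply Rmult_le_reg_r with (freq k ^ 2); [nra|]. rewrite Rmult_assoc, Rinv_l by nra.
      apply Rmult_le_reg_r with (INR k * (INR k + 1)); [nra|].
      replace (1 * / (INR k * (INR k + 1)) * freq k ^ 2 * (INR k * (INR k + 1))) with (freq k ^ 2) by (field; lra).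
      nra.
  - exists (Re l). split.
    + destruct Hl as [H _]. eapply is_lim_seq_ext with (2 := H). intros n. simpl. rewrite <- RtoC_Rsum. reflexivity.
    + intros K HK. specialize (Hb K HK). rewrite <- RtoC_Rsum in Hb.
      eapply Rle_trans; [|exact Hb]. exact (Rabs_Re_le (l - RtoC (fourierB2 K x))%C).
Qed.

(** The values at 1/4 and 1/2 are tied by [cos (2 PI k / 4) = 0] for odd [k]. Since the error is
    asymptotically constant in [x] on the open unit interval, this relation and the same one for
    [B2] force that constant to be zero. *)
Lemma fourierB2_duplication (K : nat) : 2 * fourierB2 (2 * K) (1 / 4) = / 2 * fourierB2 K (1 / 2).
Proof.
  unfold fourierB2. induction K as [|K IH]; [simpl; ring|].
  replace (2 * S K)%nat with (S (S (2 * K))) by lia.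
  change (2 * (Rsum (fun k => 4 * cos (freq k * (1 / 4)) / freq k ^ 2) (2 * K) +
    4 * cos (freq (2 * K) * (1 / 4)) / freq (2 * K) ^ 2 +
    4 * cos (freq (S (2 * K)) * (1 / 4)) / freq (S (2 * K)) ^ 2) =
    / 2 * (Rsum (fun k => 4 * cos (freq k * (1 / 2)) / freq k ^ 2) K + 4 * cos (freq K * (1 / 2)) / freq K ^ 2)).
  assert (H1 : cos (freq (2 * K) * (1 / 4)) = 0).
  { rewrite <- (cos_odd_half K). f_equal. unfold freq. rewrite S_INR, mult_INR. simpl. field. }
  assert (H2 : freq (S (2 * K)) = 2 * freq K).
  { unfold freq. rewrite !S_INR, mult_INR. simpl. ring. }
  rewrite H1, H2. pose proof (freq_pos K).
  replace (2 * freq K * (1 / 4)) with (freq K * (1 / 2)) by field.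
  rewrite !Rmult_plus_distr_l, IH. field. split; [lra|]. apply Rgt_not_eq, freq_pos.
Qed.

Lemma is_lim_seq_odd_inv (c : R) : is_lim_seq (fun K => c / (2 * INR K + 1)) 0.
Proof.
  apply is_lim_seq_abs_le with (fun K => Rabs c / INR K + (if (K =? 0)%nat then Rabs c else 0)).
  - intros K. rewrite Rminus_0_r. unfold Rdiv at 1. rewrite Rabs_mult.
    pose proof (Rabs_pos c). pose proof (pos_INR K).
    rewrite (Rabs_pos_eq (/ _)) by (left; apply Rinv_0_lt_compat; lra).
    destruct K as [|K].
    + simpl. unfold Rdiv. rewrite Rinv_0. replace (2 * 0 + 1) with 1 by ring. rewrite Rinv_1. lra.
    + rewrite Rplus_0_r. apply Rmult_le_compat_l; [assumption|].
      assert (0 < INR (S K)) by (apply lt_0_INR; lia).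
      apply Rinv_le_contravar; lra.
  - replace (Finite 0) with (Finite (0 + 0)) by (f_equal; ring).
    apply is_lim_seq_plus'; [apply is_lim_seq_div_INR|].
    apply (is_lim_seq_incr_1 (fun K => if (K =? 0)%nat then Rabs c else 0)).
    apply is_lim_seq_ext with (fun _ => 0); [reflexivity|apply is_lim_seq_const].
Qed.

Lemma fourier_error_half_lim : is_lim_seq (fun K => fourier_error K (1 / 2)) 0.
Proof.
  destruct (fourierB2_tail (1 / 2)) as [l [Hl _]].
  assert (HL : is_lim_seq (fun K => fourier_error K (1 / 2)) (B2 (1 / 2) - l))
    by (apply is_lim_seq_minus'; [apply is_lim_seq_const|exact Hl]).
  assert (H2 : is_lim_seq (fun K => fourier_error (2 * K) (1 / 2)) (B2 (1 / 2) - l)).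
  { apply (is_lim_seq_subseq (fun K => fourier_error K (1 / 2)) _ (fun K => (2 * K)%nat)); [|exact HL].
    apply eventually_subseq. intros n; lia. }
  assert (H3 : is_lim_seq (fun K => fourier_error (2 * K) (1 / 4) - fourier_error (2 * K) (1 / 2)) 0).
  { apply is_lim_seq_abs_le with (fun K => 3 / sin (PI * (1 / 4)) ^ 2 / (2 * INR (2 * K) + 1)).
    - intros K. rewrite Rminus_0_r. apply fourier_error_bound; lra.
    - apply (is_lim_seq_subseq (fun K => 3 / sin (PI * (1 / 4)) ^ 2 / (2 * INR K + 1)) 0 (fun K => (2 * K)%nat)).
      + apply eventually_subseq. intros n; lia.
      + apply is_lim_seq_odd_inv. }
  assert (H4 : is_lim_seq (fun K => / 4 * fourier_error K (1 / 2)) (0 + (B2 (1 / 2) - l))).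
  { apply is_lim_seq_ext with (2 := is_lim_seq_plus' _ _ _ _ H3 H2).
    intros K. pose proof (fourierB2_duplication K) as E. unfold fourier_error, B2 in *. lra. }
  assert (H5 := is_lim_seq_scal_l _ (/ 4) _ HL). simpl in H5.
  apply is_lim_seq_unique in H4. apply is_lim_seq_unique in H5. rewrite H4 in H5.
  injection H5 as H5. replace (Finite 0) with (Finite (B2 (1 / 2) - l)) by (f_equal; lra). exact HL.
Qed.

Lemma fourier_error_sym (K : nat) (x : R) : fourier_error K (1 - x) = fourier_error K x.
Proof.
  unfold fourier_error. f_equal; [unfold B2; ring|]. unfold fourierB2. apply Rsum_ext. intros k _.
  replace (freq k * (1 - x)) with (freq k - freq k * x) by ring.
  rewrite cos_minus, cos_freq_1, sin_freq_1. do 2 f_equal. ring.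
Qed.

Lemma fourierB2_bound (K : nat) (x : R) :
  (1 <= K)%nat -> 0 < x < 1 -> Rabs (B2 x - fourierB2 K x) <= 1 / INR K.
Proof.
  intros HK Hx. destruct (fourierB2_tail x) as [l [Hl Hb]].
  enough (B2 x = l) as -> by now apply Hb.
  assert (Hlow : forall y, 0 < y <= 1 / 2 -> is_lim_seq (fun K => fourier_error K y) 0).
  { intros y Hy.
    apply is_lim_seq_ext with (fun K => (fourier_error K y - fourier_error K (1 / 2)) + fourier_error K (1 / 2));
      [intros; ring|].
    replace (Finite 0) with (Finite (0 + 0)) by (f_equal; ring).
    apply is_lim_seq_plus'; [|apply fourier_error_half_lim].
    apply is_lim_seq_abs_le with (fun K => 3 / sin (PI * y) ^ 2 / (2 * INR K + 1)).
    - intros k. rewrite Rminus_0_r. apply fourier_error_bound; lra.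
    - apply is_lim_seq_odd_inv. }
  assert (H0 : is_lim_seq (fun K => fourier_error K x) 0).
  { destruct (Rle_or_lt x (1 / 2)) as [H|H]; [apply Hlow; lra|].
    apply is_lim_seq_ext with (fun K => fourier_error K (1 - x)); [intros; apply fourier_error_sym|].
    apply Hlow; lra. }
  assert (HL : is_lim_seq (fun K => fourier_error K x) (B2 x - l))
    by (apply is_lim_seq_minus'; [apply is_lim_seq_const|exact Hl]).
  apply is_lim_seq_unique in H0. apply is_lim_seq_unique in HL. rewrite H0 in HL.
  injection HL. lra.
Qed.

(** * Bernoulli numbers as sums over the frequencies *)

(** [bernoulli_term c j] is the contribution of the frequency [c] to [B_j / j!]: it is
    [(-1) ^ (j / 2 + 1) * 2 / c ^ j] for even [j >= 2] and vanishes otherwise. *)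
Fixpoint bernoulli_term (c : R) (j : nat) : R :=
  match j with
  | S (S i) => (match i with O => 2 | _ => - bernoulli_term c i end) / c ^ 2
  | _ => 0
  end.

Lemma bernoulli_term_even (c : R) (n : nat) :
  c <> 0 -> bernoulli_term c (2 * n + 2) = (-1) ^ n * 2 / c ^ (2 * n + 2).
Proof.
  intros Hc. induction n as [|n IH].
  - simpl. field. exact Hc.
  - replace (2 * S n + 2)%nat with (S (S (S (S (2 * n))))) by lia.
    replace (2 * n + 2)%nat with (S (S (2 * n))) in IH by lia.
    change (bernoulli_term c (S (S (S (S (2 * n)))))) with (- bernoulli_term c (S (S (2 * n))) / c ^ 2).
    rewrite IH. simpl. field. split; [now apply pow_nonzero|exact Hc].
Qed.

Lemma bernoulli_term_bound (c : R) (j : nat) : 1 <= c -> Rabs (bernoulli_term c j) <= 2 / c ^ 2.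
Proof.
  intros Hc.
  assert (H0 : 0 < / c ^ 2 <= 1).
  { split; [apply Rinv_0_lt_compat; nra|]. rewrite <- Rinv_1. apply Rinv_le_contravar; nra. }
  enough (H : Rabs (bernoulli_term c j) <= 2 / c ^ 2 /\ Rabs (bernoulli_term c (S j)) <= 2 / c ^ 2) by apply H.
  induction j as [|j [IH1 IH2]].
  - simpl. rewrite Rabs_R0. unfold Rdiv; simpl in H0; lra.
  - split; [exact IH2|].
    change (bernoulli_term c (S (S j))) with ((match j with O => 2 | _ => - bernoulli_term c j end) / c ^ 2).
    unfold Rdiv in *. rewrite Rabs_mult, (Rabs_pos_eq (/ c ^ 2)) by lra.
    apply Rmult_le_compat_r; [lra|].
    destruct j as [|j]; [rewrite Rabs_pos_eq; lra|]. rewrite Rabs_Ropp. nra.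
Qed.

Lemma freq_inv2_le (k : nat) : (1 <= k)%nat -> 1 / freq k ^ 2 <= / 4 / (INR k * INR (S k)).
Proof.
  intros Hk. pose proof (freq_pos k). pose proof (freq_ge k).
  assert (Hk0 : 0 < INR k) by (apply lt_0_INR; lia). rewrite S_INR in *.
  apply Rmult_le_reg_r with (freq k ^ 2); [nra|].
  replace (1 / freq k ^ 2 * freq k ^ 2) with 1 by (field; lra).
  apply Rmult_le_reg_r with (INR k * (INR k + 1)); [nra|].
  replace (/ 4 / (INR k * (INR k + 1)) * freq k ^ 2 * (INR k * (INR k + 1))) with (freq k ^ 2 / 4) by (field; lra).
  nra.
Qed.

Lemma bernoulli_term_summable (j : nat) :
  exists l : R, is_lim_seq (Rsum (fun k => bernoulli_term (freq k) j)) l.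
Proof.
  destruct (Rsum_converges (fun k => bernoulli_term (freq k) j) (/ 2) 1) as [l [H _]].
  - lia.
  - lra.
  - intros k Hk. pose proof (freq_inv2_le k Hk). pose proof (freq_ge k). pose proof (freq_pos k).
    assert (1 <= INR (S k)) by (apply (le_INR 1); lia).
    eapply Rle_trans; [apply bernoulli_term_bound; lra|].
    unfold Rdiv in *. lra.
  - now exists l.
Qed.

(** [cos_moment c m] is [(1 / m!)] times the integral of [x ^ m * cos (c x)] over the unit
    interval, for a frequency [c] that is a multiple of a full turn. *)
Definition cos_moment (c : R) (m : nat) : R :=
  / 2 * Rsum (fun j => bernoulli_term c j / INR (fact (S m - j))) (S m).

Lemma cos_moment_rec (c : R) (m : nat) :
  c <> 0 -> cos_moment c (S (S m)) = (/ INR (fact (S m)) - cos_moment c m) / c ^ 2.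
Proof.
  intros Hc. unfold cos_moment. rewrite Rsum_shift2.
  change (bernoulli_term c 0) with 0. change (bernoulli_term c 1) with 0.
  assert (E : forall n, (n <= S m)%nat ->
    Rsum (fun j => bernoulli_term c (S (S j)) / INR (fact (S (S (S m)) - S (S j)))) n =
    (if (n =? 0)%nat then 0 else 2 / c ^ 2 / INR (fact (S m))) +
    - / c ^ 2 * Rsum (fun j => bernoulli_term c j / INR (fact (S m - j))) n).
  { induction n as [|n IH]; intros Hn; [simpl; lra|]. cbn [Rsum]. rewrite IH by lia.
    replace (S (S (S m)) - S (S n))%nat with (S m - n)%nat by lia.
    pose proof (INR_fact_neq_0 (S m - n)). pose proof (INR_fact_neq_0 (S m)).
    destruct n as [|n].
    - replace (S m - 0)%nat with (S m) in * by lia. cbn [Nat.eqb Rsum bernoulli_term]. field. tauto.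
    - change (bernoulli_term c (S (S (S n)))) with (- bernoulli_term c (S n) / c ^ 2).
      cbn [Nat.eqb]. field. tauto. }
  rewrite E by lia. cbn [Nat.eqb]. pose proof (INR_fact_neq_0 (S m)). unfold Rdiv at 1 2. field. repeat split; try assumption; apply INR_fact_neq_0.
Qed.

Lemma is_RInt_cos_moment (k m : nat) :
  is_RInt (fun x => x ^ m * cos (freq k * x)) 0 1 (INR (fact m) * cos_moment (freq k) m).
Proof.
  pose proof (freq_pos k) as Hc. set (c := freq k) in *.
  assert (Hs1 : sin c = 0) by apply sin_freq_1. assert (Hc1 : cos c = 1) by apply cos_freq_1.
  assert (Hcont : forall (f : R -> R) x, ex_derive f x -> continuous f x)
    by (intros; now apply (ex_derive_continuous (V := R_NormedModule))).
  enough (H : is_RInt (fun x => x ^ m * cos (c * x)) 0 1 (INR (fact m) * cos_moment c m) /\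
    is_RInt (fun x => x ^ S m * cos (c * x)) 0 1 (INR (fact (S m)) * cos_moment c (S m))) by apply H.
  induction m as [|m [IH1 IH2]].
  - split.
    + apply (is_RInt_ext (V := R_NormedModule) (fun x => cos (c * x))); [intros; simpl; ring|].
      evar_last; [apply (is_RInt_derive (V := R_CompleteNormedModule) (fun x => sin (c * x) / c))|].
      * intros x _. auto_derive; [exact I|]. field; lra.
      * intros x _. apply Hcont. auto_derive; exact I.
      * unfold minus, plus, opp, cos_moment; simpl. rewrite !Rmult_1_r, Rmult_0_r, Hs1, sin_0. field. lra.
    + apply (is_RInt_ext (V := R_NormedModule) (fun x => x * cos (c * x))); [intros; simpl; ring|].
      evar_last; [apply (is_RInt_derive (V := R_CompleteNormedModule) (fun x => x * sin (c * x) / c + cos (c * x) / c ^ 2))|].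
      * intros x _. auto_derive; [exact I|]. field; lra.
      * intros x _. apply Hcont. auto_derive; exact I.
      * unfold minus, plus, opp, cos_moment; simpl. rewrite !Rmult_1_r, !Rmult_0_r, Hs1, Hc1, sin_0, cos_0. field. lra.
  - split; [exact IH2|].
    rewrite cos_moment_rec by lra.
    assert (HD : is_RInt (fun x => x ^ S (S m) * cos (c * x) + INR (S (S m)) * INR (S m) / c ^ 2 * (x ^ m * cos (c * x))) 0 1
              (INR (S (S m)) / c ^ 2)).
    { evar_last; [apply (is_RInt_derive (V := R_CompleteNormedModule)
        (fun x => x ^ S (S m) * sin (c * x) / c + INR (S (S m)) * x ^ S m * cos (c * x) / c ^ 2))|].
      - intros x _. auto_derive; [exact I|].
        cbn [Init.Nat.pred pow]. change (match m with O => 1 | S _ => INR m + 1 end) with (INR (S m)). rewrite !S_INR. field; lra.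
      - intros x _. apply Hcont. auto_derive; exact I.
      - unfold minus, plus, opp; cbn -[INR]. rewrite !Rmult_1_r, !pow1, !Rmult_0_l, !Rmult_0_r, Hs1, Hc1.
        unfold Rdiv. ring. }
    assert (HS := is_RInt_minus (V := R_NormedModule) _ _ _ _ _ _ HD
      (is_RInt_scal (V := R_NormedModule) _ _ _ (INR (S (S m)) * INR (S m) / c ^ 2) _ IH1)).
    evar_last.
    + eapply is_RInt_ext; [|exact HS]. intros x _. unfold minus, plus, opp, scal; simpl; unfold mult; simpl. ring.
    + unfold minus, plus, opp, scal; simpl; unfold mult; simpl.
      change (fact m + m * fact m)%nat with (fact (S m)).
      change (fact (S m) + (fact (S m) + m * fact (S m)))%nat with (fact (S (S m))).
      rewrite (fact_simpl (S m)), mult_INR. rewrite (fact_simpl m), mult_INR.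
      change (match m with O => 1 | S _ => INR m + 1 end) with (INR (S m)).
      pose proof (INR_fact_neq_0 m). assert (INR (S m) <> 0) by (apply not_0_INR; lia).
      rewrite (S_INR (S m)). field. repeat split; try assumption; lra.
Qed.

Lemma is_RInt_pow_unit (m : nat) : is_RInt (fun x => x ^ m) 0 1 (/ INR (S m)).
Proof. evar_last; [apply is_RInt_pow|]. rewrite pow1. unfold Rdiv. ring. Qed.

(** The Fourier series of [B2] is integrated term by term against [x ^ m]. *)
Lemma fourierB2_moment (m : nat) :
  is_lim_seq (fun K => Rsum (fun k => 4 / freq k ^ 2 * (INR (fact m) * cos_moment (freq k) m)) K)
    (/ INR (S (S (S m))) - / INR (S (S m)) + / 6 * / INR (S m)).
Proof.
  apply (is_lim_seq_incr_1 (fun K => Rsum _ K)).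
  apply is_lim_seq_abs_le with (fun K => 1 / INR (S K));
    [|apply (is_lim_seq_incr_1 (fun K => 1 / INR K)), is_lim_seq_div_INR].
  intros K. rewrite Rabs_minus_sym.
  assert (H1 : is_RInt (fun x => x ^ m * B2 x) 0 1 (/ INR (S (S (S m))) - / INR (S (S m)) + / 6 * / INR (S m))).
  { apply (is_RInt_ext (V := R_NormedModule) (fun x => x ^ S (S m) - x ^ S m + / 6 * x ^ m)).
    - intros x _. unfold B2. simpl. field.
    - apply (is_RInt_plus (V := R_NormedModule) (fun x => x ^ S (S m) - x ^ S m) (fun x => / 6 * x ^ m)).
      + apply (is_RInt_minus (V := R_NormedModule) (fun x => x ^ S (S m))); apply is_RInt_pow_unit.
      + apply (is_RInt_scal (V := R_NormedModule) (fun x => x ^ m)), is_RInt_pow_unit. }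
  assert (H2 : is_RInt (fun x => x ^ m * fourierB2 (S K) x) 0 1
     (Rsum (fun k => 4 / freq k ^ 2 * (INR (fact m) * cos_moment (freq k) m)) (S K))).
  { eapply is_RInt_ext; [|apply (is_RInt_Rsum (fun k x => 4 / freq k ^ 2 * (x ^ m * cos (freq k * x))))].
    - intros x _. unfold fourierB2. rewrite <- Rsum_scal. apply Rsum_ext. intros k _.
      pose proof (freq_pos k). field. lra.
    - intros k _. apply (is_RInt_scal (V := R_NormedModule) (fun x => x ^ m * cos (freq k * x))).
      apply is_RInt_cos_moment. }
  assert (H3 := is_RInt_minus (V := R_NormedModule) _ _ _ _ _ _ H1 H2).
  assert (H4 := is_RInt_const (V := R_NormedModule) 0 1 (1 / INR (S K))).
  assert (H5 := is_RInt_const (V := R_NormedModule) 0 1 (- (1 / INR (S K)))).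
  assert (HB : forall x, 0 < x < 1 -> Rabs (x ^ m * B2 x - x ^ m * fourierB2 (S K) x) <= 1 / INR (S K)).
  { intros x Hx. replace (x ^ m * B2 x - x ^ m * fourierB2 (S K) x) with (x ^ m * (B2 x - fourierB2 (S K) x)) by ring.
    rewrite Rabs_mult, <- (Rmult_1_l (1 / INR (S K))).
    apply Rmult_le_compat; try apply Rabs_pos; [|apply fourierB2_bound; [lia|lra]].
    rewrite Rabs_pos_eq by (apply pow_le; lra). rewrite <- (pow1 m). apply pow_incr; lra. }
  apply Rabs_le. split.
  - refine (Rle_trans _ _ _ _ (is_RInt_le _ _ 0 1 _ _ Rle_0_1 H5 H3 _)).
    + right. unfold scal; simpl; unfold mult; simpl. ring.
    + intros x Hx. specialize (HB x Hx). apply Rabs_le_between in HB. apply HB.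
  - refine (Rle_trans _ _ _ (is_RInt_le _ _ 0 1 _ _ Rle_0_1 H3 H4 _) _).
    + intros x Hx. specialize (HB x Hx). apply Rabs_le_between in HB. apply HB.
    + right. unfold scal; simpl; unfold mult; simpl. ring.
Qed.

Lemma freq_inv2_sum : is_lim_seq (fun K => Rsum (fun k => 1 / freq k ^ 2) K) (/ 24).
Proof.
  apply (is_lim_seq_incr_1 (fun K => Rsum _ K)).
  apply is_lim_seq_abs_le with (fun K => 1 / INR (S K));
    [|apply (is_lim_seq_incr_1 (fun K => 1 / INR K)), is_lim_seq_div_INR].
  intros K.
  (* the Fourier series is known on the open interval only, hence the limit at 0 *)
  assert (H0 : Rabs (fourier_error (S K) 0) <= 1 / INR (S K)).
  { assert (Hc : continuous (fun x => Rabs (fourier_error (S K) x)) 0).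
    { apply (continuous_comp (fourier_error (S K)) Rabs); [|apply continuous_Rabs].
      apply continuous_of_derive. eexists. apply is_derive_fourier_error. }
    apply Rnot_lt_le. intros Hlt.
    destruct (Hc (fun y => 1 / INR (S K) < y) (open_gt _ _ Hlt)) as [eps He].
    pose proof (cond_pos eps) as Hp. set (x := Rmin (eps / 2) (1 / 2)).
    assert (Hx : 0 < x < 1 /\ x < eps).
    { unfold x. pose proof (Rmin_l (eps / 2) (1 / 2)). pose proof (Rmin_r (eps / 2) (1 / 2)).
      repeat split; try lra. apply Rmin_glb_lt; lra. }
    assert (Hb : ball 0 eps x).
    { change (Rabs (x - 0) < eps). rewrite Rminus_0_r, Rabs_pos_eq; lra. }
    specialize (He x Hb). simpl in He.
    assert (Hf := fourierB2_bound (S K) x ltac:(lia) ltac:(lra)). unfold fourier_error in He. simpl in *. lra. }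
  replace (fourier_error (S K) 0) with (- 4 * (Rsum (fun k => 1 / freq k ^ 2) (S K) - / 24)) in H0.
  - rewrite Rabs_mult in H0. rewrite (Rabs_left (- 4)) in H0 by lra.
    pose proof (Rabs_pos (Rsum (fun k => 1 / freq k ^ 2) (S K) - / 24)). lra.
  - unfold fourier_error, fourierB2, B2.
    rewrite (Rsum_ext (fun k => 4 * cos (freq k * 0) / freq k ^ 2) (fun k => 4 * (1 / freq k ^ 2))).
    + rewrite Rsum_scal. field.
    + intros k _. rewrite Rmult_0_r, cos_0. field. apply Rgt_not_eq, freq_pos.
Qed.

Lemma cos_moment_1 (c : R) : cos_moment c 1 = 0.
Proof. unfold cos_moment; simpl. field. Qed.

Lemma cos_moment_sum (m : nat) :
  (1 <= m)%nat ->
  is_lim_seq (fun K => Rsum (fun k => 2 * cos_moment (freq k) m) K)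
    (/ 2 / INR (fact m) - / INR (fact (S m))).
Proof.
  intros Hm. destruct m as [|[|m]]; [lia| |].
  - apply is_lim_seq_ext with (fun _ => 0).
    + intros K. rewrite (Rsum_ext _ (fun k => 0 * 0)) by (intros; rewrite cos_moment_1; ring).
      rewrite Rsum_scal. ring.
    + replace (Finite _) with (Finite 0); [apply is_lim_seq_const|]. f_equal. simpl. field.
  - assert (H1 := is_lim_seq_scal_l _ (2 / INR (fact (S m))) _ freq_inv2_sum).
    assert (H2 := is_lim_seq_scal_l _ (/ 2 / INR (fact m)) _ (fourierB2_moment m)).
    assert (H3 := is_lim_seq_minus' _ _ _ _ H1 H2).
    pose proof (INR_fact_neq_0 m) as Hf.
    pose proof (pos_INR m).
    match type of H3 with is_lim_seq _ (Finite ?x) => replace (Finite x)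
      with (Finite (/ 2 / INR (fact (S (S m))) - / INR (fact (S (S (S m)))))) in H3 end.
    + apply is_lim_seq_ext with (2 := H3). intros K. cbv beta.
      rewrite <- !Rsum_scal.
      replace (Rsum (fun k => 2 / INR (fact (S m)) * (1 / freq k ^ 2)) K) with
        (Rsum (fun k => 2 * cos_moment (freq k) (S (S m)) + / 2 / INR (fact m) *
           (4 / freq k ^ 2 * (INR (fact m) * cos_moment (freq k) m))) K).
      * rewrite Rsum_plus. ring.
      * apply Rsum_ext. intros k _. pose proof (freq_pos k).
        rewrite cos_moment_rec by lra. field. repeat split; try lra; apply INR_fact_neq_0.
    + f_equal. rewrite !fact_simpl, !mult_INR. rewrite !S_INR in *. field. lra.
Qed.

Definition bernoulli_sum (j : nat) : R := real (Lim_seq (Rsum (fun k => bernoulli_term (freq k) j))).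

Lemma is_lim_bernoulli_sum (j : nat) :
  is_lim_seq (Rsum (fun k => bernoulli_term (freq k) j)) (bernoulli_sum j).
Proof.
  destruct (bernoulli_term_summable j) as [l H]. unfold bernoulli_sum.
  now rewrite (is_lim_seq_unique _ _ H).
Qed.

Lemma bernoulli_sum_rec (m : nat) :
  (1 <= m)%nat ->
  Rsum (fun j => bernoulli_sum j / INR (fact (S m - j))) (S m) =
  / 2 / INR (fact m) - / INR (fact (S m)).
Proof.
  intros Hm.
  assert (H1 : is_lim_seq (fun K => Rsum (fun j => Rsum (fun k => bernoulli_term (freq k) j) K
      / INR (fact (S m - j))) (S m))
      (Rsum (fun j => bernoulli_sum j / INR (fact (S m - j))) (S m))).
  { apply is_lim_seq_Rsum. intros j _.
    apply is_lim_seq_mult'; [apply is_lim_bernoulli_sum|apply is_lim_seq_const]. }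
  assert (H2 := cos_moment_sum m Hm).
  apply is_lim_seq_unique in H1. apply is_lim_seq_unique in H2.
  assert (E : Lim_seq (fun K => Rsum (fun j => Rsum (fun k => bernoulli_term (freq k) j) K
      / INR (fact (S m - j))) (S m)) =
     Lim_seq (fun K => Rsum (fun k => 2 * cos_moment (freq k) m) K)).
  { apply Lim_seq_ext. intros K. unfold cos_moment.
    rewrite (Rsum_ext (fun k => 2 * _) (fun k => Rsum (fun j => bernoulli_term (freq k) j
       / INR (fact (S m - j))) (S m))) by (intros; field).
    rewrite Rsum_swap. apply Rsum_ext. intros j _.
    unfold Rdiv. rewrite Rmult_comm, <- Rsum_scal. apply Rsum_ext. intros; ring. }
  rewrite H1, H2 in E. now injection E.
Qed.

(** Both sides obey the same recursion: the right-hand side of [bernoulli_sum_rec] consists of the terms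
    of [B_0] and [B_1], where the two sequences differ. *)
Lemma bernoulli_eq_sum (m : nat) :
  (2 <= m)%nat -> bernoulli m = INR (fact m) * bernoulli_sum m.
Proof.
  assert (Hrec : forall n, (1 <= n)%nat ->
     Rsum (fun j => bernoulli j / INR (fact j) / INR (fact (S n - j))) (S n) = 0).
  { intros n Hn. pose proof (bernoulli_rec n Hn) as H.
    assert (E : forall f n, Rsum f (S n) = sum_f_R0 f n).
    { intros f k. induction k as [|k IHk]; [simpl; ring|]. rewrite tech5, <- IHk. reflexivity. }
    rewrite <- E in H.
    apply Rmult_eq_reg_l with (INR (fact (S n))); [|apply INR_fact_neq_0].
    rewrite <- Rsum_scal, Rmult_0_r, <- H. apply Rsum_ext. intros j Hj. unfold Binomial.C.
    field. split; apply INR_fact_neq_0. }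
  assert (B1 : bernoulli 1 = - / 2).
  { specialize (Hrec 1%nat (le_n 1)). simpl in Hrec. unfold bernoulli at 1 in Hrec. simpl in Hrec. lra. }
  assert (HB0 : bernoulli_sum 0 = 0 /\ bernoulli_sum 1 = 0).
  { assert (H : forall j, (forall k, bernoulli_term (freq k) j = 0) -> bernoulli_sum j = 0).
    { intros j Hj. unfold bernoulli_sum.
      rewrite (is_lim_seq_unique _ 0); [reflexivity|].
      apply is_lim_seq_ext with (fun _ => 0); [|apply is_lim_seq_const].
      intros K. rewrite (Rsum_ext _ (fun k => 0 * 0)) by (intros; rewrite Hj; ring). rewrite Rsum_scal; ring. }
    split; apply H; reflexivity. }
  induction m as [m IH] using (well_founded_induction lt_wf). intros Hm.
  pose proof (Hrec m ltac:(lia)) as H1. pose proof (bernoulli_sum_rec m ltac:(lia)) as H2.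
  cbn [Rsum] in H1, H2.
  replace (S m - m)%nat with 1%nat in * by lia. change (INR (fact 1)) with 1 in *.
  assert (E : Rsum (fun j => bernoulli j / INR (fact j) / INR (fact (S m - j))) m =
     Rsum (fun j => bernoulli_sum j / INR (fact (S m - j))) m
       + / INR (fact (S m)) - / 2 / INR (fact m)).
  { destruct m as [|[|m]]; try lia. rewrite !Rsum_shift2.
    destruct HB0 as [HB0 HB1]. rewrite HB0, HB1.
    replace (S (S (S m)) - 0)%nat with (S (S (S m))) by lia.
    replace (S (S (S m)) - 1)%nat with (S (S m)) by lia.
    rewrite bernoulli_0, B1. change (INR (fact 0)) with 1. change (INR (fact 1)) with 1.
    rewrite (Rsum_ext _ (fun j => bernoulli_sum (S (S j)) / INR (fact (S (S (S m)) - S (S j))))).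
    - field. split; apply INR_fact_neq_0.
    - intros j Hj. rewrite IH by lia. field. split; apply INR_fact_neq_0. }
  rewrite E in H1. pose proof (INR_fact_neq_0 m).
  apply Rmult_eq_reg_r with (/ INR (fact m)); [|now apply Rinv_neq_0_compat].
  replace (INR (fact m) * bernoulli_sum m * / INR (fact m)) with (bernoulli_sum m) by (field; assumption).
  unfold Rdiv in *. rewrite Rinv_1 in *. lra.
Qed.

Lemma bernoulli_even_lim (n : nat) :
  is_lim_seq (fun K => Rsum (fun k => 2 / freq k ^ (2 * n + 2)) K)
    ((-1) ^ n * bernoulli (2 * n + 2) / INR (fact (2 * n + 2))).
Proof.
  rewrite bernoulli_eq_sum by lia.
  pose proof (INR_fact_neq_0 (2 * n + 2)).
  replace ((-1) ^ n * (INR (fact (2 * n + 2)) * bernoulli_sum (2 * n + 2)) / INR (fact (2 * n + 2)))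
    with ((-1) ^ n * bernoulli_sum (2 * n + 2)) by (field; assumption).
  assert (H1 := is_lim_seq_scal_l _ ((-1) ^ n) _ (is_lim_bernoulli_sum (2 * n + 2))).
  apply is_lim_seq_ext with (2 := H1). intros K. cbv beta. rewrite <- Rsum_scal. apply Rsum_ext. intros k _.
  pose proof (freq_pos k). rewrite bernoulli_term_even by lra.
  assert (Hs : (-1) ^ n * (-1) ^ n = 1) by (rewrite <- pow_add; replace (n + n)%nat with (2 * n)%nat by lia; apply pow_1_even).
  unfold Rdiv. rewrite <- !Rmult_assoc, Hs. ring.
Qed.

(** * Laplace integrals along a ray *)

(** ** Exchange of integrations for complex integrands *)

Definition c2cont (f : R -> R -> C) (x y : R) : Prop :=
  continuity_2d_pt (fun u v => Re (f u v)) x y /\ continuity_2d_pt (fun u v => Im (f u v)) x y.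

Lemma c2cont_const (z : C) (x y : R) : c2cont (fun _ _ => z) x y.
Proof. split; apply continuity_2d_pt_const. Qed.

Lemma c2cont_fst (x y : R) : c2cont (fun u _ => RtoC u) x y.
Proof. split; [apply continuity_2d_pt_id1|apply (continuity_2d_pt_const x y 0)]. Qed.

Lemma c2cont_snd (x y : R) : c2cont (fun _ v => RtoC v) x y.
Proof. split; [apply continuity_2d_pt_id2|apply (continuity_2d_pt_const x y 0)]. Qed.

Lemma c2cont_plus (f g : R -> R -> C) (x y : R) :
  c2cont f x y -> c2cont g x y -> c2cont (fun u v => f u v + g u v)%C x y.
Proof. intros [H1 H2] [H3 H4]; split; [apply (continuity_2d_pt_plus (fun u v => Re (f u v)) (fun u v => Re (g u v)))
  |apply (continuity_2d_pt_plus (fun u v => Im (f u v)) (fun u v => Im (g u v)))]; assumption. Qed.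

Lemma c2cont_opp (f : R -> R -> C) (x y : R) : c2cont f x y -> c2cont (fun u v => - f u v)%C x y.
Proof. intros [H1 H2]; split; [apply (continuity_2d_pt_opp (fun u v => Re (f u v)))
  |apply (continuity_2d_pt_opp (fun u v => Im (f u v)))]; assumption. Qed.

Lemma c2cont_mult (f g : R -> R -> C) (x y : R) :
  c2cont f x y -> c2cont g x y -> c2cont (fun u v => f u v * g u v)%C x y.
Proof.
  intros [H1 H2] [H3 H4]; split.
  - apply (continuity_2d_pt_minus (fun u v => Re (f u v) * Re (g u v)) (fun u v => Im (f u v) * Im (g u v)));
      [apply (continuity_2d_pt_mult (fun u v => Re (f u v)) (fun u v => Re (g u v)))
      |apply (continuity_2d_pt_mult (fun u v => Im (f u v)) (fun u v => Im (g u v)))]; assumption.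
  - apply (continuity_2d_pt_plus (fun u v => Re (f u v) * Im (g u v)) (fun u v => Im (f u v) * Re (g u v)));
      [apply (continuity_2d_pt_mult (fun u v => Re (f u v)) (fun u v => Im (g u v)))
      |apply (continuity_2d_pt_mult (fun u v => Im (f u v)) (fun u v => Re (g u v)))]; assumption.
Qed.

Lemma c2cont_Cexp (f : R -> R -> C) (x y : R) : c2cont f x y -> c2cont (fun u v => Cexp (f u v)) x y.
Proof.
  intros [H1 H2].
  assert (He : continuity_2d_pt (fun u v => exp (Re (f u v))) x y).
  { apply (continuity_1d_2d_pt_comp exp (fun u v => Re (f u v))); [|exact H1].
    apply derivable_continuous_pt, derivable_pt_exp. }
  split.
  - apply (continuity_2d_pt_mult (fun u v => exp (Re (f u v))) (fun u v => cos (Im (f u v)))); [exact He|].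
    apply (continuity_1d_2d_pt_comp cos (fun u v => Im (f u v))); [apply continuity_cos|exact H2].
  - apply (continuity_2d_pt_mult (fun u v => exp (Re (f u v))) (fun u v => sin (Im (f u v)))); [exact He|].
    apply (continuity_1d_2d_pt_comp sin (fun u v => Im (f u v))); [apply continuity_sin|exact H2].
Qed.

Lemma CInt_exchange (F f : R -> R -> C) (g : R -> C) (a' a b d : R) (l : C) :
  a' < a -> a <= b -> 0 <= d ->
  (forall v x, a' < x -> cderiv (fun u => F u x) v (f v x)) ->
  (forall v x, a' < x -> c2cont f v x) ->
  (forall v x, a' < x -> ccont (F v) x) ->
  (forall v, is_CInt (f v) a b (g v)) ->
  (forall v, ccont g v) ->
  (forall x, F 0 x = 0) ->
  is_CInt (F d) a b l ->
  is_CInt g 0 d l.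
Proof.
  intros Ha Hab Hd HF Hf Hc Hg Hgc H0 [Hl1 Hl2].
  assert (Hex : forall v, exists m, is_CInt (F v) a b m).
  { intros v. apply ex_CInt; [assumption|]. intros t Ht. apply Hc; lra. }
  split.
  - evar_last.
    + apply (RInt_exchange (fun v x => Re (F v x)) (fun v x => Re (f v x)) (fun v => Re (g v)) a' a b 0 d);
        try assumption.
      * intros v x Hx. exact (proj1 (HF v x Hx)).
      * intros v x Hx. exact (proj1 (Hf v x Hx)).
      * intros v. destruct (Hex v) as [m [Hm _]]. eexists; exact Hm.
      * intros v. exact (proj1 (Hg v)).
      * intros v. exact (proj1 (Hgc v)).
    + rewrite (is_RInt_unique _ _ _ _ Hl1).
      rewrite (RInt_ext _ (fun _ => 0)) by (intros x _; rewrite H0; reflexivity).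
      rewrite (is_RInt_unique _ _ _ _ (is_RInt_zero a b)). ring.
  - evar_last.
    + apply (RInt_exchange (fun v x => Im (F v x)) (fun v x => Im (f v x)) (fun v => Im (g v)) a' a b 0 d);
        try assumption.
      * intros v x Hx. exact (proj2 (HF v x Hx)).
      * intros v x Hx. exact (proj2 (Hf v x Hx)).
      * intros v. destruct (Hex v) as [m [_ Hm]]. eexists; exact Hm.
      * intros v. exact (proj2 (Hg v)).
      * intros v. exact (proj2 (Hgc v)).
    + rewrite (is_RInt_unique _ _ _ _ Hl2).
      rewrite (RInt_ext _ (fun _ => 0)) by (intros x _; rewrite H0; reflexivity).
      rewrite (is_RInt_unique _ _ _ _ (is_RInt_zero a b)). ring.
Qed.

(** ** Gamma integrals *)

(** The recursion is integration by parts of [t ^ m * exp (- mu t)]. *)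
Fixpoint gamma_primitive (mu : R) (m : nat) (t : R) : R :=
  match m with
  | O => - exp (- mu * t) / mu
  | S n => - (t ^ S n * exp (- mu * t)) / mu + INR (S n) / mu * gamma_primitive mu n t
  end.

Lemma is_derive_gamma_primitive (mu : R) (m : nat) (t : R) :
  mu <> 0 -> is_derive (gamma_primitive mu m) t (t ^ m * exp (- mu * t)).
Proof.
  intros Hm. induction m as [|m IH].
  - simpl. auto_derive; [exact I|]. field; assumption.
  - cbn [gamma_primitive].
    replace (t ^ S m * exp (- mu * t)) with
      ((t ^ S m * exp (- mu * t) - INR (S m) / mu * (t ^ m * exp (- mu * t))) + INR (S m) / mu * (t ^ m * exp (- mu * t)))
      by ring.
    apply @is_derive_plus.
    + auto_derive; [exact I|].
      change (match m with O => 1 | S _ => INR m + 1 end) with (INR (S m)). cbn [Init.Nat.pred pow]. field. assumption.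
    + apply (is_derive_scal (gamma_primitive mu m)), IH.
Qed.

Lemma gamma_primitive_0 (mu : R) (m : nat) :
  mu <> 0 -> gamma_primitive mu m 0 = - (INR (fact m) / mu ^ S m).
Proof.
  intros Hm. induction m as [|m IH].
  - simpl. rewrite Rmult_0_r, exp_0. field; assumption.
  - cbn [gamma_primitive]. rewrite IH, fact_simpl, mult_INR. cbn [pow]. field. split; [now apply pow_nonzero|assumption].
Qed.

Lemma gamma_primitive_le (mu : R) (m : nat) (t : R) :
  0 < mu -> 0 <= t -> gamma_primitive mu m t <= - (t ^ m * exp (- mu * t) / mu).
Proof.
  intros Hm Ht. assert (Hi : 0 < / mu) by now apply Rinv_0_lt_compat.
  induction m as [|m IH]; cbn [gamma_primitive].
  - cbn [pow]. right. unfold Rdiv. ring.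
  - assert (gamma_primitive mu m t <= 0).
    { eapply Rle_trans; [exact IH|]. pose proof (exp_pos (- mu * t)). pose proof (pow_le t m Ht).
      unfold Rdiv. assert (0 <= t ^ m * exp (- mu * t) * / mu); [|lra].
      apply Rmult_le_pos; [apply Rmult_le_pos|]; lra. }
    assert (0 <= INR (S m) / mu) by (apply Rdiv_le_0_compat; [apply pos_INR|assumption]).
    unfold Rdiv in *. nra.
Qed.

Lemma is_RInt_gamma (mu : R) (m : nat) (V : R) :
  mu <> 0 -> is_RInt (fun t => t ^ m * exp (- mu * t)) 0 V
    (gamma_primitive mu m V + INR (fact m) / mu ^ S m).
Proof.
  intros Hm. evar_last.
  - apply (is_RInt_derive (V := R_CompleteNormedModule) (gamma_primitive mu m)); intros t _.
    + now apply is_derive_gamma_primitive.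
    + apply continuous_of_derive. auto_derive. exact I.
  - unfold minus, plus, opp; simpl. rewrite gamma_primitive_0 by assumption. simpl. ring.
Qed.

(** The integral of [s ^ m * exp (- mu s)] over [0, t], which is positive, is [fact m / mu ^ S m] minus
    a quantity at least [t ^ m * exp (- mu t) / mu]. *)
Lemma pow_exp_bound (mu : R) (m : nat) (t : R) :
  0 < mu -> 0 <= t -> t ^ m * exp (- mu * t) <= INR (fact m) / mu ^ m.
Proof.
  intros Hm Ht.
  assert (H1 := is_RInt_gamma mu m t ltac:(lra)).
  assert (H2 := is_RInt_le _ _ 0 t _ _ Ht (is_RInt_zero 0 t) H1).
  assert (H3 : 0 <= gamma_primitive mu m t + INR (fact m) / mu ^ S m).
  { apply H2. intros x Hx. apply Rmult_le_pos; [apply pow_le; lra|left; apply exp_pos]. }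
  pose proof (gamma_primitive_le mu m t Hm Ht) as H4.
  assert (H5 : t ^ m * exp (- mu * t) / mu <= INR (fact m) / mu ^ S m) by lra.
  apply Rmult_le_reg_r with (/ mu); [now apply Rinv_0_lt_compat|].
  replace (INR (fact m) / mu ^ m * / mu) with (INR (fact m) / mu ^ S m); [exact H5|].
  simpl. field. split; [lra|apply pow_nonzero; lra].
Qed.

Lemma is_lim_pow_exp (mu : R) (m : nat) :
  0 < mu -> is_lim_seq (fun n => INR n ^ m * exp (- mu * INR n)) 0.
Proof.
  intros Hm. apply (is_lim_seq_incr_1 (fun n => INR n ^ m * exp (- mu * INR n))).
  apply is_lim_seq_abs_le with (fun n => INR (fact (S m)) / mu ^ S m / INR (S n));
    [|apply (is_lim_seq_incr_1 (fun n => _ / INR n)), is_lim_seq_div_INR].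
  intros n. assert (H0 : 0 < INR (S n)) by (apply lt_0_INR; lia).
  rewrite Rminus_0_r, Rabs_pos_eq
    by (apply Rmult_le_pos; [apply pow_le; lra|left; apply exp_pos]).
  apply Rmult_le_reg_r with (INR (S n)); [assumption|].
  unfold Rdiv at 1. rewrite (Rmult_assoc _ (/ INR (S n))), Rinv_l, Rmult_1_r by lra.
  pose proof (pow_exp_bound mu (S m) (INR (S n)) Hm ltac:(lra)) as H. eapply Rle_trans; [|exact H]. right. cbn [pow]. ring.
Qed.

Fixpoint cgamma_primitive (a : C) (m : nat) (t : R) : C :=
  match m with
  | O => - Cexp (RtoC t * (- a)) / a
  | S n => - (RtoC t ^ S n * Cexp (RtoC t * (- a))) / a + INR (S n) / a * cgamma_primitive a n t
  end%C.

Lemma cderiv_cgamma_primitive (a : C) (m : nat) (t : R) :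
  a <> 0 -> cderiv (cgamma_primitive a m) t (RtoC t ^ m * Cexp (RtoC t * (- a)))%C.
Proof.
  intros Ha.
  assert (Hl : cderiv (fun u => RtoC u * (- a))%C t (- a)%C).
  { apply cderiv_scaled. }
  apply cderiv_Cexp in Hl. cbv beta in Hl.
  induction m as [|m IH].
  - apply (cderiv_eq _ _ (- (/ a) * (- a * Cexp (RtoC t * - a)))%C); [|simpl; field; exact Ha].
    assert (H := cderiv_scal (- (/ a)) _ _ _ Hl).
    assert (E : forall u, (- / a * Cexp (RtoC u * - a) = cgamma_primitive a 0 u)%C)
      by (intros u; cbn [cgamma_primitive]; field; exact Ha).
    exact (cderiv_ext _ _ _ _ E H).
  - cbn [cgamma_primitive].
    assert (H := cderiv_scal (- (/ a)) _ _ _ (cderiv_mult _ _ _ _ _ (cderiv_pow _ _ _ m (cderiv_id t)) Hl)).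
    assert (H' := cderiv_plus _ _ _ _ _ H (cderiv_scal (INR (S m) / a) _ _ _ IH)).
    eapply cderiv_eq.
    + eapply cderiv_ext; [|exact H']. intros u; cbv beta; field; exact Ha.
    + cbv beta. rewrite Cpow_S. field. exact Ha.
Qed.

Lemma cgamma_primitive_0 (a : C) (m : nat) :
  a <> 0 -> cgamma_primitive a m 0 = (- (INR (fact m) / a ^ S m))%C.
Proof.
  intros Ha. induction m as [|m IH].
  - cbn [cgamma_primitive]. rewrite Cmult_0_l, Cexp_0. simpl. field; assumption.
  - cbn [cgamma_primitive]. rewrite IH, fact_simpl, mult_INR, RtoC_mult, !Cpow_S. field.
    split; [now apply Cpow_nz|assumption].
Qed.

Lemma clim_pow_Cexp (a : C) (m : nat) :
  0 < Re a -> clim (fun n => RtoC (INR n) ^ m * Cexp (RtoC (INR n) * (- a)))%C 0.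
Proof.
  intros Ha. apply clim_zero_le with (fun n => INR n ^ m * exp (- Re a * INR n)); [|now apply is_lim_pow_exp].
  intros n. rewrite Cmod_mult, Cmod_pow, Cmod_R, Cmod_Cexp, Rabs_pos_eq by apply pos_INR.
  right. f_equal. f_equal. rewrite Re_mult, Re_opp, Re_RtoC, Im_RtoC. ring.
Qed.

Lemma clim_cgamma_primitive (a : C) (m : nat) :
  0 < Re a -> clim (fun n => cgamma_primitive a m (INR n)) 0.
Proof.
  intros Ha. assert (H0 : a <> 0) by (intros ->; simpl in Ha; lra).
  induction m as [|m IH].
  - eapply clim_ext; [|eapply clim_eq; [apply (clim_scal (- / a) _ _ (clim_pow_Cexp a 0 Ha))|]].
    + intros n. cbn [cgamma_primitive Cpow]. field. exact H0.
    + ring.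
  - eapply clim_ext; [|eapply clim_eq; [apply clim_plus;
      [apply (clim_scal (- / a) _ _ (clim_pow_Cexp a (S m) Ha))|apply (clim_scal (INR (S m) / a) _ _ IH)]|]].
    + intros n. cbn [cgamma_primitive]. field. exact H0.
    + ring.
Qed.

(** ** Integrals over the ray *)

(** The direction [exp (- i psi)]. With [psi = theta - phi] the exponential of [- z s], for [s] on this
    ray and [theta] the argument of [z], decays like [exp (- |z| |s| cos phi)]. *)
Definition ray (psi : R) : C := (cos psi, - sin psi).

Lemma Cmod_ray (psi : R) : Cmod (ray psi) = 1.
Proof.
  unfold Cmod, ray; simpl. replace (_ + _) with 1; [apply sqrt_1|].
  pose proof (sin2_cos2 psi) as H. unfold Rsqr in H. lra.
Qed.

Lemma ray_neq_0 (psi : R) : ray psi <> 0.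
Proof. apply Cmod_gt_0. rewrite Cmod_ray. lra. Qed.

(** The left-hand side is the distance from [- c ^ 2] to the line spanned by [ray psi ^ 2]. *)
Lemma denominator_bound (psi c v : R) :
  c ^ 2 * Rabs (sin (2 * psi)) <= Cmod ((v * ray psi) ^ 2 + c ^ 2)%C.
Proof.
  apply Rsqr_incr_0; [|apply Rmult_le_pos; [apply pow2_ge_0|apply Rabs_pos]|apply Cmod_ge_0].
  unfold Rsqr. replace (Cmod _ * Cmod _) with (Cmod ((v * ray psi) ^ 2 + c ^ 2)%C ^ 2) by ring.
  rewrite Cmod2_alt.
  replace (c ^ 2 * Rabs (sin (2 * psi)) * (c ^ 2 * Rabs (sin (2 * psi)))) with ((c ^ 2) ^ 2 * (Rabs (sin (2 * psi)) ^ 2)) by ring.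
  rewrite pow2_abs.
  replace (Re _) with (v ^ 2 * cos (2 * psi) + c ^ 2).
  - replace (Im _) with (- v ^ 2 * sin (2 * psi)).
    + pose proof (sin2_cos2 (2 * psi)) as H. unfold Rsqr in H.
      set (a := v ^ 2). set (b := c ^ 2). set (s := sin (2 * psi)) in *. set (t := cos (2 * psi)) in *.
      assert (E : (a * t + b) ^ 2 + (- a * s) ^ 2 = (a + b * t) ^ 2 + b ^ 2 * 1 - b ^ 2 * t ^ 2
         + (a ^ 2) * (s * s + t * t) - a ^ 2) by ring.
      rewrite E, H. assert (E2 : b ^ 2 * 1 - b ^ 2 * t ^ 2 = b ^ 2 * s ^ 2)
        by (rewrite <- H; ring).
      pose proof (pow2_ge_0 (a + b * t)). lra.
    + rewrite <- RtoC_pow, Im_plus, Im_RtoC. unfold ray. simpl. rewrite sin_2a. ring.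
  - rewrite <- RtoC_pow, Re_plus, Re_RtoC. unfold ray. simpl. rewrite cos_2a. ring.
Qed.

Lemma denominator_neq_0 (psi c v : R) :
  c <> 0 -> sin (2 * psi) <> 0 -> ((v * ray psi) ^ 2 + c ^ 2)%C <> 0.
Proof.
  intros Hc Hs. apply Cmod_gt_0. eapply Rlt_le_trans; [|apply denominator_bound].
  apply Rmult_lt_0_compat; [|now apply Rabs_pos_lt]. assert (0 < c²) by now apply Rsqr_pos_lt.
  rewrite <- Rsqr_pow2. assumption.
Qed.

(** The form [exp (- w s) * s / (s ^ 2 + c ^ 2) ds] on the ray [s = v * ray psi]: the Laplace
    representation of the cosine integrals of frequency [c], summed over the unit translates of [w]. *)
Definition laplace_integrand (psi c : R) (w : C) (v : R) : C :=
  (ray psi * Cexp (v * (- (w * ray psi))) * (v * ray psi / ((v * ray psi) ^ 2 + c ^ 2)))%C.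

Lemma ccont_laplace (psi c : R) (w : C) (t : R) :
  c <> 0 -> sin (2 * psi) <> 0 -> ccont (laplace_integrand psi c w) t.
Proof.
  intros Hc Hs. unfold laplace_integrand.
  apply ccont_mult.
  - apply (ccont_mult (fun _ => ray psi)); [apply ccont_const|].
    apply (ccont_Cexp (fun u => RtoC u * (- (w * ray psi)))%C), ccont_scaled.
  - apply (ccont_div (fun u => RtoC u * ray psi)%C (fun u => (RtoC u * ray psi) ^ 2 + RtoC c ^ 2)%C).
    + now apply denominator_neq_0.
    + apply ccont_scaled.
    + apply (ccont_plus (fun u => (RtoC u * ray psi) ^ 2)%C (fun _ => RtoC c ^ 2)%C);
        [apply ccont_pow, ccont_scaled|apply ccont_const].
Qed.

Lemma laplace_integrand_shift (psi c : R) (w : C) (v : R) :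
  (laplace_integrand psi c w v - laplace_integrand psi c (w + 1) v)%C =
  (ray psi * Cexp (v * (- (w * ray psi))) *
    (v * ray psi * (1 - Cexp (- (v * ray psi))) / ((v * ray psi) ^ 2 + c ^ 2)))%C.
Proof.
  unfold laplace_integrand.
  replace (v * - ((w + 1) * ray psi))%C with (v * (- (w * ray psi)) + (- (v * ray psi)))%C by ring.
  rewrite Cexp_plus. unfold Cdiv. ring.
Qed.

Lemma cos_exp_integral (k : nat) (s : C) :
  (s ^ 2 + freq k ^ 2)%C <> 0 ->
  is_CInt (fun x => RtoC (cos (freq k * x)) * Cexp (RtoC x * (- s)))%C 0 1
    (s * (1 - Cexp (- s)) / (s ^ 2 + freq k ^ 2))%C.
Proof.
  intros H0. set (c := freq k) in *.
  set (D := (s ^ 2 + c ^ 2)%C) in *.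
  set (P := fun x : R => ((RtoC (c * sin (c * x)) - s * RtoC (cos (c * x))) * Cexp (RtoC x * (- s)) / D)%C).
  replace (s * (1 - Cexp (- s)) / D)%C with (P 1 - P 0)%C.
  - apply is_CInt_derive; [lra| |].
    + intros t _. unfold P.
      assert (Hl : cderiv (fun u => RtoC u * (- s))%C t (- s)%C).
      { apply cderiv_scaled. }
      apply cderiv_Cexp in Hl. cbv beta in Hl.
      assert (H1 : cderiv (fun u => RtoC (c * sin (c * u))) t (RtoC (c * (c * cos (c * t)))))
        by (apply cderiv_real; auto_derive; [exact I|ring]).
      assert (H2 : cderiv (fun u => RtoC (cos (c * u))) t (RtoC (- (c * sin (c * t)))))
        by (apply cderiv_real; auto_derive; [exact I|ring]).
      assert (H3 := cderiv_mult _ _ _ _ _ (cderiv_minus _ _ _ _ _ H1 (cderiv_scal s _ _ _ H2)) Hl).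
      assert (H4 := cderiv_scal (/ D) _ _ _ H3).
      eapply cderiv_eq; [eapply cderiv_ext; [|exact H4]|].
      * intros u; cbv beta. unfold Cdiv. ring.
      * cbv beta. rewrite !RtoC_mult, RtoC_opp, RtoC_mult. unfold D. field. exact H0.
    + intros t _. apply ccont_mult.
      * apply ccont_of_derive. auto_derive; exact I.
      * apply (ccont_Cexp (fun u => RtoC u * (- s))%C), ccont_scaled.
  - unfold P.
    assert (E1 : sin (c * 1) = 0) by (rewrite Rmult_1_r; apply sin_freq_1).
    assert (E2 : cos (c * 1) = 1) by (rewrite Rmult_1_r; apply cos_freq_1).
    rewrite E1, E2, !Rmult_0_r, sin_0, cos_0, Rmult_0_r, Cmult_0_l, Cexp_0, Cmult_1_l.
    unfold Cdiv. ring.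
Qed.

(** On the ray, [1 / (x + w)] is the Laplace integral of [exp (- (x + w) s)]; the integral over [x] is
    then elementary. Truncating at [V] keeps all integrals proper. *)
Lemma cos_laplace_exchange (psi : R) (w : C) (k : nat) (V : R) (l : C) :
  0 < cos psi -> sin (2 * psi) <> 0 -> 0 < Re (w * ray psi)%C -> 0 <= V ->
  is_CInt (fun x => RtoC (cos (freq k * x)) / (RtoC x + w) * (1 - Cexp (V * (- ((RtoC x + w) * ray psi)))))%C 0 1 l ->
  is_CInt (fun v => laplace_integrand psi (freq k) w v - laplace_integrand psi (freq k) (w + 1) v)%C 0 V l.
Proof.
  intros Hc Hs Hw HV Hl.
  pose proof (freq_pos k) as Hf.
  assert (Hx : forall x, - (Re (w * ray psi)%C / cos psi) < x -> (RtoC x + w)%C <> 0).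
  { intros x Hx E. assert (E2 : Re ((RtoC x + w) * ray psi)%C = 0) by (rewrite E, Cmult_0_l; reflexivity).
    replace (Re ((RtoC x + w) * ray psi)%C) with (x * cos psi + Re (w * ray psi)%C) in E2
      by (unfold ray; simpl; unfold Re; simpl; ring).
    apply (Rmult_lt_compat_r (cos psi)) in Hx; [|assumption].
    replace (- (Re (w * ray psi)%C / cos psi) * cos psi) with (- Re (w * ray psi)%C) in Hx by (field; lra). lra. }
  apply (CInt_exchange
    (fun v x => RtoC (cos (freq k * x)) / (RtoC x + w) * (1 - Cexp (v * (- ((RtoC x + w) * ray psi)))))%C
    (fun v x => RtoC (cos (freq k * x)) * (ray psi * Cexp (v * (- ((RtoC x + w) * ray psi)))))%C
    _ (- (Re (w * ray psi)%C / cos psi)) 0 1 V l); try assumption; try lra.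
  - assert (0 < Re (w * ray psi)%C / cos psi) by now apply Rdiv_lt_0_compat. lra.
  - intros v x H. specialize (Hx x H).
    set (b := (- ((RtoC x + w) * ray psi))%C).
    assert (Hd : cderiv (fun u => RtoC u * b)%C v b).
    { apply cderiv_scaled. }
    apply cderiv_Cexp in Hd. cbv beta in Hd.
    eapply cderiv_eq; [apply cderiv_scal, cderiv_minus; [apply cderiv_const|exact Hd]|].
    unfold b. field. exact Hx.
  - intros v x _. apply c2cont_mult.
    + split; [|apply (continuity_2d_pt_const v x 0)].
      apply (continuity_1d_2d_pt_comp (fun y => cos (freq k * y)) (fun _ y => y)); [|apply continuity_2d_pt_id2].
      apply continuity_pt_comp with (f1 := fun y => freq k * y) (f2 := cos); [|apply continuity_cos].
      apply derivable_continuous_pt. apply derivable_pt_scal, derivable_pt_id.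
    + apply (c2cont_mult (fun _ _ => ray psi)); [apply c2cont_const|].
      apply (c2cont_Cexp (fun v y => RtoC v * (- ((RtoC y + w) * ray psi)))%C).
      apply (c2cont_mult (fun u _ => RtoC u)); [apply c2cont_fst|].
      apply (c2cont_opp (fun _ y => (RtoC y + w) * ray psi)%C).
      apply (c2cont_mult (fun _ y => RtoC y + w)%C (fun _ _ => ray psi)); [|apply c2cont_const].
      apply (c2cont_plus (fun _ y => RtoC y) (fun _ _ => w)); [apply c2cont_snd|apply c2cont_const].
  - intros v x H. specialize (Hx x H).
    assert (Hxw : ccont (fun y => RtoC y + w)%C x).
    { apply (ccont_plus (fun y => RtoC y) (fun _ => w)); [|apply ccont_const].
      apply (ccont_id x). }
    apply ccont_mult.
    + apply (ccont_div (fun y => RtoC (cos (freq k * y))) (fun y => RtoC y + w)%C); [exact Hx| |exact Hxw].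
      apply ccont_of_derive. auto_derive; exact I.
    + apply (ccont_minus (fun _ => RtoC 1)); [apply ccont_const|].
      apply (ccont_Cexp (fun y => RtoC v * (- ((RtoC y + w) * ray psi)))%C).
      apply (ccont_mult (fun _ => RtoC v)); [apply ccont_const|].
      apply ccont_ext with (fun y => (- ray psi) * (RtoC y + w))%C; [intros; ring|].
      apply (ccont_mult (fun _ => - ray psi)%C); [apply ccont_const|exact Hxw].
  - intros v.
    rewrite laplace_integrand_shift.
    assert (H0 := denominator_neq_0 psi (freq k) v ltac:(lra) Hs).
    assert (H := is_CInt_scal (ray psi * Cexp (v * (- (w * ray psi)))) _ _ _ _ (cos_exp_integral k (v * ray psi) H0)).
    apply is_CInt_ext with (3 := H); [lra|]. intros x _. cbv beta.
    replace (v * - ((x + w) * ray psi))%C with (v * (- (w * ray psi)) + x * (- (v * ray psi)))%C by ring.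
    rewrite Cexp_plus. ring.
  - intros v. apply ccont_minus; apply ccont_laplace; lra || assumption.
  - intros x. rewrite Cmult_0_l, Cexp_0. ring.
Qed.

Lemma geometric_expansion (s D : C) (c : R) (n : nat) :
  c <> 0 -> D = (s ^ 2 + c ^ 2)%C -> D <> 0 ->
  (s / D = Csum (fun j => RtoC ((-1) ^ j / c ^ (2 * j + 2)) * s ^ (2 * j + 1)) n
    + RtoC ((-1) ^ n / c ^ (2 * n)) * s ^ (2 * n + 1) / D)%C.
Proof.
  intros Hc HD H0. assert (Hc' : RtoC c <> 0) by (intros E; apply Hc; now apply RtoC_inj).
  induction n as [|n IH].
  - simpl. rewrite Rdiv_1_r. field. exact H0.
  - rewrite IH at 1. cbn [Csum]. rewrite <- Cplus_assoc. f_equal.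
    replace (2 * S n)%nat with (2 * n + 2)%nat by lia.
    replace (2 * n + 2 + 1)%nat with (2 + (2 * n + 1))%nat by lia.
    rewrite (Cpow_add_r s 2).
    rewrite !RtoC_div by (apply pow_nonzero; assumption).
    rewrite !RtoC_pow, (Cpow_add_r c (2 * n) 2), (Cpow_S (-1) n).
    assert (RtoC c ^ (2 * n) <> 0)%C by now apply Cpow_nz.
    assert (E : (s ^ 2)%C = (D - c ^ 2)%C) by (rewrite HD; ring).
    rewrite E. field. auto.
Qed.

Lemma Cmod_exp_ray (w : C) (psi v : R) :
  Cmod (Cexp (v * (- (w * ray psi)))) = exp (- Re (w * ray psi)%C * v).
Proof.
  rewrite Cmod_Cexp. f_equal. rewrite Re_mult, Re_opp, Re_RtoC, Im_RtoC. ring.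
Qed.

Definition laplace_moment (psi : R) (w : C) (m : nat) (V : R) : C :=
  (ray psi ^ S m * (cgamma_primitive (w * ray psi) m V + INR (fact m) / (w * ray psi) ^ S m))%C.

Lemma is_CInt_laplace_moment (psi : R) (w : C) (m : nat) (V : R) :
  w <> 0 -> 0 <= V ->
  is_CInt (fun v => ray psi * Cexp (v * (- (w * ray psi))) * (v * ray psi) ^ m)%C 0 V (laplace_moment psi w m V).
Proof.
  intros Hw HV. pose proof (ray_neq_0 psi) as Hr.
  assert (Ha : (w * ray psi)%C <> 0) by now apply Cmult_neq_0.
  assert (H : is_CInt (fun v => RtoC v ^ m * Cexp (RtoC v * (- (w * ray psi))))%C 0 V
     (cgamma_primitive (w * ray psi) m V - cgamma_primitive (w * ray psi) m 0)%C).
  { apply is_CInt_derive; [assumption| |].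
    - intros t _. now apply cderiv_cgamma_primitive.
    - intros t _. apply ccont_mult; [apply ccont_pow, (ccont_id t)|].
      apply (ccont_Cexp (fun u => RtoC u * (- (w * ray psi)))%C), ccont_scaled. }
  apply (is_CInt_scal (ray psi ^ S m)) in H.
  rewrite cgamma_primitive_0 in H by assumption.
  unfold laplace_moment.
  replace (cgamma_primitive (w * ray psi) m V + INR (fact m) / (w * ray psi) ^ S m)%C
    with (cgamma_primitive (w * ray psi) m V - - (INR (fact m) / (w * ray psi) ^ S m))%C by ring.
  apply is_CInt_ext with (3 := H); [assumption|]. intros t _. cbv beta. rewrite Cpow_mult_l, Cpow_S. ring.
Qed.

Lemma clim_laplace_moment (psi : R) (w : C) (m : nat) :
  0 < Re (w * ray psi)%C ->
  clim (fun n => laplace_moment psi w m (INR n)) (INR (fact m) / w ^ S m)%C.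
Proof.
  intros H. pose proof (ray_neq_0 psi) as Hr.
  assert (Hw : w <> 0) by (intros ->; rewrite Cmult_0_l in H; simpl in H; lra).
  eapply clim_eq.
  - apply clim_scal. apply clim_plus; [now apply clim_cgamma_primitive|apply clim_const].
  - rewrite Cpow_mult_l. field. split; now apply Cpow_nz.
Qed.

(** The remainder of the geometric sum is, up to sign, [s ^ (2 n + 1) / (c ^ (2 n) * (s ^ 2 + c ^ 2))].
    The tilt of the ray costs the factor [1 / |sin (2 psi)|] from the denominator and replaces [|w|] by
    [Re (w * ray psi)] in the gamma integral of the first omitted term. *)
Lemma laplace_remainder_bound (psi c : R) (w : C) (n : nat) (V : R) (A : C) :
  0 < c -> sin (2 * psi) <> 0 -> 0 < Re (w * ray psi)%C -> 0 <= V ->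
  is_CInt (laplace_integrand psi c w) 0 V A ->
  Cmod (A - Csum (fun j => RtoC ((-1) ^ j / c ^ (2 * j + 2)) * laplace_moment psi w (2 * j + 1) V)%C n) <=
  INR (fact (2 * n + 1)) / (c ^ (2 * n + 2) * Re (w * ray psi)%C ^ (2 * n + 2)) / Rabs (sin (2 * psi)).
Proof.
  intros Hc Hs Hmu HV HA.
  set (mu := Re (w * ray psi)%C) in *.
  assert (Hw : w <> 0) by (intros ->; unfold mu in Hmu; rewrite Cmult_0_l in Hmu; simpl in Hmu; lra).
  assert (Hs' : 0 < Rabs (sin (2 * psi))) by now apply Rabs_pos_lt.
  assert (HM : is_CInt (fun v => Csum (fun j => RtoC ((-1) ^ j / c ^ (2 * j + 2)) *
      (ray psi * Cexp (v * (- (w * ray psi))) * (v * ray psi) ^ (2 * j + 1)))%C n) 0 V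
      (Csum (fun j => RtoC ((-1) ^ j / c ^ (2 * j + 2)) * laplace_moment psi w (2 * j + 1) V)%C n)).
  { apply (is_CInt_sum (fun j v => RtoC ((-1) ^ j / c ^ (2 * j + 2)) *
      (ray psi * Cexp (v * (- (w * ray psi))) * (v * ray psi) ^ (2 * j + 1)))%C).
    intros j _. apply is_CInt_scal. now apply is_CInt_laplace_moment. }
  assert (HD := is_CInt_minus _ _ _ _ _ _ HA HM).
  assert (HG : is_RInt (fun t => / (c ^ (2 * n + 2) * Rabs (sin (2 * psi))) * (t ^ (2 * n + 1) * exp (- mu * t))) 0 V
      (/ (c ^ (2 * n + 2) * Rabs (sin (2 * psi))) *
        (gamma_primitive mu (2 * n + 1) V + INR (fact (2 * n + 1)) / mu ^ S (2 * n + 1))))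
    by exact (is_RInt_scal (V := R_NormedModule) _ _ _ _ _ (is_RInt_gamma mu (2 * n + 1) V ltac:(lra))).
  eapply Rle_trans; [apply (is_CInt_norm_le _ _ _ _ _ _ HV) with (2 := HD) (3 := HG)|].
  - intros v Hv.
    assert (H0 := denominator_neq_0 psi c v ltac:(lra) Hs).
    assert (E : (laplace_integrand psi c w v - Csum (fun j => RtoC ((-1) ^ j / c ^ (2 * j + 2)) *
        (ray psi * Cexp (v * (- (w * ray psi))) * (v * ray psi) ^ (2 * j + 1))) n)%C =
      (ray psi * Cexp (v * (- (w * ray psi))) *
        (RtoC ((-1) ^ n / c ^ (2 * n)) * (v * ray psi) ^ (2 * n + 1) / ((v * ray psi) ^ 2 + c ^ 2)))%C).
    { unfold laplace_integrand.
      rewrite (geometric_expansion (v * ray psi) _ c n ltac:(lra) eq_refl H0) at 1.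
      rewrite (Csum_ext (fun j => _ * (ray psi * _ * _))%C (fun j => (ray psi * Cexp (v * (- (w * ray psi)))) *
        (RtoC ((-1) ^ j / c ^ (2 * j + 2)) * (v * ray psi) ^ (2 * j + 1)))%C) by (intros; ring).
      rewrite Csum_scal. ring. }
    rewrite E. unfold Cdiv. rewrite !Cmod_mult, Cmod_ray, Cmod_exp_ray, Cmod_inv, Cmod_pow, Cmod_mult, Cmod_ray, !Cmod_R by exact H0.
    fold mu.
    rewrite (Rabs_pos_eq v) by lra. rewrite Rmult_1_r, Rmult_1_l.
    unfold Rdiv. rewrite Rabs_mult, pow_1_abs, Rmult_1_l.
    rewrite Rabs_pos_eq by (left; apply Rinv_0_lt_compat, pow_lt; lra).
    pose proof (denominator_bound psi c v) as Hb.
    assert (Hcs : 0 < c ^ 2 * Rabs (sin (2 * psi))) by (apply Rmult_lt_0_compat; [apply pow_lt|]; lra).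
    assert (Hi : / Cmod ((v * ray psi) ^ 2 + c ^ 2)%C <= / (c ^ 2 * Rabs (sin (2 * psi)))) by now apply Rinv_le_contravar.
    assert (Hcn : 0 < / c ^ (2 * n)) by (apply Rinv_0_lt_compat, pow_lt; lra).
    assert (Hv1 : 0 <= v ^ (2 * n + 1)) by (apply pow_le; lra).
    pose proof (exp_pos (- mu * v)) as He.
    apply Rle_trans with (exp (- mu * v) * (/ c ^ (2 * n) * v ^ (2 * n + 1) * / (c ^ 2 * Rabs (sin (2 * psi))))).
    + apply Rmult_le_compat_l; [lra|]. apply Rmult_le_compat_l; [|exact Hi]. apply Rmult_le_pos; lra.
    + right. rewrite (pow_add c). field. repeat split; try lra; apply pow_nonzero; lra.
  - pose proof (gamma_primitive_le mu (2 * n + 1) V Hmu HV) as Hg.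
    assert (0 <= V ^ (2 * n + 1) * exp (- mu * V) / mu).
    { apply Rdiv_le_0_compat; [|assumption]. apply Rmult_le_pos; [now apply pow_le|left; apply exp_pos]. }
    apply Rle_trans with (/ (c ^ (2 * n + 2) * Rabs (sin (2 * psi))) * (INR (fact (2 * n + 1)) / mu ^ S (2 * n + 1))).
    + apply Rmult_le_compat_l; [|lra]. left; apply Rinv_0_lt_compat, Rmult_lt_0_compat; [apply pow_lt|]; lra.
    + right. replace (S (2 * n + 1)) with (2 * n + 2)%nat by lia. field.
      repeat split; try lra; apply pow_nonzero; lra.
Qed.

(** After the exchange of integrations, the sum over [j] telescopes to the difference of the Laplace
    integrals at [z] and at [z + n]; [laplace_remainder_bound] expands the first one and, with an empty
    expansion, shows that the second one is small. *)
Lemma frequency_bound (psi : R) (z : C) (k n N : nat) (I : nat -> C) :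
  0 < cos psi -> sin (2 * psi) <> 0 -> 0 < Re (z * ray psi)%C ->
  (forall j, (j < n)%nat ->
     is_CInt (fun x => RtoC (cos (freq k * x)) / (RtoC x + (z + INR j)))%C 0 1 (I j)) ->
  Cmod (Csum I n - Csum (fun j => RtoC ((-1) ^ j / freq k ^ (2 * j + 2)) *
     (INR (fact (2 * j + 1)) / z ^ (2 * j + 2)))%C N) <=
  INR (fact (2 * N + 1)) / (freq k ^ (2 * N + 2) * Re (z * ray psi)%C ^ (2 * N + 2)) / Rabs (sin (2 * psi)) +
  1 / (freq k ^ 2 * (Re (z * ray psi)%C + INR n * cos psi) ^ 2) / Rabs (sin (2 * psi)).
Proof.
  intros Hc Hs Hz HI. pose proof (freq_pos k) as Hf. set (c := freq k) in *.
  assert (Hmu : forall j, Re ((z + INR j) * ray psi)%C = Re (z * ray psi)%C + INR j * cos psi).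
  { intros j. unfold ray. simpl. unfold Re; simpl. ring. }
  assert (Hmu0 : forall j, 0 < Re ((z + INR j) * ray psi)%C).
  { intros j. rewrite Hmu. pose proof (pos_INR j). nra. }
  set (F := fun (j m : nat) (x : R) => (RtoC (cos (c * x)) / (RtoC x + (z + INR j)) *
     (1 - Cexp (INR m * (- ((RtoC x + (z + INR j)) * ray psi)))))%C).
  assert (Hxw : forall j x, 0 <= x -> Re ((z + INR j) * ray psi)%C <= Re ((RtoC x + (z + INR j)) * ray psi)%C).
  { intros j x Hx. replace (Re ((RtoC x + (z + INR j)) * ray psi)%C) with (x * cos psi + Re ((z + INR j) * ray psi)%C)
      by (unfold ray; simpl; unfold Re; simpl; ring). nra. }
  assert (Hx0 : forall j x, 0 <= x -> (RtoC x + (z + INR j))%C <> 0).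
  { intros j x Hx E. specialize (Hxw j x Hx). rewrite E, Cmult_0_l in Hxw. change (Re (RtoC 0)) with 0 in Hxw. specialize (Hmu0 j). lra. }
  assert (Hcos : forall x, ccont (fun y => RtoC (cos (c * y))) x).
  { intros x. apply ccont_of_derive. auto_derive; exact Logic.I. }
  assert (Hxc : forall j x, ccont (fun y => RtoC y + (z + INR j))%C x).
  { intros j x. apply (ccont_plus (fun y => RtoC y) (fun _ => z + INR j)%C); [|apply ccont_const].
    apply (ccont_id x). }
  assert (HF : forall j m, is_CInt (F j m) 0 1 (CInt (F j m) 0 1)).
  { intros j m. apply CInt_correct; [lra|]. intros x Hx. unfold F. apply ccont_mult.
    - apply (ccont_div (fun y => RtoC (cos (c * y)))); [apply Hx0; lra|apply Hcos|apply Hxc].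
    - apply (ccont_minus (fun _ => RtoC 1)); [apply ccont_const|].
      apply (ccont_Cexp (fun y => RtoC (INR m) * (- ((RtoC y + (z + INR j)) * ray psi)))%C).
      apply (ccont_mult (fun _ => RtoC (INR m))); [apply ccont_const|].
      apply ccont_ext with (fun y => (- ray psi) * (RtoC y + (z + INR j)))%C; [intros; ring|].
      apply (ccont_mult (fun _ => - ray psi)%C); [apply ccont_const|apply Hxc]. }
  (* removing the truncation of the Laplace representation of 1 / (x + z + j) *)
  assert (Hlim : forall j, (j < n)%nat -> clim (fun m => CInt (F j m) 0 1) (I j)).
  { intros j Hj. set (mu := Re ((z + INR j) * ray psi)%C).
    apply clim_le with (fun m => / mu * (INR m ^ 0 * exp (- mu * INR m))).
    - intros m.
      assert (HD := is_CInt_minus _ _ _ _ _ _ (HF j m) (HI j Hj)).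
      eapply Rle_trans; [apply (is_CInt_norm_le_const _ _ _ _ (/ mu * exp (- mu * INR m))) with (3 := HD); [lra|]|].
      + intros x Hx. unfold F.
        replace (_ - _)%C with (- (RtoC (cos (c * x)) * / (RtoC x + (z + INR j)) * Cexp (INR m * (- ((RtoC x + (z + INR j)) * ray psi)))))%C
          by (unfold Cdiv; ring).
        rewrite Cmod_opp, !Cmod_mult, Cmod_exp_ray, Cmod_inv, Cmod_R by (apply Hx0; lra).
        specialize (Hxw j x ltac:(lra)). fold mu in Hxw. specialize (Hmu0 j). fold mu in Hmu0.
        assert (Hm1 : mu <= Cmod (RtoC x + (z + INR j))%C).
        { eapply Rle_trans; [exact Hxw|]. eapply Rle_trans; [apply Re_le_Cmod|].
          rewrite Cmod_mult, Cmod_ray. lra. }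
        assert (Hc1 : Rabs (cos (c * x)) <= 1) by (apply Rabs_le; destruct (COS_bound (c * x)); lra).
        assert (He : exp (- Re ((RtoC x + (z + INR j)) * ray psi)%C * INR m) <= exp (- mu * INR m)).
        { pose proof (pos_INR m). destruct (Req_dec (- Re ((RtoC x + (z + INR j)) * ray psi)%C * INR m) (- mu * INR m)) as [->|Hne]; [lra|].
          left. apply exp_increasing. nra. }
        assert (Hi : / Cmod (RtoC x + (z + INR j))%C <= / mu) by now apply Rinv_le_contravar.
        assert (0 < / Cmod (RtoC x + (z + INR j))%C) by (apply Rinv_0_lt_compat; lra).
        apply Rmult_le_compat; [apply Rmult_le_pos; [apply Rabs_pos|lra]|left; apply exp_pos| |exact He].
        rewrite <- (Rmult_1_l (/ mu)). apply Rmult_le_compat; try lra. apply Rabs_pos.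
      + simpl. lra.
    - replace (Finite 0) with (Rbar_mult (/ mu) 0) by (simpl; f_equal; ring).
      apply is_lim_seq_scal_l, is_lim_pow_exp, Hmu0. }
  set (A := fun (w : C) (m : nat) => CInt (laplace_integrand psi c w) 0 (INR m)).
  assert (HA : forall w m, is_CInt (laplace_integrand psi c w) 0 (INR m) (A w m)).
  { intros w m. apply CInt_correct; [apply pos_INR|]. intros; apply ccont_laplace; lra. }
  assert (Htel : forall m, Csum (fun j => CInt (F j m) 0 1) n = (A z m - A (z + INR n)%C m)%C).
  { intros m. clear -HF HA Hc Hs Hmu0 Hf. induction n as [|n IH].
    - simpl Csum. change (INR 0) with 0. rewrite Cplus_0_r. ring.
    - cbn [Csum]. rewrite IH.
      assert (E : CInt (F n m) 0 1 = (A (z + INR n)%C m - A (z + INR (S n))%C m)%C).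
      { apply (is_CInt_unique (fun v => laplace_integrand psi c (z + INR n) v - laplace_integrand psi c (z + INR n + 1) v)%C 0 (INR m)).
        - apply cos_laplace_exchange; try assumption; [apply Hmu0|apply pos_INR|]. apply HF.
        - rewrite S_INR, RtoC_plus, Cplus_assoc. apply is_CInt_minus; apply HA. }
      rewrite E. ring. }
  assert (HL : clim (fun m => Csum (fun j => CInt (F j m) 0 1) n - Csum (fun j => RtoC ((-1) ^ j / c ^ (2 * j + 2)) * laplace_moment psi z (2 * j + 1) (INR m)) N)%C
     (Csum I n - Csum (fun j => RtoC ((-1) ^ j / c ^ (2 * j + 2)) * (INR (fact (2 * j + 1)) / z ^ (2 * j + 2)))%C N)%C).
  { apply clim_minus; [now apply (clim_Csum (fun m j => CInt (F j m) 0 1))|].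
    apply (clim_Csum (fun m j => RtoC ((-1) ^ j / c ^ (2 * j + 2)) * laplace_moment psi z (2 * j + 1) (INR m))%C).
    intros j _. apply clim_scal. replace (2 * j + 2)%nat with (S (2 * j + 1)) by lia. now apply clim_laplace_moment. }
  refine (clim_Cmod_le _ (fun _ => _) _ _ HL (is_lim_seq_const _) _).
  intros m. rewrite Htel.
  replace (A z m - A (z + INR n)%C m - _)%C with
    ((A z m - Csum (fun j => RtoC ((-1) ^ j / c ^ (2 * j + 2)) * laplace_moment psi z (2 * j + 1) (INR m))%C N) - A (z + INR n)%C m)%C by ring.
  eapply Rle_trans; [apply Cmod_triangle|]. rewrite Cmod_opp. apply Rplus_le_compat.
  - apply laplace_remainder_bound; try assumption; [apply pos_INR|apply HA].
  - assert (H := laplace_remainder_bound psi c (z + INR n) 0 (INR m) (A (z + INR n)%C m) Hf Hs (Hmu0 n) (pos_INR m) (HA _ _)).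
    simpl Csum in H. unfold Cminus in H. rewrite Copp_0, Cplus_0_r, Hmu in H. exact H.
Qed.

(** * The expansion of the Euler-Maclaurin integrals *)

(** The coefficient of [z ^ (- (2 i + 2))] in the expansion of [log G (z + 1)], in the form in which
    the sum over the frequencies produces it. *)
Definition expansion_coef (i : nat) : R :=
  INR (fact (2 * i + 1)) * (bernoulli (2 * i + 4) / INR (fact (2 * i + 4))).

Lemma is_lim_expansion_coef (i : nat) :
  is_lim_seq (fun K => Rsum (fun k => - (2 / freq k ^ 2) * ((-1) ^ i / freq k ^ (2 * i + 2) * INR (fact (2 * i + 1)))) K)
    (expansion_coef i).
Proof.
  assert (H := is_lim_seq_scal_l _ (- (-1) ^ i * INR (fact (2 * i + 1))) _ (bernoulli_even_lim (S i))).
  replace (2 * S i + 2)%nat with (2 * i + 4)%nat in H by lia.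
  unfold expansion_coef. simpl Rbar_mult in H.
  replace (INR (fact (2 * i + 1)) * (bernoulli (2 * i + 4) / INR (fact (2 * i + 4)))) with
    (- (-1) ^ i * INR (fact (2 * i + 1)) * ((-1) ^ S i * bernoulli (2 * i + 4) / INR (fact (2 * i + 4)))).
  - apply is_lim_seq_ext with (2 := H). intros K. cbv beta. rewrite <- Rsum_scal. apply Rsum_ext. intros k _.
    pose proof (freq_pos k). replace (2 * i + 4)%nat with (2 + (2 * i + 2))%nat by lia. rewrite (pow_add _ 2).
    field. split; [apply pow_nonzero|]; lra.
  - assert (Hs : (-1) ^ i * (-1) ^ i = 1) by (rewrite <- pow_add; replace (i + i)%nat with (2 * i)%nat by lia; apply pow_1_even).
    cbn [pow]. unfold Rdiv. 
    transitivity (((-1) ^ i * (-1) ^ i) * INR (fact (2 * i + 1)) * (bernoulli (2 * i + 4) * / INR (fact (2 * i + 4)))); [ring|].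
    rewrite Hs. ring.
Qed.

Lemma is_lim_expansion_coef_abs (i : nat) :
  is_lim_seq (fun K => Rsum (fun k => 2 / freq k ^ (2 * i + 4) * INR (fact (2 * i + 1))) K)
    (Rabs (expansion_coef i)).
Proof.
  assert (H := is_lim_seq_abs _ _ (is_lim_expansion_coef i)). cbn [Rbar_abs] in H.
  apply is_lim_seq_ext with (2 := H). intros K. cbv beta.
  rewrite (Rsum_ext _ (fun k => - (-1) ^ i * (2 / freq k ^ (2 * i + 4) * INR (fact (2 * i + 1))))).
  - rewrite Rsum_scal, Rabs_mult, Rabs_Ropp, pow_1_abs, Rmult_1_l. apply Rabs_pos_eq.
    rewrite <- (Rmult_0_l (Rsum (fun _ => 0) K)), <- Rsum_scal.
    apply Rsum_le. intros k _. rewrite Rmult_0_l.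
    apply Rmult_le_pos; [|apply pos_INR]. apply Rdiv_le_0_compat; [lra|]. apply pow_lt, freq_pos.
  - intros k _. pose proof (freq_pos k).
    replace (2 * i + 4)%nat with (2 + (2 * i + 2))%nat by lia. rewrite (pow_add _ 2).
    field. split; [apply pow_nonzero|]; lra.
Qed.

(** The bounds for the single frequencies add up to a Bernoulli number, because all terms of
    [bernoulli_even_lim] have the same sign. The last term vanishes as [n] grows. *)
Lemma euler_maclaurin_bound (psi : R) (z : C) (n N : nat) (J : nat -> C) :
  0 < cos psi -> sin (2 * psi) <> 0 -> 0 < Re (z * ray psi)%C ->
  (forall j, (j < n)%nat -> is_CInt (fun x => RtoC (B2 x) / (RtoC x + (z + INR j)))%C 0 1 (J j)) ->
  Cmod (- (/ 2)%R * Csum J n - Csum (fun i => RtoC (expansion_coef i) / z ^ (2 * i + 2))%C N) <=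
  Rabs (expansion_coef N) / Re (z * ray psi)%C ^ (2 * N + 2) / Rabs (sin (2 * psi)) +
  Rabs (expansion_coef 0) / (Re (z * ray psi)%C + INR n * cos psi) ^ 2 / Rabs (sin (2 * psi)).
Proof.
  intros Hc Hs Hz HJ.
  set (mu := Re (z * ray psi)%C) in *.
  assert (Hs' : 0 < Rabs (sin (2 * psi))) by now apply Rabs_pos_lt.
  assert (Hxw : forall j x, 0 <= x -> mu <= Cmod (RtoC x + (z + INR j))%C).
  { intros j x Hx. eapply Rle_trans; [|rewrite <- (Rmult_1_r (Cmod _)), <- (Cmod_ray psi), <- Cmod_mult; apply Re_le_Cmod].
    replace (Re ((RtoC x + (z + INR j)) * ray psi)%C) with (x * cos psi + INR j * cos psi + mu)
      by (unfold mu, ray; simpl; unfold Re; simpl; ring).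
    pose proof (pos_INR j). nra. }
  assert (Hx0 : forall j x, 0 <= x -> (RtoC x + (z + INR j))%C <> 0).
  { intros j x Hx E. specialize (Hxw j x Hx). rewrite E, Cmod_0 in Hxw. lra. }
  set (I := fun k j => CInt (fun x => RtoC (cos (freq k * x)) / (RtoC x + (z + INR j)))%C 0 1).
  assert (HI : forall k j, is_CInt (fun x => RtoC (cos (freq k * x)) / (RtoC x + (z + INR j)))%C 0 1 (I k j)).
  { intros k j. apply CInt_correct; [lra|]. intros x Hx.
    apply (ccont_div (fun y => RtoC (cos (freq k * y))) (fun y => RtoC y + (z + INR j))%C); [apply Hx0; lra| |].
    - apply ccont_of_derive. auto_derive; exact Logic.I.
    - apply (ccont_plus (fun y => RtoC y) (fun _ => z + INR j)%C); [|apply ccont_const].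
      apply (ccont_id x). }
  (* term by term integration, from the uniform bound on the partial sums *)
  assert (HF : forall j, (j < n)%nat -> clim (fun K => Csum (fun k => RtoC (4 / freq k ^ 2) * I k j)%C K) (J j)).
  { intros j Hj. apply (clim_incr _ _ 1).
    apply clim_le with (fun K => 1 / INR (K + 1) * / mu).
    - intros K.
      assert (H1 : is_CInt (fun x => Csum (fun k => RtoC (4 / freq k ^ 2) * (RtoC (cos (freq k * x)) / (RtoC x + (z + INR j)))) (K + 1))%C 0 1
         (Csum (fun k => RtoC (4 / freq k ^ 2) * I k j)%C (K + 1))).
      { apply (is_CInt_sum (fun k x => RtoC (4 / freq k ^ 2) * (RtoC (cos (freq k * x)) / (RtoC x + (z + INR j))))%C).
        intros k _. apply is_CInt_scal, HI. }
      assert (H2 := is_CInt_minus _ _ _ _ _ _ H1 (HJ j Hj)).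
      eapply Rle_trans; [apply (is_CInt_norm_le_const _ _ _ _ (1 / INR (K + 1) * / mu)) with (3 := H2); [lra|]|lra].
      intros x Hx.
      replace (_ - _)%C with (RtoC (- (B2 x - fourierB2 (K + 1) x)) * / (RtoC x + (z + INR j)))%C.
      + rewrite Cmod_mult, Cmod_R, Rabs_Ropp, Cmod_inv by (apply Hx0; lra).
        apply Rmult_le_compat; [apply Rabs_pos| |apply fourierB2_bound; [lia|lra]|].
        * specialize (Hxw j x ltac:(lra)). left; apply Rinv_0_lt_compat; lra.
        * specialize (Hxw j x ltac:(lra)). apply Rinv_le_contravar; assumption.
      + rewrite (Csum_ext _ (fun k => / (RtoC x + (z + INR j)) * RtoC (4 * cos (freq k * x) / freq k ^ 2))%C).
        * rewrite Csum_scal, <- RtoC_Rsum. unfold fourierB2. rewrite RtoC_opp, RtoC_minus. unfold Cdiv. ring.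
        * intros k _. replace (4 * cos (freq k * x) / freq k ^ 2) with (4 / freq k ^ 2 * cos (freq k * x)) by (unfold Rdiv; ring).
          rewrite RtoC_mult. unfold Cdiv. ring.
    - replace (Finite 0) with (Rbar_mult 0 (/ mu)) by (simpl; f_equal; ring).
      apply is_lim_seq_scal_r. apply (is_lim_seq_incr_n (fun K => 1 / INR K)), is_lim_seq_div_INR. }
  set (P := fun k => Csum (fun i => RtoC ((-1) ^ i / freq k ^ (2 * i + 2)) *
     (INR (fact (2 * i + 1)) / z ^ (2 * i + 2)))%C N).
  assert (HL : clim (fun K => Csum (fun k => RtoC (- (2 / freq k ^ 2)) * (Csum (I k) n - P k)) K)%C
     (- (/ 2)%R * Csum J n - Csum (fun i => RtoC (expansion_coef i) / z ^ (2 * i + 2)) N)%C).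
  { assert (L1 : clim (fun K => - (/ 2)%R * Csum (fun j => Csum (fun k => RtoC (4 / freq k ^ 2) * I k j) K) n)%C (- (/ 2)%R * Csum J n)%C).
    { apply clim_scal. apply (clim_Csum (fun K j => Csum (fun k => RtoC (4 / freq k ^ 2) * I k j) K)%C). exact HF. }
    assert (L2 : clim (fun K => Csum (fun i => RtoC (Rsum (fun k => - (2 / freq k ^ 2) * ((-1) ^ i / freq k ^ (2 * i + 2) *
        INR (fact (2 * i + 1))))%R K) * / z ^ (2 * i + 2)) N)%C
        (Csum (fun i => RtoC (expansion_coef i) / z ^ (2 * i + 2)) N)%C).
    { apply (clim_Csum (fun K i => RtoC (Rsum _ K) * / z ^ (2 * i + 2))%C).
      intros i _. apply clim_mult; [|apply clim_const]. apply clim_real, is_lim_expansion_coef. }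
    apply clim_ext with (2 := clim_minus _ _ _ _ L1 L2). intros K. cbv beta.
    rewrite Csum_swap, <- Csum_scal.
    rewrite (Csum_ext (fun i => RtoC (Rsum _ K) * _)%C (fun i => Csum (fun k => RtoC (- (2 / freq k ^ 2)) *
      (RtoC ((-1) ^ i / freq k ^ (2 * i + 2)) * (INR (fact (2 * i + 1)) / z ^ (2 * i + 2))))%C K)).
    - rewrite (Csum_swap (fun i k => RtoC (- (2 / freq k ^ 2)) * _)%C), <- Csum_minus.
      apply Csum_ext. intros k _. rewrite !Csum_scal. fold (P k).
      replace (4 / freq k ^ 2) with (2 * (2 / freq k ^ 2)) by (unfold Rdiv; ring).
      rewrite RtoC_opp, RtoC_mult, RtoC_inv. field. lra.
    - intros i _. rewrite RtoC_Rsum, Cmult_comm, <- Csum_scal. apply Csum_ext. intros k _.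
      rewrite !RtoC_mult. unfold Cdiv. ring. }
  set (b1 := fun K => Rsum (fun k => 2 / freq k ^ (2 * N + 4) * INR (fact (2 * N + 1))) K).
  set (b0 := fun K => Rsum (fun k => 2 / freq k ^ (2 * 0 + 4) * INR (fact (2 * 0 + 1))) K).
  apply (clim_Cmod_le _ (fun K => b1 K / mu ^ (2 * N + 2) / Rabs (sin (2 * psi)) +
     b0 K / (mu + INR n * cos psi) ^ 2 / Rabs (sin (2 * psi))) _ _ HL).
  - apply is_lim_seq_plus'; repeat apply is_lim_seq_mult'; try apply is_lim_seq_const;
      apply is_lim_expansion_coef_abs.
  - intros K. eapply Rle_trans; [apply Cmod_Csum_le|].
    unfold b1, b0, Rdiv. rewrite !(Rmult_assoc (Rsum _ _)), !(Rmult_comm (Rsum _ _)), <- !Rsum_scal, <- Rsum_plus.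
    apply Rsum_le. intros k _. pose proof (freq_pos k).
    assert (Hmn : 0 < mu + INR n * cos psi) by (pose proof (pos_INR n); nra).
    rewrite Cmod_mult, Cmod_R, Rabs_Ropp, Rabs_pos_eq by (apply Rdiv_le_0_compat; [lra|apply pow_lt; lra]).
    eapply Rle_trans; [apply Rmult_le_compat_l; [apply Rdiv_le_0_compat; [lra|apply pow_lt; lra]|
      apply (frequency_bound psi z k n N (I k) Hc Hs Hz); intros; apply HI]|].
    fold mu. right. replace (2 * N + 4)%nat with (2 + (2 * N + 2))%nat by lia. rewrite (pow_add _ 2).
    change (INR (fact (2 * 0 + 1))) with 1. cbn [Nat.add Nat.mul].
    field. repeat split; try lra; apply pow_nonzero; lra.
Qed.

(** * Power series *)

Lemma sum_n_Csum (f : nat -> C) (n : nat) : sum_n (G := C_AbelianMonoid) f n = Csum f (S n).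
Proof.
  induction n as [|n IH].
  - rewrite sum_O. simpl. ring.
  - rewrite sum_Sn, IH. reflexivity.
Qed.

Lemma is_series_clim (f : nat -> C) (l : C) :
  @is_series C_AbsRing C_NormedModule f l -> clim (Csum f) l.
Proof.
  intros H. apply (clim_incr _ _ 1).
  assert (Hn : forall eps : posreal, exists N, forall n, (N <= n)%nat -> Cmod (Csum f (S n) - l) < eps).
  { intros eps.
    assert (H' := proj1 (filterlim_locally_ball_norm (U := C_NormedModule) (F := eventually) (sum_n f) l) H eps).
    destruct H' as [N HN]. exists N. intros n Hn. specialize (HN n Hn).
    unfold ball_norm in HN. rewrite sum_n_Csum in HN. exact HN. }
  assert (HL : is_lim_seq (fun n => Cmod (Csum f (S n) - l)) 0).
  { apply is_lim_seq_spec. intros eps. destruct (Hn eps) as [N HN]. exists N. intros n H1.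
    rewrite Rminus_0_r, Rabs_pos_eq by apply Cmod_ge_0. now apply HN. }
  apply clim_le with (2 := HL). intros n. rewrite Nat.add_1_r. lra.
Qed.

Lemma clim_is_series (f : nat -> C) (l : C) :
  clim (Csum f) l -> @is_series C_AbsRing C_NormedModule f l.
Proof.
  intros H. apply (clim_incr _ _ 1) in H. apply clim_Cmod in H. apply is_lim_seq_spec in H.
  apply (proj2 (filterlim_locally_ball_norm (U := C_NormedModule) (F := eventually) (sum_n f) l)).
  intros eps. destruct (H eps) as [N HN]. exists N. intros n Hn. specialize (HN n Hn).
  rewrite Rminus_0_r, Rabs_pos_eq in HN by apply Cmod_ge_0. rewrite Nat.add_1_r in HN.
  unfold ball_norm. rewrite sum_n_Csum. exact HN.
Qed.

Lemma pow_n_Cpow (z : C) (n : nat) : pow_n (K := C_Ring) z n = (z ^ n)%C.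
Proof. induction n as [|n IH]; [reflexivity|]. simpl. now rewrite IH. Qed.

Lemma is_pseries_clim (a : nat -> C) (z l : C) :
  @is_pseries C_AbsRing C_NormedModule a z l <-> clim (Csum (fun k => z ^ k * a k)%C) l.
Proof.
  unfold is_pseries. split; intros H.
  - apply is_series_clim in H. eapply clim_ext; [|exact H]. intros n. apply Csum_ext. intros k _.
    simpl. change (pow_n z k) with (pow_n (K := C_Ring) z k). now rewrite pow_n_Cpow.
  - apply clim_is_series. eapply clim_ext; [|exact H]. intros n. apply Csum_ext. intros k _.
    exact (f_equal (fun w => w * a k)%C (eq_sym (pow_n_Cpow z k))).
Qed.

Lemma clim_bounded (u : nat -> C) (l : C) : clim u l -> exists M, 0 < M /\ forall n, Cmod (u n) <= M.
Proof.
  intros H. assert (H' := clim_Cmod _ _ H).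
  apply is_lim_seq_spec in H'. destruct (H' (mkposreal 1 Rlt_0_1)) as [N HN]. simpl in HN.
  assert (HB : exists B, 0 <= B /\ forall n, (n < N)%nat -> Cmod (u n) <= B).
  { clear. induction N as [|N [B [HB H]]]; [exists 0; split; [lra|intros; lia]|].
    exists (B + Cmod (u N)). pose proof (Cmod_ge_0 (u N)). split; [lra|]. intros n Hn.
    destruct (Nat.eq_dec n N) as [->|Hne]; [lra|]. specialize (H n ltac:(lia)). lra. }
  destruct HB as [B [HB0 HB]]. exists (B + Cmod l + 1). pose proof (Cmod_ge_0 l). split; [lra|].
  intros n. destruct (Nat.lt_ge_cases n N) as [Hn|Hn]; [specialize (HB n Hn); lra|].
  specialize (HN n Hn). rewrite Rminus_0_r, Rabs_pos_eq in HN by apply Cmod_ge_0.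
  replace (u n) with ((u n - l) + l)%C by ring. eapply Rle_trans; [apply Cmod_triangle|]. lra.
Qed.

Lemma Rsum_geometric (q : R) (n : nat) : 0 <= q < 1 -> Rsum (fun k => q ^ k) n <= / (1 - q).
Proof.
  intros Hq. replace (Rsum (fun k => q ^ k) n) with ((1 - q ^ n) / (1 - q)).
  - apply Rmult_le_reg_r with (1 - q); [lra|]. unfold Rdiv. rewrite Rmult_assoc, Rinv_l by lra.
    pose proof (pow_le q n ltac:(lra)). lra.
  - induction n as [|n IH]; [simpl; field; lra|]. simpl. rewrite <- IH. field. lra.
Qed.

(** At distance [r / 2] from the centre the terms of the series are bounded, so the remainder is dominated by
    a geometric series. *)
Lemma pseries_remainder (a : nat -> C) (f : C -> C) (z0 : C) (r : R) :
  0 < r ->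
  (forall z, Cmod (z - z0) < r -> @is_pseries C_AbsRing C_NormedModule a (z - z0)%C (f z)) ->
  exists M, 0 < M /\ forall m z, Cmod (z - z0) < r / 4 ->
    Cmod (f z - Csum (fun k => (z - z0) ^ k * a k)%C m) <= M * (Cmod (z - z0) / (r / 2)) ^ m.
Proof.
  intros Hr H.
  assert (H0 := H (z0 + RtoC (r / 2))%C).
  replace (z0 + RtoC (r / 2) - z0)%C with (RtoC (r / 2)) in H0 by ring.
  rewrite Cmod_R, Rabs_pos_eq in H0 by lra. specialize (H0 ltac:(lra)).
  apply is_pseries_clim in H0.
  assert (Hterm : exists M, 0 < M /\ forall k, Cmod (a k) <= M / (r / 2) ^ k).
  { assert (Ht : clim (fun k => RtoC (r / 2) ^ k * a k)%C 0).
    { assert (H1 := proj1 (clim_incr _ _ 1) H0).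
      eapply clim_ext; [|eapply clim_eq; [apply (clim_minus _ _ _ _ H1 H0)|]].
      - intros n. cbv beta. rewrite Nat.add_1_r. simpl. ring.
      - ring. }
    destruct (clim_bounded _ _ Ht) as [M [HM Hb]]. exists M. split; [assumption|].
    intros k. specialize (Hb k). rewrite Cmod_mult, Cmod_pow, Cmod_R, Rabs_pos_eq in Hb by lra.
    assert (0 < (r / 2) ^ k) by (apply pow_lt; lra).
    apply Rle_div_r; [assumption|]. lra. }
  destruct Hterm as [M [HM Ha]]. exists (2 * M). split; [lra|]. intros m z Hz.
  set (q := Cmod (z - z0) / (r / 2)).
  pose proof (Cmod_ge_0 (z - z0)) as Hz0.
  assert (Hq : 0 <= q < 1 / 2).
  { unfold q. split; [apply Rdiv_le_0_compat; lra|]. apply Rlt_div_l; lra. }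
  assert (Hc := proj1 (is_pseries_clim _ _ _) (H z ltac:(lra))).
  apply (clim_incr _ _ m) in Hc.
  apply (clim_Cmod_le (fun n => Csum (fun k => (z - z0) ^ k * a k)%C (n + m) - Csum (fun k => (z - z0) ^ k * a k)%C m)%C (fun _ => 2 * M * q ^ m)).
  - apply clim_minus; [exact Hc|apply clim_const].
  - apply is_lim_seq_const.
  - intros n.
    assert (E : (Csum (fun k => (z - z0) ^ k * a k)%C (n + m) - Csum (fun k => (z - z0) ^ k * a k)%C m)%C =
       Csum (fun k => (z - z0) ^ (k + m) * a (k + m)%nat)%C n).
    { induction n as [|n IH]; simpl; [ring|]. rewrite <- IH. ring. }
    rewrite E. eapply Rle_trans; [apply Cmod_Csum_le|].
    apply Rle_trans with (Rsum (fun k => M * q ^ m * q ^ k) n).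
    + apply Rsum_le. intros k _. rewrite Cmod_mult, Cmod_pow.
      apply Rle_trans with (Cmod (z - z0) ^ (k + m) * (M / (r / 2) ^ (k + m))).
      * apply Rmult_le_compat_l; [now apply pow_le|apply Ha].
      * right. rewrite (Rmult_assoc M), <- pow_add, (Nat.add_comm m k). unfold q. generalize (r / 2). intros s.
        unfold Rdiv. rewrite Rpow_mult_distr, pow_inv. ring.
    + rewrite Rsum_scal. assert (Hg := Rsum_geometric q n ltac:(lra)).
      assert (/ (1 - q) <= 2) by (rewrite <- (Rinv_inv 2); apply Rinv_le_contravar; lra).
      assert (0 <= M * q ^ m) by (apply Rmult_le_pos; [lra|apply pow_le; lra]).
      apply Rle_trans with (M * q ^ m * 2); [apply Rmult_le_compat_l; [lra|]|right; ring]. exact (Rle_trans _ _ _ Hg H1).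
Qed.

Definition ccontinuous_at (f : C -> C) (z0 : C) : Prop :=
  forall eps, 0 < eps -> exists del, 0 < del /\ forall z, Cmod (z - z0) < del -> Cmod (f z - f z0) < eps.

Lemma analytic_at_value (a : nat -> C) (f : C -> C) (z0 : C) (r : R) :
  0 < r ->
  (forall z, Cmod (z - z0) < r -> @is_pseries C_AbsRing C_NormedModule a (z - z0)%C (f z)) ->
  f z0 = a 0%nat.
Proof.
  intros Hr H. assert (H0 : Cmod (z0 - z0) < r) by (unfold Cminus; rewrite Cplus_opp_r, Cmod_0; lra).
  apply H, is_pseries_clim, (clim_incr _ _ 1) in H0.
  apply (clim_unique _ _ _ H0). apply clim_ext with (fun _ => a 0%nat); [|apply clim_const].
  intros n. rewrite Nat.add_1_r. induction n as [|n IH].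
  - simpl. ring.
  - cbn [Csum] in *. rewrite <- IH. rewrite Cpow_S. unfold Cminus. rewrite Cplus_opp_r. ring.
Qed.

Lemma analytic_continuous (f : C -> C) (z0 : C) : analytic_at f z0 -> ccontinuous_at f z0.
Proof.
  intros [a [r [Hr H]]]. destruct (pseries_remainder a f z0 r Hr H) as [M [HM Hb]].
  intros eps He. exists (Rmin (r / 4) (eps * (r / 2) / M)).
  assert (0 < eps * (r / 2) / M) by (apply Rdiv_lt_0_compat; nra).
  split; [apply Rmin_glb_lt; lra|]. intros z Hz.
  pose proof (Rmin_l (r / 4) (eps * (r / 2) / M)). pose proof (Rmin_r (r / 4) (eps * (r / 2) / M)).
  specialize (Hb 1%nat z ltac:(lra)). rewrite (analytic_at_value a f z0 r Hr H).
  simpl in Hb. replace (0 + 1 * a 0%nat)%C with (a 0%nat) in Hb by ring.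
  eapply Rle_lt_trans; [exact Hb|]. rewrite Rmult_1_r.
  apply Rlt_le_trans with (M * ((eps * (r / 2) / M) / (r / 2))); [|right; field; lra].
  apply Rmult_lt_compat_l; [assumption|]. apply Rmult_lt_compat_r; [apply Rinv_0_lt_compat; lra|lra].
Qed.

Lemma ccontinuous_path (f : C -> C) (g : R -> C) (t : R) :
  ccontinuous_at f (g t) -> ccont g t -> ccont (fun u => f (g u)) t.
Proof.
  intros Hf Hg. apply ccont_locally. intros eps Heps. destruct (Hf eps Heps) as [d [Hd Hfd]].
  generalize (proj1 (ccont_locally g t) Hg d Hd). apply filter_imp. intros u. apply Hfd.
Qed.

(** * Weierstrass products and their logarithms *)

Lemma Cmod_1_plus_ge (w : C) : Cmod w <= 1 / 2 -> 1 / 2 <= Re (1 + w)%C /\ 1 / 2 <= Cmod (1 + w)%C.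
Proof.
  intros Hw. pose proof (Rabs_Re_le w) as H. apply Rabs_le_between in H.
  pose proof (Re_le_Cmod (1 + w)%C). rewrite Re_plus, Re_RtoC in *. lra.
Qed.

Lemma Clog_1 : Clog 1 = 0.
Proof. rewrite Clog_RtoC, ln_1 by lra. reflexivity. Qed.

Lemma Clog_expansion (w : C) :
  Cmod w <= 1 / 2 ->
  Cmod (Clog (1 + w) - w) <= 2 * Cmod w ^ 2 /\ Cmod (Clog (1 + w) - w + w ^ 2 / 2) <= 2 * Cmod w ^ 3.
Proof.
  intros Hw. pose proof (Cmod_ge_0 w) as Hw0.
  assert (Hsmall : forall t, 0 <= t <= 1 -> 1 / 2 <= Re (1 + RtoC t * w)%C /\ 1 / 2 <= Cmod (1 + RtoC t * w)%C).
  { intros t Ht. apply Cmod_1_plus_ge. rewrite Cmod_mult, Cmod_R, Rabs_pos_eq by lra. nra. }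
  assert (Hn0 : forall t, 0 <= t <= 1 -> (1 + RtoC t * w)%C <> 0).
  { intros t Ht. apply Cmod_gt_0. specialize (Hsmall t Ht). lra. }
  assert (Hlog : forall t, 0 <= t <= 1 -> cderiv (fun u => Clog (1 + RtoC u * w)) t (w / (1 + RtoC t * w))%C).
  { intros t Ht. apply (cderiv_Clog (fun u => 1 + RtoC u * w)%C); [|apply cderiv_line].
    intros [H _]. specialize (Hsmall t Ht). lra. }
  assert (Hinv : forall t, 0 <= t <= 1 -> ccont (fun u => / (1 + RtoC u * w))%C t).
  { intros t Ht. apply (ccont_inv (fun u => 1 + RtoC u * w)%C); [now apply Hn0|].
    eapply cderiv_ccont, cderiv_line. }
  assert (Hid : forall t, ccont (fun u => RtoC u) t) by (intros t; apply (ccont_id t)).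
  assert (Hib : forall t, 0 <= t <= 1 -> Cmod (/ (1 + RtoC t * w))%C <= 2).
  { intros t Ht. rewrite Cmod_inv by now apply Hn0. specialize (Hsmall t Ht).
    rewrite <- (Rinv_inv 2). apply Rinv_le_contravar; lra. }
  split.
  - set (f := fun t : R => (Clog (1 + RtoC t * w) - RtoC t * w)%C).
    replace (Clog (1 + w) - w)%C with (f 1 - f 0)%C.
    + replace (2 * Cmod w ^ 2) with ((1 - 0) * (2 * Cmod w ^ 2)) by ring.
      apply (cderiv_bound f (fun t => - (RtoC t * w ^ 2) * / (1 + RtoC t * w))%C); [lra| | |].
      * intros t Ht. unfold f. eapply cderiv_eq.
        { apply cderiv_minus; [now apply Hlog|].
          apply (cderiv_mult (fun u => RtoC u) (fun _ => w)); [apply cderiv_id|apply cderiv_const]. }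
        cbv beta. field. now apply Hn0.
      * intros t Ht. apply ccont_mult; [|now apply Hinv].
        apply ccont_ext with (fun u => (- w ^ 2) * RtoC u)%C; [intros; ring|].
        apply (ccont_mult (fun _ => - w ^ 2)%C); [apply ccont_const|apply Hid].
      * intros t Ht. rewrite Cmod_mult, Cmod_opp, Cmod_mult, Cmod_pow, Cmod_R, Rabs_pos_eq by lra.
        specialize (Hib t Ht). pose proof (Cmod_ge_0 (/ (1 + RtoC t * w))). pose proof (pow2_ge_0 (Cmod w)).
        rewrite Rmult_comm. apply Rmult_le_compat; try lra; nra.
    + unfold f. rewrite Cmult_1_l, Cmult_0_l, Cplus_0_r, Clog_1. ring.
  - set (f := fun t : R => (Clog (1 + RtoC t * w) - RtoC t * w + RtoC t ^ 2 * (w ^ 2 / 2))%C).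
    replace (Clog (1 + w) - w + w ^ 2 / 2)%C with (f 1 - f 0)%C.
    + replace (2 * Cmod w ^ 3) with ((1 - 0) * (2 * Cmod w ^ 3)) by ring.
      apply (cderiv_bound f (fun t => RtoC t ^ 2 * w ^ 3 * / (1 + RtoC t * w))%C); [lra| | |].
      * intros t Ht. unfold f. eapply cderiv_eq.
        { apply cderiv_plus; [apply cderiv_minus; [now apply Hlog|]|].
          - apply (cderiv_mult (fun u => RtoC u) (fun _ => w)); [apply cderiv_id|apply cderiv_const].
          - apply (cderiv_mult (fun u => RtoC u ^ 2)%C (fun _ => w ^ 2 / 2)%C);
              [apply (cderiv_pow (fun u => RtoC u) t 1 1), cderiv_id|apply cderiv_const]. }
        cbv beta. change (INR 2) with (1 + 1). rewrite RtoC_plus. field. now apply Hn0.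
      * intros t Ht. apply ccont_mult; [|now apply Hinv].
        apply ccont_mult; [apply ccont_pow, Hid|apply ccont_const].
      * intros t Ht. rewrite !Cmod_mult, !Cmod_pow, Cmod_R, Rabs_pos_eq by lra.
        specialize (Hib t Ht). pose proof (Cmod_ge_0 (/ (1 + RtoC t * w))).
        assert (0 <= Cmod w ^ 3) by now apply pow_le.
        rewrite Rmult_comm. apply Rmult_le_compat; try lra; [apply Rmult_le_pos; nra|].
        assert (t ^ 2 <= 1) by nra. nra.
    + unfold f. rewrite Cmult_1_l, Cmult_0_l, Cplus_0_r, Clog_1. rewrite <- !RtoC_pow, pow1.
      replace (0 ^ 2) with 0 by ring. ring.
Qed.

Definition Clim (u : nat -> C) : C :=
  (real (Lim_seq (fun n => Re (u n))), real (Lim_seq (fun n => Im (u n)))).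

Lemma clim_Clim (u : nat -> C) (l : C) : clim u l -> Clim u = l.
Proof.
  intros [H1 H2]. unfold Clim. rewrite (is_lim_seq_unique _ _ H1), (is_lim_seq_unique _ _ H2).
  now apply C_ext.
Qed.

Lemma Cinf_prod_exp (f g : nat -> C) (l : C) :
  (forall k, f (S k) = Cexp (g k)) -> clim (Csum g) l -> Cinf_prod f = Cexp l.
Proof.
  intros Hfg Hl. apply (clim_Clim (Cprod f)).
  apply clim_ext with (2 := clim_Cexp _ _ Hl). intros n.
  induction n as [|n IH]; simpl; [apply Cexp_0|]. now rewrite Cexp_plus, IH, Hfg.
Qed.

Definition barnes_log_term (z : C) (k : nat) : C :=
  (INR (S k) * Clog (1 + z / INR (S k)) - z + z ^ 2 / (2 * INR (S k)))%C.

Definition gamma_log_term (w : C) (k : nat) : C := (Clog (1 + w / INR (S k)) - w / INR (S k))%C.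

Lemma INR_S_neq_0 (k : nat) : RtoC (INR (S k)) <> 0.
Proof. intros H. apply RtoC_inj in H. now apply (not_0_INR (S k)). Qed.

Lemma Cmod_div_INR (z : C) (k : nat) : Cmod (z / INR (S k))%C = Cmod z / INR (S k).
Proof.
  unfold Cdiv. rewrite Cmod_mult, Cmod_inv by apply INR_S_neq_0.
  rewrite Cmod_R, Rabs_pos_eq by apply pos_INR. reflexivity.
Qed.

Lemma small_quotient (B : R) (z : C) (k : nat) :
  Cmod z <= B -> 2 * B <= INR k -> Cmod (z / INR (S k))%C <= 1 / 2.
Proof.
  intros H1 H2. rewrite Cmod_div_INR, S_INR. pose proof (Cmod_ge_0 z).
  apply Rle_div_l; lra.
Qed.

Lemma barnes_log_term_bound (B : R) (z : C) (k : nat) :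
  Cmod z <= B -> 1 <= INR k -> 2 * B <= INR k ->
  Cmod (barnes_log_term z k) <= 2 * B ^ 3 / (INR k * INR (S k)).
Proof.
  intros HB Hk1 Hk. pose proof (small_quotient B z k HB Hk) as Hs.
  destruct (Clog_expansion _ Hs) as [_ H].
  pose proof (INR_S_neq_0 k) as H0. pose proof (Cmod_ge_0 z) as Hz.
  replace (barnes_log_term z k) with (INR (S k) * (Clog (1 + z / INR (S k)) - z / INR (S k) + (z / INR (S k)) ^ 2 / 2))%C
    by (unfold barnes_log_term; field; exact H0).
  rewrite Cmod_mult, Cmod_R, Rabs_pos_eq by apply pos_INR.
  eapply Rle_trans; [apply Rmult_le_compat_l; [apply pos_INR|exact H]|].
  rewrite Cmod_div_INR. rewrite S_INR in *.
  apply Rle_trans with (2 * B ^ 3 / ((INR k + 1) * (INR k + 1))).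
  - replace ((INR k + 1) * (2 * (Cmod z / (INR k + 1)) ^ 3)) with (2 * Cmod z ^ 3 / ((INR k + 1) * (INR k + 1))) by (field; lra).
    apply Rmult_le_compat_r; [left; apply Rinv_0_lt_compat; nra|].
    apply Rmult_le_compat_l; [lra|]. apply pow_incr; lra.
  - apply Rmult_le_compat_l; [apply Rmult_le_pos; [lra|apply pow_le; lra]|].
    apply Rinv_le_contravar; nra.
Qed.

Lemma gamma_log_term_bound (B : R) (z : C) (k : nat) :
  Cmod z <= B -> 1 <= INR k -> 2 * B <= INR k ->
  Cmod (gamma_log_term z k) <= 2 * B ^ 2 / (INR k * INR (S k)).
Proof.
  intros HB Hk1 Hk. pose proof (small_quotient B z k HB Hk) as Hs.
  destruct (Clog_expansion _ Hs) as [H _]. pose proof (Cmod_ge_0 z) as Hz.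
  eapply Rle_trans; [exact H|]. rewrite Cmod_div_INR. rewrite S_INR in *.
  replace (2 * (Cmod z / (INR k + 1)) ^ 2) with (2 * Cmod z ^ 2 / ((INR k + 1) * (INR k + 1))) by (field; lra).
  apply Rle_trans with (2 * B ^ 2 / ((INR k + 1) * (INR k + 1))).
  - apply Rmult_le_compat_r; [left; apply Rinv_0_lt_compat; nra|].
    apply Rmult_le_compat_l; [lra|]. apply pow_incr; lra.
  - apply Rmult_le_compat_l; [apply Rmult_le_pos; [lra|apply pow_le; lra]|].
    apply Rinv_le_contravar; nra.
Qed.

Lemma large_index (B : R) : exists K, (1 <= K)%nat /\ forall k, (K <= k)%nat -> 1 <= INR k /\ B <= INR k.
Proof.
  destruct (INR_unbounded B) as [n Hn]. exists (S n). split; [lia|].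
  intros k Hk. split; [apply (le_INR 1); lia|]. apply le_INR in Hk. rewrite S_INR in Hk. lra.
Qed.

Lemma ccont_series (f : nat -> R -> C) (F : R -> C) (t M : R) (K : nat) :
  (1 <= K)%nat -> 0 <= M ->
  locally t (fun u => forall k, (K <= k)%nat -> Cmod (f k u) <= M / (INR k * INR (S k))) ->
  (forall k, ccont (f k) t) ->
  (forall u, clim (Csum (fun k => f k u)) (F u)) ->
  ccont F t.
Proof.
  intros HK HM Hloc Hc HF.
  assert (Hfin : forall n, ccont (fun u => Csum (fun k => f k u) n) t).
  { induction n as [|n IH]; simpl; [apply ccont_const|]. now apply ccont_plus. }
  assert (Htail : forall u, (forall k, (K <= k)%nat -> Cmod (f k u) <= M / (INR k * INR (S k))) ->
     forall m, (K <= m)%nat -> Cmod (F u - Csum (fun k => f k u) m) <= M / INR m).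
  { intros u Hu m Hm. destruct (Csum_converges (fun k => f k u) M K HK HM Hu) as [l [Hl Hb]].
    rewrite <- (clim_unique _ _ _ Hl (HF u)). now apply Hb. }
  assert (Ht := locally_singleton _ _ Hloc).
  apply ccont_locally. intros eps Heps.
  destruct (large_index (4 * M / eps + 1)) as [m0 [_ Hm0]]. set (m := Nat.max K m0).
  destruct (Hm0 m (Nat.le_max_r _ _)) as [Hm1 Hm2].
  assert (HMm : M / INR m < eps / 4).
  { apply Rlt_div_l; [lra|]. assert (Hq : 4 * M / eps < INR m) by lra. apply Rlt_div_l in Hq; lra. }
  assert (L := proj1 (ccont_locally _ _) (Hfin m) (eps / 4) ltac:(lra)).
  generalize (filter_and _ _ Hloc L). apply filter_imp. intros u [Hu B].
  set (S1 := Csum (fun k => f k u) m) in *. set (S0 := Csum (fun k => f k t) m) in *.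
  assert (T1 := Htail u Hu m (Nat.le_max_l _ _)). assert (T0 := Htail t Ht m (Nat.le_max_l _ _)).
  fold S1 in T1. fold S0 in T0.
  replace (F u - F t)%C with ((F u - S1) + ((S1 - S0) + - (F t - S0)))%C by ring.
  eapply Rle_lt_trans; [apply Cmod_triangle|].
  pose proof (Cmod_triangle (S1 - S0) (- (F t - S0))) as HT. rewrite Cmod_opp in HT. lra.
Qed.

Lemma ccont_bounded (g : R -> C) (t : R) : ccont g t -> locally t (fun u => Cmod (g u) <= Cmod (g t) + 1).
Proof.
  intros H. generalize (proj1 (ccont_locally g t) H 1 Rlt_0_1). apply filter_imp. intros u Hu.
  replace (g u) with (g t + (g u - g t))%C by ring.
  eapply Rle_trans; [apply Cmod_triangle|]. lra.
Qed.

Lemma slit_1_plus (w : C) (k : nat) : slit_plane w -> slit_plane (1 + w / INR (S k)).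
Proof.
  intros H [H1 H2]. apply H. assert (H0 : 0 < INR (S k)) by (apply lt_0_INR; lia).
  assert (E : (w / INR (S k))%C = (RtoC (/ INR (S k)) * w)%C) by (rewrite RtoC_inv by lra; unfold Cdiv; ring).
  rewrite E in H1, H2. rewrite Re_plus, Re_mult in H1. rewrite Im_plus, Im_mult in H2.
  rewrite !Re_RtoC, ?Im_RtoC in *.
  assert (Hi : 0 < / INR (S k)) by now apply Rinv_0_lt_compat.
  split; nra.
Qed.

Lemma ccont_Clog_term (g : R -> C) (l : C) (t : R) (k : nat) :
  slit_plane (g t) -> cderiv g t l -> ccont (fun u => Clog (1 + g u / INR (S k))) t.
Proof.
  intros Hs Hg. eapply cderiv_ccont. apply (cderiv_Clog (fun u => 1 + g u / INR (S k))%C); [now apply slit_1_plus|].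
  apply (cderiv_plus (fun _ => RtoC 1)); [apply cderiv_const|].
  apply cderiv_ext with (fun u => / INR (S k) * g u)%C; [intros; unfold Cdiv; ring|]. exact (cderiv_scal _ _ _ _ Hg).
Qed.

(** Common to the two products: convergence from the bound [M B / k ^ 2] on each disc of radius [B], and
    continuity along paths from the uniformity of that bound. *)
Lemma log_series (f : C -> nat -> C) (M : R -> R) :
  (forall B, 0 <= B -> 0 <= M B) ->
  (forall B z k, Cmod z <= B -> 1 <= INR k -> 2 * B <= INR k -> Cmod (f z k) <= M B / (INR k * INR (S k))) ->
  (forall z, clim (Csum (f z)) (Clim (Csum (f z)))) /\
  (forall (g : R -> C) (t : R), ccont g t -> (forall k, ccont (fun u => f (g u) k) t) ->
     ccont (fun u => Clim (Csum (f (g u)))) t).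
Proof.
  intros HM Hb.
  assert (Hlim : forall z, clim (Csum (f z)) (Clim (Csum (f z)))).
  { intros z. destruct (large_index (2 * Cmod z)) as [K [HK H]].
    destruct (Csum_converges (f z) (M (Cmod z)) K HK) as [l [Hl _]].
    - apply HM, Cmod_ge_0.
    - intros k Hk. destruct (H k Hk). apply Hb; lra.
    - now rewrite (clim_Clim _ _ Hl). }
  split; [exact Hlim|]. intros g t Hg Hk.
  set (B := Cmod (g t) + 1). assert (HB : 0 <= B) by (unfold B; pose proof (Cmod_ge_0 (g t)); lra).
  destruct (large_index (2 * B)) as [K [HK H]].
  apply (ccont_series (fun k u => f (g u) k) _ t (M B) K HK (HM B HB)).
  - generalize (ccont_bounded g t Hg). apply filter_imp. intros u Hu k Hk'.
    destruct (H k Hk'). now apply Hb.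
  - exact Hk.
  - intros u. apply Hlim.
Qed.

Definition barnes_log_sum (z : C) : C := Clim (Csum (barnes_log_term z)).
Definition gamma_log_sum (w : C) : C := Clim (Csum (gamma_log_term w)).

Lemma barnes_log_series :
  (forall z, clim (Csum (barnes_log_term z)) (barnes_log_sum z)) /\
  (forall (g : R -> C) (l : C) (t : R),
     slit_plane (g t) -> cderiv g t l -> ccont (fun u => barnes_log_sum (g u)) t).
Proof.
  destruct (log_series barnes_log_term (fun B => 2 * B ^ 3)) as [H1 H2].
  - intros B HB. apply Rmult_le_pos; [lra|now apply pow_le].
  - exact barnes_log_term_bound.
  - split; [exact H1|]. intros g l t Hs Hg. pose proof (cderiv_ccont _ _ _ Hg) as Hc.
    apply (H2 g t Hc). intros k. unfold barnes_log_term. apply ccont_plus; [apply ccont_minus; [|exact Hc]|].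
    + apply ccont_scal, (ccont_Clog_term g l); assumption.
    + apply ccont_mult; [now apply ccont_pow|apply ccont_const].
Qed.

Lemma gamma_log_series :
  (forall z, clim (Csum (gamma_log_term z)) (gamma_log_sum z)) /\
  (forall (g : R -> C) (l : C) (t : R),
     slit_plane (g t) -> cderiv g t l -> ccont (fun u => gamma_log_sum (g u)) t).
Proof.
  destruct (log_series gamma_log_term (fun B => 2 * B ^ 2)) as [H1 H2].
  - intros B HB. apply Rmult_le_pos; [lra|now apply pow_le].
  - exact gamma_log_term_bound.
  - split; [exact H1|]. intros g l t Hs Hg. pose proof (cderiv_ccont _ _ _ Hg) as Hc.
    apply (H2 g t Hc). intros k. unfold gamma_log_term. apply ccont_minus.
    + apply (ccont_Clog_term g l); assumption.
    + apply ccont_mult; [exact Hc|apply ccont_const].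
Qed.

(** The imaginary part is a multiple of [2 PI] that starts at zero and, by the intermediate value
    theorem, cannot cross [PI]. *)
Lemma log_of_one_zero (D : R -> C) :
  (forall t, 0 <= t <= 1 -> ccont D t) -> (forall t, 0 <= t <= 1 -> Cexp (D t) = 1) -> Im (D 0) = 0 -> D 1 = 0.
Proof.
  intros Hc He H0. pose proof PI_RGT_0 as HPI.
  assert (HRe : forall t, 0 <= t <= 1 -> Re (D t) = 0).
  { intros t Ht. assert (E : Cmod (Cexp (D t)) = 1) by (rewrite He, Cmod_1 by assumption; reflexivity).
    rewrite Cmod_Cexp in E. apply exp_inv. now rewrite exp_0. }
  assert (Hcs : forall t, 0 <= t <= 1 -> cos (Im (D t)) = 1 /\ sin (Im (D t)) = 0).
  { intros t Ht. assert (E := He t Ht).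
    assert (E1 : Re (Cexp (D t)) = 1) by (rewrite E; reflexivity).
    assert (E2 : Im (Cexp (D t)) = 0) by (rewrite E; reflexivity).
    rewrite Re_Cexp, HRe, exp_0, Rmult_1_l in E1 by assumption.
    rewrite Im_Cexp, HRe, exp_0, Rmult_1_l in E2 by assumption. now split. }
  assert (Hsm : forall t, 0 <= t <= 1 -> Rabs (Im (D t)) < 2 * PI -> Im (D t) = 0).
  { intros t Ht Hb. destruct (Hcs t Ht). apply Rabs_lt_between in Hb.
    apply angle_unique; [lra|now rewrite cos_0|now rewrite sin_0]. }
  apply C_ext; [apply HRe; lra|]. change (Im (RtoC 0)) with 0.
  set (h := fun s t => s * Im (D t) - PI).
  assert (Hh : forall s, s = 1 \/ s = -1 -> h s 1 <= 0).
  { intros s Hs. apply Rnot_lt_le. intros Hpos.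
    destruct (Ranalysis5.IVT_interv (h s) 0 1) as [x [Hx Ex]]; try lra.
    - intros x Hx. apply continuity_pt_filterlim. unfold h.
      apply (continuous_minus (fun t => s * Im (D t)) (fun _ => PI)); [|apply continuous_const].
      apply (continuous_mult_R (fun _ => s)); [apply continuous_const|]. now apply Hc.
    - unfold h. rewrite H0. lra.
    - unfold h in Ex. assert (Him : Im (D x) = 0); [|rewrite Him in Ex; lra].
      apply Hsm; [assumption|]. apply Rabs_lt_between. destruct Hs as [->| ->]; lra. }
  assert (A1 := Hh 1 (or_introl eq_refl)). assert (A2 := Hh (-1) (or_intror eq_refl)).
  unfold h in A1, A2. apply Hsm; [lra|]. apply Rabs_lt_between. lra.
Qed.

Lemma slit_segment (z : C) (t : R) : slit_plane z -> 0 <= t <= 1 -> slit_plane (1 + RtoC t * (z - 1)).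
Proof.
  intros Hz Ht [A1 A2]. apply Hz.
  replace (Re (1 + RtoC t * (z - 1))%C) with (1 - t + t * Re z) in A1 by (simpl; unfold Re; ring).
  replace (Im (1 + RtoC t * (z - 1))%C) with (t * Im z) in A2 by (simpl; unfold Im; ring).
  destruct (Req_dec t 0) as [->|Hn]; [lra|]. split; [nra|]. apply Rmult_integral in A2. lra.
Qed.

(** The two logarithms are compared along the segment from 1 to [z], which stays in the slit plane. *)
Lemma log_branch_unique (F L l : C -> C) (z : C) :
  is_log_branch F L -> slit_plane z ->
  (forall t, 0 <= t <= 1 -> Cexp (l (1 + RtoC t * (z - 1)))%C = F (1 + RtoC t * (z - 1))%C) ->
  (forall t, 0 <= t <= 1 -> ccont (fun u => l (1 + RtoC u * (z - 1))%C) t) ->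
  Im (l 1) = 0 -> L z = l z.
Proof.
  intros [HL HL0] Hz He Hc H1.
  assert (Hs : forall t, 0 <= t <= 1 -> slit_plane (1 + RtoC t * (z - 1))) by (intros; now apply slit_segment).
  set (D := fun t : R => (L (1 + RtoC t * (z - 1)) - l (1 + RtoC t * (z - 1)))%C).
  assert (HD : D 1 = 0).
  { apply log_of_one_zero.
    - intros t Ht. unfold D. apply ccont_minus; [|now apply Hc].
      apply ccontinuous_path; [|eapply cderiv_ccont, cderiv_line]. apply analytic_continuous, HL, Hs, Ht.
    - intros t Ht. unfold D. unfold Cminus at 1. rewrite Cexp_plus, Cexp_opp, He by assumption.
      destruct (HL _ (Hs t Ht)) as [_ E]. rewrite E. field. rewrite <- He by assumption. apply Cexp_neq_0.
    - unfold D. rewrite Im_minus, Cmult_0_l, Cplus_0_r, H1, HL0 by lra. ring. }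
  unfold D in HD. replace (1 + RtoC 1 * (z - 1))%C with z in HD by ring.
  replace (L z) with ((L z - l z) + l z)%C by ring. rewrite HD. ring.
Qed.

(** * The constants of Euler and Stirling *)

Lemma ln_expansion (x : R) :
  0 <= x <= 1 / 2 -> Rabs (ln (1 + x) - x) <= 2 * x ^ 2 /\ Rabs (ln (1 + x) - x + x ^ 2 / 2) <= 2 * x ^ 3.
Proof.
  intros Hx. assert (Hw : Cmod (RtoC x) <= 1 / 2) by (rewrite Cmod_R, Rabs_pos_eq; lra).
  destruct (Clog_expansion (RtoC x) Hw) as [H1 H2].
  rewrite <- RtoC_plus, Clog_RtoC in H1, H2 by lra.
  rewrite Cmod_R, (Rabs_pos_eq x) in H1, H2 by lra.
  rewrite <- RtoC_minus, Cmod_R in H1.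
  rewrite <- RtoC_pow, <- RtoC_div, <- RtoC_minus, <- RtoC_plus, Cmod_R in H2 by lra.
  now split.
Qed.

Lemma ln_succ (k : nat) : (1 <= k)%nat -> ln (INR (S k)) = ln (INR k) + ln (1 + / INR k).
Proof.
  intros Hk. assert (H : 0 < INR k) by (apply lt_0_INR; lia).
  rewrite <- ln_mult; [|assumption|pose proof (Rinv_0_lt_compat _ H); lra].
  f_equal. rewrite S_INR. field. lra.
Qed.

Lemma inv_INR_bound (k : nat) : (2 <= k)%nat -> 2 <= INR k /\ 0 < / INR k <= 1 / 2.
Proof.
  intros Hk. assert (H2 : 2 <= INR k) by (apply (le_INR 2); lia). split; [exact H2|].
  split; [apply Rinv_0_lt_compat; lra|]. replace (1 / 2) with (/ 2) by field. apply Rinv_le_contravar; lra.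
Qed.

Lemma increments_converge (u : nat -> R) (M : R) (K : nat) :
  (1 <= K)%nat -> 0 <= M ->
  (forall k, (K <= k)%nat -> Rabs (u (S k) - u k) <= M / (INR k * INR (S k))) ->
  exists l : R, is_lim_seq u l.
Proof.
  intros HK HM H. destruct (Rsum_converges (fun k => u (S k) - u k) M K HK HM H) as [l [Hl _]].
  exists (l + u 0%nat). apply is_lim_seq_ext with (fun n => Rsum (fun k => u (S k) - u k) n + u 0%nat).
  - intros n. induction n as [|n IH]; simpl; [ring|]. simpl in IH. lra.
  - apply is_lim_seq_plus'; [exact Hl|apply is_lim_seq_const].
Qed.

Definition harmonic (n : nat) : R := Rsum (fun k => / INR (S k)) n.

Lemma harmonic_sum_n_m (n : nat) : sum_n_m (fun k => / INR k) 1 n = harmonic n.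
Proof.
  unfold harmonic. destruct n as [|n].
  - rewrite sum_n_m_zero by lia. reflexivity.
  - induction n as [|n IH].
    + rewrite sum_n_n. simpl. ring.
    + rewrite sum_n_Sm by lia. rewrite IH. reflexivity.
Qed.

Lemma is_lim_euler_gamma : is_lim_seq (fun n => harmonic n - ln (INR n)) euler_gamma.
Proof.
  destruct (increments_converge (fun n => harmonic n - ln (INR n)) 5 2) as [l Hl].
  - lia.
  - lra.
  - intros k Hk. destruct (inv_INR_bound k Hk) as [H2 Hi].
    destruct (ln_expansion (/ INR k) ltac:(lra)) as [H _].
    unfold harmonic. cbn [Rsum]. rewrite ln_succ by lia. set (L := ln (1 + / INR k)) in *.
    replace (_ - _) with (- (L - / INR k) - (/ INR k - / INR (S k))) by ring.
    eapply Rle_trans; [apply Rabs_triang|]. rewrite !Rabs_Ropp. rewrite S_INR in *.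
    replace (/ INR k - / (INR k + 1)) with (1 / (INR k * (INR k + 1))) by (field; lra).
    rewrite (Rabs_pos_eq (1 / _)) by (apply Rdiv_le_0_compat; nra).
    apply Rle_trans with (2 * (/ INR k) ^ 2 + 1 / (INR k * (INR k + 1))); [lra|].
    apply Rle_trans with (4 / (INR k * (INR k + 1)) + 1 / (INR k * (INR k + 1))); [|right; field; lra].
    apply Rplus_le_compat_r. rewrite pow_inv.
    apply Rmult_le_reg_r with (INR k ^ 2 * (INR k + 1)); [nra|].
    replace (2 * / INR k ^ 2 * (INR k ^ 2 * (INR k + 1))) with (2 * (INR k + 1)) by (field; lra).
    replace (4 / (INR k * (INR k + 1)) * (INR k ^ 2 * (INR k + 1))) with (4 * INR k) by (field; lra). lra.
  - unfold euler_gamma. erewrite Lim_seq_ext; [|intros n; rewrite harmonic_sum_n_m; reflexivity].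
    rewrite (is_lim_seq_unique _ _ Hl). exact Hl.
Qed.

Definition log_fact (n : nat) : R := Rsum (fun k => ln (INR (S k))) n.

Lemma log_fact_eq (n : nat) : log_fact n = ln (INR (fact n)).
Proof.
  unfold log_fact. induction n as [|n IH]; [simpl; now rewrite ln_1|].
  cbn [Rsum]. rewrite IH, fact_simpl, mult_INR, ln_mult; [ring| |apply INR_fact_lt_0].
  apply lt_0_INR; lia.
Qed.

Definition stirling_seq (n : nat) : R := log_fact n - (INR n + / 2) * ln (INR n) + INR n.

Lemma stirling_converges : exists l : R, is_lim_seq stirling_seq l.
Proof.
  apply (increments_converge _ 8 2); [lia|lra|].
  intros k Hk. destruct (inv_INR_bound k Hk) as [H2 Hi].
  destruct (ln_expansion (/ INR k) ltac:(lra)) as [_ H].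
  unfold stirling_seq, log_fact. cbn [Rsum]. rewrite !ln_succ by lia. set (L := ln (1 + / INR k)) in *.
  rewrite S_INR in *. set (x := INR k) in *.
  replace (_ - _) with (- ((x + / 2) * (L - / x + (/ x) ^ 2 / 2)) + / 4 * / x ^ 2) by (field; lra).
  eapply Rle_trans; [apply Rabs_triang|]. rewrite Rabs_Ropp, Rabs_mult.
  rewrite (Rabs_pos_eq (x + / 2)) by lra.
  rewrite (Rabs_pos_eq (/ 4 * / x ^ 2)) by (apply Rmult_le_pos; [lra|left; apply Rinv_0_lt_compat; nra]).
  apply Rle_trans with ((x + / 2) * (2 * (/ x) ^ 3) + / 4 * / x ^ 2); [apply Rplus_le_compat_r, Rmult_le_compat_l; lra|].
  apply Rmult_le_reg_r with (x ^ 3 * (x + 1)); [nra|].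
  replace (((x + / 2) * (2 * (/ x) ^ 3) + / 4 * / x ^ 2) * (x ^ 3 * (x + 1))) with ((2 * x + 1 + x / 4) * (x + 1)) by (field; lra).
  replace (8 / (x * (x + 1)) * (x ^ 3 * (x + 1))) with (8 * x ^ 2) by (field; lra). nra.
Qed.

Definition wallis (m : nat) : R := RInt (fun x => sin x ^ m) 0 (PI / 2).

Lemma is_RInt_wallis (m : nat) : is_RInt (fun x => sin x ^ m) 0 (PI / 2) (wallis m).
Proof.
  apply (RInt_correct (V := R_CompleteNormedModule)), (ex_RInt_continuous (V := R_CompleteNormedModule)).
  intros x _. apply continuous_of_derive. auto_derive. exact I.
Qed.

Lemma wallis_rec (m : nat) : INR (S (S m)) * wallis (S (S m)) = INR (S m) * wallis m.
Proof.
  assert (H1 : is_RInt (fun x => INR (S (S m)) * sin x ^ S (S m) - INR (S m) * sin x ^ m) 0 (PI / 2)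
     (INR (S (S m)) * wallis (S (S m)) - INR (S m) * wallis m)).
  { apply (is_RInt_minus (V := R_NormedModule) (fun x => INR (S (S m)) * sin x ^ S (S m)) (fun x => INR (S m) * sin x ^ m)).
    - apply (is_RInt_scal (V := R_NormedModule) (fun x => sin x ^ S (S m))), is_RInt_wallis.
    - apply (is_RInt_scal (V := R_NormedModule) (fun x => sin x ^ m)), is_RInt_wallis. }
  assert (H2 : is_RInt (fun x => INR (S (S m)) * sin x ^ S (S m) - INR (S m) * sin x ^ m) 0 (PI / 2) 0).
  { evar_last; [apply (is_RInt_derive (V := R_CompleteNormedModule) (fun x => - cos x * sin x ^ S m))|].
    - intros x _. auto_derive; [exact I|].
      change (match m with O => 1 | S _ => INR m + 1 end) with (INR (S m)). cbn [Init.Nat.pred].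
      pose proof (sin2_cos2 x) as E. unfold Rsqr in E. rewrite (S_INR (S m)). cbn [pow].
      assert (E2 : cos x * cos x = 1 - sin x * sin x) by lra.
      transitivity ((1 * sin x) * (sin x * sin x ^ m) - INR (S m) * ((cos x * cos x) * sin x ^ m)); [ring|]. rewrite E2. ring.
    - intros x _. apply continuous_of_derive. auto_derive. exact I.
    - unfold minus, plus, opp; simpl. rewrite cos_PI2, sin_0. ring. }
  assert (E := is_RInt_unique _ _ _ _ H1). rewrite (is_RInt_unique _ _ _ _ H2) in E. lra.
Qed.

Lemma wallis_le (m : nat) : wallis (S m) <= wallis m.
Proof.
  pose proof PI_RGT_0. apply (is_RInt_le _ _ 0 (PI / 2) _ _ ltac:(lra) (is_RInt_wallis (S m)) (is_RInt_wallis m)).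
  intros x Hx. assert (0 < sin x) by (apply sin_gt_0; lra). destruct (SIN_bound x).
  simpl. rewrite <- (Rmult_1_l (sin x ^ m)) at 2. apply Rmult_le_compat_r; [apply pow_le|]; lra.
Qed.

Lemma wallis_closed (n : nat) :
  wallis (2 * n) * (4 ^ n * INR (fact n) ^ 2) = PI / 2 * INR (fact (2 * n)) /\
  wallis (2 * n + 1) * INR (fact (2 * n + 1)) = 4 ^ n * INR (fact n) ^ 2.
Proof.
  induction n as [|n [IH1 IH2]].
  - simpl. split.
    + assert (H := is_RInt_const (V := R_NormedModule) 0 (PI / 2) 1).
      assert (E : wallis 0 = PI / 2); [|rewrite E; field].
      unfold wallis. rewrite (RInt_ext _ (fun _ => 1)) by (intros; reflexivity).
      rewrite (is_RInt_unique _ _ _ _ H). unfold scal; simpl; unfold mult; simpl. ring.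
    + assert (E : wallis 1 = 1); [|rewrite E; ring].
      unfold wallis. apply is_RInt_unique. evar_last.
      * apply (is_RInt_derive (V := R_CompleteNormedModule) (fun x => - cos x)).
        { intros x _. auto_derive; [exact I|]. ring. }
        intros x _. apply continuous_of_derive. auto_derive. exact I.
      * unfold minus, plus, opp; simpl. rewrite cos_PI2, cos_0. ring.
  - replace (2 * S n)%nat with (S (S (2 * n))) by lia.
    replace (S (S (2 * n)) + 1)%nat with (S (S (2 * n + 1))) by lia.
    pose proof (wallis_rec (2 * n)) as R1. pose proof (wallis_rec (2 * n + 1)) as R2.
    rewrite (fact_simpl n), (fact_simpl (S (2 * n))), (fact_simpl (2 * n)), (fact_simpl (S (2 * n + 1))), (fact_simpl (2 * n + 1)).
    rewrite !mult_INR. cbn [pow].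
    assert (E1 : INR (S (S (2 * n))) = 2 * INR (S n)) by (rewrite !S_INR, mult_INR; simpl; ring).
    assert (E2 : INR (S (2 * n + 1)) = 2 * INR (S n)) by (rewrite !S_INR, plus_INR, mult_INR; simpl; ring).
    split.
    + rewrite E1 in R1 |- *.
      transitivity ((2 * INR (S n) * wallis (S (S (2 * n)))) * (4 ^ n * INR (fact n) ^ 2) * (2 * INR (S n))); [ring|].
      rewrite R1.
      transitivity ((wallis (2 * n) * (4 ^ n * INR (fact n) ^ 2)) * (INR (S (2 * n)) * (2 * INR (S n)))); [ring|].
      rewrite IH1. ring.
    + transitivity ((INR (S (S (2 * n + 1))) * wallis (S (S (2 * n + 1)))) * (INR (S (2 * n + 1)) * INR (fact (2 * n + 1)))); [ring|].
      rewrite R2.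
      transitivity ((wallis (2 * n + 1) * INR (fact (2 * n + 1))) * (INR (S (2 * n + 1)) * INR (S (2 * n + 1)))); [ring|].
      rewrite IH2, E2. ring.
Qed.

Lemma wallis_pos (m : nat) : 0 < wallis m.
Proof.
  pose proof PI_RGT_0.
  apply (RInt_gt_0 (fun x => sin x ^ m) 0 (PI / 2)); [lra| |].
  - intros x Hx. apply pow_lt, sin_gt_0; lra.
  - intros x _. apply continuous_of_derive. auto_derive. exact I.
Qed.

Lemma is_lim_ln_1 (u : nat -> R) : is_lim_seq u 1 -> is_lim_seq (fun n => ln (u n)) 0.
Proof.
  intros H. rewrite <- ln_1. apply (is_lim_seq_continuous ln); [|exact H].
  apply derivable_continuous_pt. exists (/ 1). apply derivable_pt_lim_ln. lra.
Qed.

Lemma wallis_ratio : is_lim_seq (fun n => ln (wallis (2 * n + 1)) - ln (wallis (2 * n))) 0.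
Proof.
  apply is_lim_seq_le_le with (u := fun n => ln (1 - 1 / INR (2 * n + 2))) (w := fun _ => 0).
  - intros n. pose proof (wallis_pos (2 * n)). pose proof (wallis_pos (2 * n + 1)).
    pose proof (wallis_le (2 * n)) as L1. pose proof (wallis_le (2 * n + 1)) as L2.
    pose proof (wallis_rec (2 * n)) as R1.
    replace (S (2 * n)) with (2 * n + 1)%nat in * by lia.
    replace (S (2 * n + 1)) with (2 * n + 2)%nat in * by lia.
    assert (Hn : 0 < INR (2 * n + 1)) by (apply lt_0_INR; lia).
    assert (E : INR (2 * n + 2) = INR (2 * n + 1) + 1) by (rewrite !plus_INR; simpl; ring).
    rewrite E in *. set (x := INR (2 * n + 1)) in *.
    split.
    + assert (Hx : 1 - 1 / (x + 1) = x / (x + 1)) by (field; lra). rewrite Hx.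
      assert (0 < x / (x + 1)) by (apply Rdiv_lt_0_compat; lra).
      assert (K : ln (x / (x + 1) * wallis (2 * n)) <= ln (wallis (2 * n + 1))).
      { apply ln_le; [now apply Rmult_lt_0_compat|]. eapply Rle_trans; [|exact L2]. right.
        apply Rmult_eq_reg_l with (x + 1); [|lra]. rewrite R1. field. lra. }
      rewrite ln_mult in K by assumption. lra.
    + apply ln_le in L1; [lra|assumption].
  - apply is_lim_ln_1.
    replace (Finite 1) with (Finite (1 - 0)) by (f_equal; ring). apply is_lim_seq_minus'; [apply is_lim_seq_const|].
    apply (is_lim_seq_subseq (fun n => 1 / INR n) 0 (fun n => (2 * n + 2)%nat)); [|apply is_lim_seq_div_INR].
    apply eventually_subseq. intros n; lia.
  - apply is_lim_seq_const.
Qed.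

(** The Wallis integrals determine the constant: their ratio [wallis (2 n + 1) / wallis (2 n)] tends
    to 1, and in terms of factorials this says that [2 * stirling_seq n - stirling_seq (2 n)] tends to
    half of [ln (2 PI)]. *)
Lemma stirling_limit : is_lim_seq stirling_seq (/ 2 * ln (2 * PI)).
Proof.
  destruct stirling_converges as [c Hc].
  enough (E : c = / 2 * ln (2 * PI)) by now rewrite <- E.
  pose proof PI_RGT_0 as HPI.
  assert (H2 : is_lim_seq (fun n => stirling_seq (2 * n)) c).
  { apply (is_lim_seq_subseq stirling_seq c (fun n => (2 * n)%nat)); [|exact Hc]. apply eventually_subseq. intros n; lia. }
  assert (H3 : is_lim_seq (fun n => ln (1 + / 2 * (1 / INR n))) 0).
  { apply is_lim_ln_1. replace (Finite 1) with (Finite (1 + / 2 * 0)) by (f_equal; ring).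
    apply is_lim_seq_plus'; [apply is_lim_seq_const|]. apply is_lim_seq_mult'; [apply is_lim_seq_const|apply is_lim_seq_div_INR]. }
  assert (HL : is_lim_seq (fun n => 4 * stirling_seq n - 2 * stirling_seq (2 * n) - 2 * ln 2 - ln (1 + / 2 * (1 / INR n)) - (ln PI - ln 2)) 
      (4 * c - 2 * c - 2 * ln 2 - 0 - (ln PI - ln 2))).
  { apply is_lim_seq_minus'; [|apply is_lim_seq_const]. apply is_lim_seq_minus'; [|exact H3].
    apply is_lim_seq_minus'; [|apply is_lim_seq_const].
    apply is_lim_seq_minus'; [exact (is_lim_seq_scal_l _ 4 _ Hc)|exact (is_lim_seq_scal_l _ 2 _ H2)]. }
  assert (HW : is_lim_seq (fun n => 4 * stirling_seq n - 2 * stirling_seq (2 * n) - 2 * ln 2 - ln (1 + / 2 * (1 / INR n)) - (ln PI - ln 2)) 0).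
  { apply is_lim_seq_incr_1. apply (is_lim_seq_ext (fun n => ln (wallis (2 * S n + 1)) - ln (wallis (2 * S n)))).
    - intros m. set (n := S m). destruct (wallis_closed n) as [W1 W2].
      assert (Hn : 0 < INR n) by (apply lt_0_INR; unfold n; lia). clearbody n.
      apply (f_equal ln) in W1. apply (f_equal ln) in W2.
      pose proof (INR_fact_lt_0 n) as F1. pose proof (INR_fact_lt_0 (2 * n)) as F2. pose proof (INR_fact_lt_0 (2 * n + 1)) as F3.
      assert (P4 : 0 < 4 ^ n) by (apply pow_lt; lra).
      assert (FF : 0 < INR (fact n) ^ 2) by (now apply pow_lt).
      rewrite !ln_mult, !ln_pow in W1 by (first [assumption|lra|apply wallis_pos|apply Rmult_lt_0_compat; (assumption || lra)]).
      rewrite !ln_mult, !ln_pow in W2 by (first [assumption|lra|apply wallis_pos]).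
      replace (2 * n + 1)%nat with (S (2 * n)) in W2 at 2 by lia.
      rewrite fact_simpl, mult_INR, ln_mult in W2 by (assumption || (apply lt_0_INR; lia)).
      assert (E1 : ln (INR (S (2 * n))) = ln 2 + ln (INR n) + ln (1 + / 2 * (1 / INR n))).
      { assert (0 < 1 / INR n) by (apply Rdiv_lt_0_compat; lra). rewrite <- !ln_mult by lra. f_equal.
        rewrite S_INR, mult_INR. simpl. field. lra. }
      assert (E2 : ln (INR (2 * n)) = ln 2 + ln (INR n)).
      { rewrite <- ln_mult by lra. f_equal. rewrite mult_INR. simpl. ring. }
      assert (E3 : ln (PI / 2) = ln PI - ln 2) by (unfold Rdiv; rewrite ln_mult, ln_Rinv by lra; ring).
      assert (E4 : ln 4 = 2 * ln 2) by (replace 4 with (2 * 2) by ring; rewrite ln_mult by lra; ring).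
      rewrite <- !log_fact_eq in W1, W2. rewrite E1 in W2. rewrite E3 in W1. rewrite E4 in W1, W2.
      unfold stirling_seq. rewrite E2, mult_INR. simpl INR in *. change (INR n) with (INR n) in *. lra.
    - apply (is_lim_seq_incr_1 (fun n => ln (wallis (2 * n + 1)) - ln (wallis (2 * n)))), wallis_ratio. }
  apply is_lim_seq_unique in HL. apply is_lim_seq_unique in HW. rewrite HW in HL. injection HL as HL.
  rewrite ln_mult by lra. lra.
Qed.

(** * The remainder as a limit of Euler-Maclaurin integrals *)

Definition quad (z : C) : C := (1 / 2 * z * (z + 1) + 1 / 12)%C.

Definition euler_step (w : C) : C := ((2 * w + 1) / 4 - quad w * (Clog (w + 1) - Clog w))%C.

Lemma RtoC_neq_0 (x : R) : x <> 0 -> RtoC x <> 0.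
Proof. intros H E. apply H. now apply RtoC_inj. Qed.

Lemma slit_plus (w : C) (x : R) : slit_plane w -> 0 <= x -> slit_plane (RtoC x + w).
Proof.
  intros Hw Hx [H1 H2]. apply Hw. rewrite Re_plus, Re_RtoC in H1. rewrite Im_plus, Im_RtoC in H2. lra.
Qed.

(** Division of [B2 x] by [x + w] leaves the remainder [2 * quad w], whence the logarithm in
    [euler_step]. *)
Lemma is_CInt_B2 (w : C) :
  slit_plane w -> is_CInt (fun x => RtoC (B2 x) / (RtoC x + w))%C 0 1 (- 2 * euler_step w)%C.
Proof.
  intros Hw.
  set (P := fun x : R => ((RtoC x + w) ^ 2 * / 2 - RtoC x * (2 * w + 1) + 2 * quad w * Clog (RtoC x + w))%C).
  assert (Hxw : forall t, cderiv (fun x => RtoC x + w)%C t 1).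
  { intros t. eapply cderiv_eq; [apply (cderiv_plus (fun x => RtoC x) (fun _ => w)); [apply cderiv_id|apply cderiv_const]|]. ring. }
  replace (- 2 * euler_step w)%C with (P 1 - P 0)%C.
  - apply is_CInt_derive; [lra| |].
    + intros t Ht. assert (Hs := slit_plus w t Hw ltac:(lra)). assert (H0 := slit_neq_0 _ Hs).
      unfold P. eapply cderiv_eq.
      * apply cderiv_plus; [apply cderiv_minus|].
        -- apply (cderiv_mult (fun x => (RtoC x + w) ^ 2)%C (fun _ => / 2)%C); [|apply cderiv_const].
           apply (cderiv_pow (fun x => RtoC x + w)%C t 1 1), Hxw.
        -- apply (cderiv_mult (fun x => RtoC x) (fun _ => 2 * w + 1)%C); [apply cderiv_id|apply cderiv_const].
        -- apply (cderiv_scal (2 * quad w)). apply (cderiv_Clog (fun x => RtoC x + w)%C); [exact Hs|apply Hxw].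
      * cbv beta. unfold B2, quad. rewrite RtoC_plus, RtoC_minus, RtoC_pow, RtoC_div by lra.
        change (INR 2) with (1 + 1). rewrite RtoC_plus.
        field; tauto.
    + intros t Ht. assert (Hs := slit_plus w t Hw ltac:(lra)).
      apply ccont_div; [now apply slit_neq_0| |eapply cderiv_ccont, Hxw].
      apply ccont_real. unfold B2. apply continuous_of_derive. auto_derive. exact I.
  - unfold P, euler_step. rewrite !(Cplus_comm 1 w), Cplus_0_l.
    replace (RtoC 4) with (2 * 2)%C by (rewrite <- RtoC_mult; f_equal; ring). unfold Cdiv. field.
Qed.

Lemma euler_step_sum (z : C) (n : nat) :
  Csum (fun j => euler_step (z + INR j)) n =
  (((z + INR n) ^ 2 - z ^ 2) / 4 - quad (z + INR n) * Clog (z + INR n) + quad z * Clog z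
   + Csum (fun j => (z + INR (S j)) * Clog (z + INR (S j))) n)%C.
Proof.
  induction n as [|n IH].
  - simpl Csum. change (INR 0) with 0. rewrite !Cplus_0_r. field.
  - cbn [Csum]. rewrite IH. unfold euler_step.
    replace (z + INR (S n))%C with (z + INR n + 1)%C by (rewrite S_INR, RtoC_plus; ring).
    set (w := (z + INR n)%C).
    assert (E : quad (w + 1) = (quad w + w + 1)%C) by (unfold quad; field; tauto).
    assert (E2 : ((w + 1) ^ 2 - z ^ 2)%C = (w ^ 2 - z ^ 2 + (2 * w + 1))%C).
    { replace (RtoC 2) with (1 + 1)%C by (rewrite <- RtoC_plus; f_equal; ring). ring. }
    rewrite E, E2. unfold Cdiv. ring.
Qed.

Definition log_hyper (n : nat) : R := Rsum (fun k => INR (S k) * ln (INR (S k))) n.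

Lemma Clog_shift (z : C) (k : nat) :
  slit_plane z -> Clog (1 + z / INR (S k)) = (Clog (z + INR (S k)) - ln (INR (S k)))%C.
Proof.
  intros Hz. assert (H0 : 0 < INR (S k)) by (apply lt_0_INR; lia).
  assert (H1 := slit_neq_0 _ (slit_1_plus z k Hz)).
  assert (E := Clog_scal (INR (S k)) _ H0 H1).
  replace (INR (S k) * (1 + z / INR (S k)))%C with (z + INR (S k))%C in E by (field; apply INR_S_neq_0).
  rewrite E. ring.
Qed.

Lemma barnes_log_term_sum (z : C) (n : nat) :
  slit_plane z ->
  Csum (barnes_log_term z) n =
  (Csum (fun k => INR (S k) * Clog (z + INR (S k))) n - log_hyper n - INR n * z + z ^ 2 / 2 * harmonic n)%C.
Proof.
  intros Hz. assert (H2 : RtoC 2 <> 0) by (apply RtoC_neq_0; lra).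
  unfold log_hyper, harmonic. induction n as [|n IH].
  - simpl. unfold Cdiv. ring.
  - cbn [Csum Rsum]. rewrite IH. unfold barnes_log_term. rewrite Clog_shift by assumption.
    rewrite !RtoC_plus, RtoC_mult, RtoC_inv by (apply not_0_INR; lia).
    assert (H0 := INR_S_neq_0 n). rewrite (S_INR n), RtoC_plus in *. field; tauto.
Qed.

Lemma gamma_log_term_sum (z : C) (n : nat) :
  slit_plane z ->
  (Clog (z + 1) + Csum (gamma_log_term (z + 1)) n)%C =
  (Csum (fun k => Clog (z + INR (S k))) n + Clog (z + INR (S n)) - log_fact n - (z + 1) * harmonic n)%C.
Proof.
  intros Hz. assert (Hz1 : slit_plane (z + 1)) by (rewrite Cplus_comm; apply slit_plus; [exact Hz|lra]).
  unfold log_fact, harmonic. induction n as [|n IH].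
  - simpl. ring.
  - cbn [Csum Rsum]. rewrite Cplus_assoc, IH. unfold gamma_log_term. rewrite Clog_shift by assumption.
    rewrite !RtoC_plus, RtoC_inv by (apply not_0_INR; lia).
    replace (z + 1 + INR (S n))%C with (z + INR (S (S n)))%C by (rewrite (S_INR (S n)), RtoC_plus; ring).
    unfold Cdiv. ring.
Qed.

Definition log_barnes (z : C) : C :=
  (z / 2 * ln (2 * PI) - (z * (z + 1) + euler_gamma * z ^ 2) / 2 + barnes_log_sum z)%C.

Definition log_gamma (z : C) : C := (- (Clog (z + 1) + euler_gamma * (z + 1) + gamma_log_sum (z + 1)))%C.

Lemma clim_inv_INR (z : C) : clim (fun n => z * / INR (S n))%C 0.
Proof.
  eapply clim_eq; [apply clim_scal|].
  - apply clim_ext with (fun n => RtoC (1 / INR (S n))).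
    + intros n. rewrite RtoC_div by (apply not_0_INR; lia). field. apply INR_S_neq_0.
    + apply clim_real. apply (is_lim_seq_incr_1 (fun n => 1 / INR n)), is_lim_seq_div_INR.
  - ring.
Qed.

Lemma clim_log_expansion (z : C) :
  clim (fun n => Clog (1 + z / INR (S n))) 0 /\
  clim (fun n => INR (S n) ^ 2 * (Clog (1 + z / INR (S n)) - z / INR (S n) + (z / INR (S n)) ^ 2 / 2))%C 0.
Proof.
  destruct (large_index (2 * Cmod z)) as [K [HK H]].
  assert (Hs : forall n, Cmod (z / INR (S (n + K)))%C <= 1 / 2).
  { intros n. apply small_quotient with (Cmod z); [lra|]. apply H; lia. }
  assert (HL : is_lim_seq (fun n => 1 / INR (S (n + K))) 0).
  { apply (is_lim_seq_incr_n (fun n => 1 / INR (S n)) K), (is_lim_seq_incr_1 (fun n => 1 / INR n)), is_lim_seq_div_INR. }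
  split; apply (clim_incr _ _ K).
  - apply clim_zero_le with (fun n => (Cmod z + 2 * Cmod z ^ 2) * (1 / INR (S (n + K)))).
    + intros n. destruct (Clog_expansion _ (Hs n)) as [E _].
      replace (Clog (1 + z / INR (S (n + K)))) with ((Clog (1 + z / INR (S (n + K))) - z / INR (S (n + K))) + z / INR (S (n + K)))%C by ring.
      eapply Rle_trans; [apply Cmod_triangle|]. rewrite Cmod_div_INR in *.
      assert (H1 : 1 <= INR (S (n + K))) by (apply (le_INR 1); lia). set (x := INR (S (n + K))) in *.
      assert (Hi : 0 < / x <= 1) by (split; [apply Rinv_0_lt_compat; lra|rewrite <- Rinv_1; apply Rinv_le_contravar; lra]).
      unfold Rdiv in *. rewrite Rpow_mult_distr in E. pose proof (pow2_ge_0 (Cmod z)). simpl in *. nra.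
    + replace (Finite 0) with (Rbar_mult (Cmod z + 2 * Cmod z ^ 2) 0) by (simpl; f_equal; ring).
      now apply is_lim_seq_scal_l.
  - apply clim_zero_le with (fun n => (2 * Cmod z ^ 3) * (1 / INR (S (n + K)))).
    + intros n. destruct (Clog_expansion _ (Hs n)) as [_ E].
      rewrite Cmod_mult, Cmod_pow, Cmod_R, Rabs_pos_eq by apply pos_INR.
      rewrite Cmod_div_INR in E.
      assert (H1 : 1 <= INR (S (n + K))) by (apply (le_INR 1); lia). set (x := INR (S (n + K))) in *.
      eapply Rle_trans; [apply Rmult_le_compat_l; [apply pow2_ge_0|exact E]|]. right. field. lra.
    + replace (Finite 0) with (Rbar_mult (2 * Cmod z ^ 3) 0) by (simpl; f_equal; ring).
      now apply is_lim_seq_scal_l.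
Qed.

(** All polynomially growing terms cancel, so the difference between the partial products and the
    Euler-Maclaurin sums tends to a constant; Stirling's formula, Euler's constant and the
    asymptotics of the hyperfactorial identify it. *)
Lemma clim_euler_step_sum (z : C) (a : R) :
  slit_plane z ->
  is_lim_seq (fun n => log_hyper n - (INR n ^ 2 / 2 + INR n / 2 + 1 / 12) * ln (INR n) + INR n ^ 2 / 4) a ->
  clim (Csum (fun j => euler_step (z + INR j)))
    (log_barnes z - z * log_gamma z - (1 / 4 * z ^ 2 - quad z * Clog z) + a)%C.
Proof.
  intros Hz Ha. apply (clim_incr _ _ 1).
  assert (La := clim_real _ _ Ha).
  assert (Ld := clim_real _ _ stirling_limit).
  assert (Lh := clim_real _ _ is_lim_euler_gamma).
  assert (Lb := proj1 barnes_log_series z). assert (Lg := proj1 gamma_log_series (z + 1)%C).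
  apply (clim_incr _ _ 1) in La. apply (clim_incr _ _ 1) in Ld. apply (clim_incr _ _ 1) in Lh.
  apply (clim_incr _ _ 1) in Lb. apply (clim_incr _ _ 1) in Lg.
  destruct (clim_log_expansion z) as [_ Lr]. destruct (clim_log_expansion (z + 1)) as [Ls _].
  (* quad (z + n) / n ^ 2, with n replaced by S n *)
  assert (Lq : clim (fun n => 1 / 2 + (z + 1 / 2) * / INR (S n) + (quad z * / INR (S n)) * / INR (S n))%C (1 / 2 + 0 + quad z * 0 * 0)%C).
  { apply clim_plus; [apply clim_plus; [apply clim_const|apply clim_inv_INR]|].
    assert (I1 : clim (fun n => / INR (S n))%C 0) by (eapply clim_ext; [|apply (clim_inv_INR 1)]; intros n; cbv beta; ring).
    apply clim_mult; [apply clim_mult; [apply clim_const|exact I1]|exact I1]. }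
  assert (Le := clim_inv_INR (quad z * z - (z + 1 / 2) * z ^ 2 / 2)).
  assert (Le2 := clim_mult _ _ _ _ (clim_inv_INR (quad z * z ^ 2 / 2)) (clim_inv_INR 1)).
  assert (LT := clim_minus _ _ _ _ (clim_minus _ _ _ _ (clim_minus _ _ _ _ (clim_plus _ _ _ _ (clim_plus _ _ _ _
     (clim_plus _ _ _ _ Lb (clim_scal z _ _ Lg)) La) (clim_scal z _ _ Ld)) (clim_scal z _ _ Ls))
     (clim_plus _ _ _ _ (clim_mult _ _ _ _ Lq Lr) (clim_minus _ _ _ _ Le Le2)))
     (clim_const 0)).
  assert (LT' := clim_plus _ _ _ _ LT (clim_scal (z ^ 2 / 2 + z) _ _ Lh)).
  set (base := (- (z * (z + 1) + euler_gamma * z ^ 2) / 2 + z * Clog (z + 1) + euler_gamma * z * (z + 1)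
     - (1 / 4 * z ^ 2 - quad z * Clog z) - (z ^ 2 / 2 + z) * euler_gamma)%C).
  assert (LF := clim_plus _ _ _ _ LT' (clim_const base)).
  eapply clim_ext; [|eapply clim_eq; [exact LF|]].
  - intros n. cbv beta. rewrite !Nat.add_1_r.
    rewrite euler_step_sum, barnes_log_term_sum by assumption.
    assert (Eg := gamma_log_term_sum z (S n) Hz).
    assert (Eg' : Csum (gamma_log_term (z + 1)) (S n) = (Csum (fun k => Clog (z + INR (S k))) (S n) + Clog (z + INR (S (S n))) - log_fact (S n) - (z + 1) * harmonic (S n) - Clog (z + 1))%C)
      by (rewrite <- Eg; ring).
    rewrite Eg'.
    rewrite (Csum_ext (fun j => (z + INR (S j)) * Clog (z + INR (S j)))%C (fun j => z * Clog (z + INR (S j)) + INR (S j) * Clog (z + INR (S j)))%C) by (intros; ring).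
    rewrite Csum_plus, Csum_scal.
    assert (Hz1 : slit_plane (z + 1)) by (rewrite Cplus_comm; apply slit_plus; [exact Hz|lra]).
    rewrite (Clog_shift (z + 1)), (Clog_shift z) by assumption.
    replace (z + 1 + INR (S n))%C with (z + INR (S (S n)))%C by (rewrite (S_INR (S n)), RtoC_plus; ring).
    unfold stirling_seq. unfold base, quad.
    rewrite !RtoC_minus, !RtoC_plus, !RtoC_minus, !RtoC_mult, !RtoC_plus, !RtoC_div, !RtoC_inv, !RtoC_pow by lra.
    generalize (Csum (fun k => Clog (z + INR (S k))) (S n)) as X1.
    generalize (Csum (fun k => INR (S k) * Clog (z + INR (S k))) (S n))%C as X2. intros X2 X1.
    generalize (Clog (z + INR (S (S n)))) as L1. generalize (Clog (z + INR (S n))) as L0. intros L0 L1.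
    generalize (RtoC (ln (INR (S n)))) as l. intros l.
    generalize (RtoC (harmonic (S n))) as h. generalize (RtoC (log_fact (S n))) as f. generalize (RtoC (log_hyper (S n))) as k.
    intros k f h. generalize (INR_S_neq_0 n). generalize (RtoC (INR (S n))) as x. intros x Hx.
    field; tauto.
  - unfold base, log_barnes, log_gamma, quad. rewrite !RtoC_mult, RtoC_inv by lra. field; tauto.
Qed.

(** * Analytic continuation of the zeta function *)

(** By induction on [m]: integrate along the segment from 0 to [w]. *)
Lemma Cexp_taylor (w : C) (m : nat) :
  Cmod (Cexp w - Csum (fun j => w ^ j / INR (fact j))%C m) <=
  Cmod w ^ m / INR (fact m) * exp (Cmod w).
Proof.
  pose proof (Cmod_ge_0 w) as Hw.
  enough (H : forall t, 0 <= t <= 1 ->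
    Cmod (Cexp (RtoC t * w) - Csum (fun j => (RtoC t * w) ^ j / INR (fact j))%C m) <=
    t ^ m * (Cmod w ^ m / INR (fact m) * exp (Cmod w))).
  { specialize (H 1 ltac:(lra)). rewrite Cmult_1_l, pow1, Rmult_1_l in H. exact H. }
  induction m as [|m IH]; intros t Ht.
  - simpl. unfold Cminus. rewrite Copp_0, Cplus_0_r, Cmod_Cexp.
    apply Rle_trans with (exp (Cmod w)); [|right; field].
    assert (Re (RtoC t * w)%C <= Cmod w).
    { eapply Rle_trans; [apply Re_le_Cmod|]. rewrite Cmod_mult, Cmod_R, Rabs_pos_eq by lra. nra. }
    destruct H as [H|H]; [left; now apply exp_increasing|rewrite H; lra].
  - set (f := fun (m : nat) (u : R) => (Cexp (RtoC u * w) - Csum (fun j => (RtoC u * w) ^ j / INR (fact j))%C m)%C).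
    assert (Hlin : forall u, cderiv (fun v => RtoC v * w)%C u w).
    { intros u. eapply cderiv_eq; [apply (cderiv_mult (fun v => RtoC v) (fun _ => w)); [apply cderiv_id|apply cderiv_const]|].
      cbv beta; ring. }
    assert (Hd : forall n u, cderiv (f (S n)) u (w * f n u)%C).
    { intros n u. unfold f. eapply cderiv_eq.
      - apply cderiv_minus; [apply cderiv_Cexp, Hlin|].
        instantiate (1 := (w * Csum (fun j => (RtoC u * w) ^ j / INR (fact j))%C n)%C).
        induction n as [|n IHn].
        + apply cderiv_ext with (fun _ => RtoC 1); [intros v; simpl; unfold Cdiv; rewrite <- RtoC_inv by lra; rewrite Rinv_1; ring|].
          eapply cderiv_eq; [apply cderiv_const|]. simpl. ring.
        + eapply cderiv_eq.
          * apply (cderiv_plus (fun v => Csum (fun j => (RtoC v * w) ^ j / INR (fact j))%C (S n))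
              (fun v => (RtoC v * w) ^ S n / INR (fact (S n)))%C); [exact IHn|].
            apply (cderiv_mult (fun v => (RtoC v * w) ^ S n)%C (fun _ => / INR (fact (S n)))%C);
              [apply (cderiv_pow (fun v => RtoC v * w)%C), Hlin|apply cderiv_const].
          * cbn [Csum]. cbv beta. rewrite fact_simpl, mult_INR, RtoC_mult.
            assert (H1 := INR_S_neq_0 n). assert (H2 : RtoC (INR (fact n)) <> 0) by (apply RtoC_neq_0, INR_fact_neq_0).
            field. tauto.
      - cbv beta; ring. }
    assert (Hc : forall n u, ccont (f n) u).
    { intros n u. unfold f. apply ccont_minus; [eapply cderiv_ccont, cderiv_Cexp, Hlin|].
      induction n as [|n IHn]; simpl; [apply ccont_const|]. apply ccont_plus; [exact IHn|].
      apply ccont_mult; [apply ccont_pow; eapply cderiv_ccont, Hlin|apply ccont_const]. }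
    assert (HI := is_CInt_derive (f (S m)) (fun u => w * f m u)%C 0 t ltac:(lra) (fun u _ => Hd m u)
      (fun u _ => ccont_mult (fun _ => w) (f m) u (ccont_const w u) (Hc m u))).
    assert (H0 : f (S m) 0 = 0).
    { unfold f. rewrite Cmult_0_l, Cexp_0. clear. induction m as [|m IH].
      - simpl. unfold Cdiv. rewrite <- RtoC_inv by lra. rewrite Rinv_1. ring.
      - cbn [Csum] in *. rewrite Cpow_S. unfold Cminus, Cdiv in *. rewrite !Cmult_0_l, Cplus_0_r. exact IH. }
    rewrite H0 in HI. fold (f (S m) t). unfold Cminus in HI. rewrite Copp_0, Cplus_0_r in HI.
    set (c := Cmod w ^ m / INR (fact m) * exp (Cmod w)) in *.
    assert (HR : is_RInt (fun u => (Cmod w * c) * u ^ m) 0 t ((Cmod w * c) * (t ^ S m / INR (S m)))).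
    { apply (is_RInt_scal (V := R_NormedModule) (fun u => u ^ m)).
      apply is_RInt_pow. }
    eapply Rle_trans; [apply (is_CInt_norm_le _ _ 0 t _ _ ltac:(lra)) with (2 := HI) (3 := HR)|].
    + intros u Hu. rewrite Cmod_mult. specialize (IH u ltac:(lra)). fold (f m u) in IH.
      rewrite Rmult_assoc. apply Rmult_le_compat_l; [assumption|]. fold c in IH. lra.
    + right. unfold c. rewrite fact_simpl, mult_INR. cbn [pow]. field.
      split; [apply INR_fact_neq_0|apply not_0_INR; lia].
Qed.

Lemma pow_fact_le_exp (x : R) (m : nat) : 0 <= x -> x ^ m / INR (fact m) <= exp x.
Proof.
  intros Hx. pose proof (pow_exp_bound 1 m x Rlt_0_1 Hx) as H.
  rewrite pow1, Rdiv_1_r in H. replace (- (1) * x) with (- x) in H by ring.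
  pose proof (INR_fact_lt_0 m). pose proof (exp_pos x).
  apply Rle_div_l; [assumption|].
  replace (x ^ m) with (x ^ m * exp (- x) * exp x).
  - rewrite (Rmult_comm (exp x)). apply Rmult_le_compat_r; lra.
  - rewrite exp_Ropp. field. lra.
Qed.

(** ** Integrals over consecutive unit intervals *)

Definition B3 (x : R) : R := x ^ 3 - 3 / 2 * x ^ 2 + / 2 * x.

Lemma B3_bound (x : R) : 0 <= x <= 1 -> Rabs (B3 x) <= 1.
Proof. intros H. unfold B3. apply Rabs_le. split; nra. Qed.

Lemma shift_pos (k : nat) (x : R) : 0 <= x -> 1 <= x + INR (S k).
Proof. intros Hx. assert (1 <= INR (S k)) by (apply (le_INR 1); lia). lra. Qed.

Lemma is_lim_neg_power (a : R) : 0 < a -> is_lim_seq (fun n => exp (- a * ln (INR (S n)))) 0.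
Proof.
  intros Ha.
  assert (H1 : is_lim_seq (fun n => ln (INR (S n))) p_infty).
  { apply (is_lim_comp_seq ln (fun n => INR (S n)) p_infty p_infty is_lim_ln_p).
    - exists 0%nat. intros; discriminate.
    - apply (is_lim_seq_incr_1 INR), is_lim_seq_INR. }
  apply (is_lim_comp_seq exp (fun n => - a * ln (INR (S n))) m_infty 0 is_lim_exp_m).
  - exists 0%nat. intros; discriminate.
  - apply is_lim_seq_ext with (fun n => (- a) * ln (INR (S n))); [reflexivity|].
    replace m_infty with (Rbar_mult (- a) p_infty); [now apply is_lim_seq_scal_l|].
    simpl. destruct (Rle_dec 0 (- a)); [exfalso; lra|reflexivity].
Qed.

(** The integral of [C0 * y ^ (- p)] over [y >= k + 1]. *)
Definition power_tail (p C0 : R) (k : nat) : R := C0 / (p - 1) * exp (- (p - 1) * ln (INR (S k))).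

Lemma unit_integral_bound (f : R -> C) (p C0 : R) (k : nat) (l : C) :
  1 < p -> 0 <= C0 ->
  (forall x, 0 < x < 1 -> Cmod (f x) <= C0 * exp (- p * ln (x + INR (S k)))) ->
  is_CInt f 0 1 l -> Cmod l <= power_tail p C0 k - power_tail p C0 (S k).
Proof.
  intros Hp HC Hf Hl.
  set (P := fun x => - (C0 / (p - 1) * exp (- (p - 1) * ln (x + INR (S k))))).
  assert (HR : is_RInt (fun x => C0 * exp (- p * ln (x + INR (S k)))) 0 1 (P 1 - P 0)).
  { apply (is_RInt_derive (V := R_CompleteNormedModule) P); intros x; rewrite Rmin_left, Rmax_right by lra; intros Hx;
      pose proof (shift_pos k x ltac:(lra)) as H1; change (match k with O => 1 | S _ => INR k + 1 end) with (INR (S k)) in *.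
    - unfold P. auto_derive; [change (0 < x + INR (S k)); lra|].
      change (match k with O => 1 | S _ => INR k + 1 end) with (INR (S k)).
      replace (- p * ln (x + INR (S k))) with (- (p - 1) * ln (x + INR (S k)) + - ln (x + INR (S k))) by ring.
      rewrite exp_plus, exp_Ropp, exp_ln by lra. unfold Rminus. field. lra.
    - apply continuous_of_derive. auto_derive. change (0 < x + INR (S k)). lra. }
  replace (power_tail p C0 k - power_tail p C0 (S k)) with (P 1 - P 0).
  - apply (is_CInt_norm_le _ _ 0 1 _ _ Rle_0_1 Hf Hl HR).
  - unfold P, power_tail. rewrite (S_INR (S k)), Rplus_0_l, (Rplus_comm 1). ring.
Qed.

Lemma is_lim_power_tail (p C0 : R) : 1 < p -> is_lim_seq (power_tail p C0) 0.
Proof.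
  intros Hp. unfold power_tail. replace (Finite 0) with (Rbar_mult (C0 / (p - 1)) 0) by (simpl; f_equal; ring).
  apply is_lim_seq_scal_l, is_lim_neg_power. lra.
Qed.

Lemma power_tail_sum (f : nat -> R -> C) (p C0 : R) :
  1 < p -> 0 <= C0 ->
  (forall k x, 0 <= x <= 1 -> ccont (f k) x) ->
  (forall k x, 0 < x < 1 -> Cmod (f k x) <= C0 * exp (- p * ln (x + INR (S k)))) ->
  clim (Csum (fun k => CInt (f k) 0 1)) (Clim (Csum (fun k => CInt (f k) 0 1))) /\
  Cmod (Clim (Csum (fun k => CInt (f k) 0 1))) <= C0 / (p - 1).
Proof.
  intros Hp HC Hc Hf.
  destruct (Csum_converges_telescope (fun k => CInt (f k) 0 1) (power_tail p C0) 0) as [l [Hl Hb]].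
  - intros k _. apply (unit_integral_bound (f k)); try assumption; [apply Hf|]. apply CInt_correct; [lra|apply Hc].
  - now apply is_lim_power_tail.
  - rewrite (clim_Clim _ _ Hl). split; [exact Hl|]. specialize (Hb 0%nat (le_n 0)).
    simpl Csum in Hb. unfold Cminus in Hb. rewrite Copp_0, Cplus_0_r in Hb. eapply Rle_trans; [exact Hb|].
    unfold power_tail. change (INR 1) with 1. rewrite ln_1, Rmult_0_r, exp_0. lra.
Qed.

(** ** The Euler-Maclaurin remainder and its Taylor series *)

(** [B3 x / (x + k + 1) ^ (s + 3)], where [B3] is the third Bernoulli polynomial. Order three makes the
    remainder converge for [Re s > -2], a half-plane that contains [-1]. *)
Definition em_integrand (s : C) (k : nat) (x : R) : C :=
  (RtoC (B3 x) * Cexp (- (s + 3) * RtoC (ln (x + INR (S k)))))%C.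

Definition em_remainder (s : C) : C := Clim (Csum (fun k => CInt (em_integrand s k) 0 1)).

(** The coefficient of [h ^ j] in [em_integrand (s + h) k x]. *)
Definition em_coef_integrand (s : C) (j k : nat) (x : R) : C :=
  (em_integrand s k x * (RtoC (- ln (x + INR (S k))) ^ j / INR (fact j)))%C.

Definition em_coef (s : C) (j : nat) : C := Clim (Csum (fun k => CInt (em_coef_integrand s j k) 0 1)).

Lemma ccont_ln_shift (k : nat) (x : R) : 0 <= x -> ccont (fun u => RtoC (ln (u + INR (S k)))) x.
Proof.
  intros Hx. pose proof (shift_pos k x Hx). apply ccont_of_derive. auto_derive. change (0 < x + INR (S k)). lra.
Qed.

Lemma ccont_em_integrand (s : C) (k : nat) (x : R) : 0 <= x -> ccont (em_integrand s k) x.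
Proof.
  intros Hx. unfold em_integrand. apply ccont_mult.
  - apply ccont_of_derive. unfold B3. auto_derive. exact I.
  - apply (ccont_Cexp (fun u => - (s + 3) * RtoC (ln (u + INR (S k))))%C).
    apply (ccont_mult (fun _ => - (s + 3))%C); [apply ccont_const|now apply ccont_ln_shift].
Qed.

Lemma ccont_em_coef_integrand (s : C) (j k : nat) (x : R) : 0 <= x -> ccont (em_coef_integrand s j k) x.
Proof.
  intros Hx. unfold em_coef_integrand. apply ccont_mult; [now apply ccont_em_integrand|].
  apply ccont_mult; [|apply ccont_const]. apply ccont_pow.
  apply ccont_ext with (fun u => (- (1)) * RtoC (ln (u + INR (S k))))%C; [intros u; rewrite RtoC_opp; ring|].
  apply (ccont_mult (fun _ => - (1))%C); [apply ccont_const|now apply ccont_ln_shift].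
Qed.

Lemma em_integrand_bound (s : C) (k : nat) (x : R) :
  0 <= x <= 1 -> Cmod (em_integrand s k x) <= exp (- (Re s + 3) * ln (x + INR (S k))).
Proof.
  intros Hx. unfold em_integrand. rewrite Cmod_mult, Cmod_R, Cmod_Cexp.
  replace (Re (- (s + 3) * RtoC (ln (x + INR (S k))))%C) with (- (Re s + 3) * ln (x + INR (S k)))
    by (rewrite Re_mult, Re_opp, Re_plus, !Re_RtoC, Im_RtoC; ring).
  pose proof (B3_bound x Hx). pose proof (exp_pos (- (Re s + 3) * ln (x + INR (S k)))). nra.
Qed.

Lemma ln_shift_nonneg (k : nat) (x : R) : 0 <= x -> 0 <= ln (x + INR (S k)).
Proof. intros Hx. rewrite <- ln_1. pose proof (shift_pos k x Hx). destruct H as [H|H]; [left; apply ln_increasing; lra|rewrite <- H; lra]. Qed.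

Lemma em_coef_bound (s : C) (j k : nat) (r x : R) :
  0 < r -> 0 <= x <= 1 ->
  Cmod (em_coef_integrand s j k x) <= / r ^ j * exp (- (Re s + 3 - r) * ln (x + INR (S k))).
Proof.
  intros Hr Hx. unfold em_coef_integrand. set (y := ln (x + INR (S k))).
  assert (Hy : 0 <= y) by (apply ln_shift_nonneg; lra).
  rewrite Cmod_mult. pose proof (em_integrand_bound s k x Hx) as H1. fold y in H1.
  rewrite <- RtoC_pow, <- RtoC_div by apply INR_fact_neq_0. rewrite Cmod_R.
  assert (H2 : Rabs ((- y) ^ j / INR (fact j)) <= / r ^ j * exp (r * y)).
  { unfold Rdiv. rewrite Rabs_mult, <- RPow_abs, Rabs_Ropp, (Rabs_pos_eq y) by assumption.
    rewrite Rabs_pos_eq by (left; apply Rinv_0_lt_compat, INR_fact_lt_0).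
    pose proof (pow_fact_le_exp (r * y) j ltac:(nra)) as H. rewrite Rpow_mult_distr in H.
    assert (Hrj : 0 < r ^ j) by now apply pow_lt.
    apply Rmult_le_reg_l with (r ^ j); [assumption|].
    rewrite <- (Rmult_assoc (r ^ j) (/ r ^ j)), Rinv_r, Rmult_1_l by lra.
    unfold Rdiv in H. lra. }
  replace (- (Re s + 3 - r) * y) with (- (Re s + 3) * y + r * y) by ring. rewrite exp_plus.
  replace (/ r ^ j * (exp (- (Re s + 3) * y) * exp (r * y))) with (exp (- (Re s + 3) * y) * (/ r ^ j * exp (r * y))) by ring.
  apply Rmult_le_compat; [apply Cmod_ge_0|apply Rabs_pos|exact H1|exact H2].
Qed.

Lemma clim_em_remainder (s : C) :
  -2 < Re s -> clim (Csum (fun k => CInt (em_integrand s k) 0 1)) (em_remainder s).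
Proof.
  intros Hs. apply (power_tail_sum (em_integrand s) (Re s + 3) 1); try lra.
  - intros k x Hx. apply ccont_em_integrand; lra.
  - intros k x Hx. rewrite Rmult_1_l. apply em_integrand_bound; lra.
Qed.

(** Each factor [(x + k + 1) ^ (- h)] is expanded in [h]; its Taylor remainder carries the factor
    [(|h| / r) ^ m], at the price of lowering the exponent of decay by [2 r]. *)
Lemma em_remainder_pseries (s h : C) (r : R) :
  0 < r -> 2 * r < Re s + 2 -> Cmod h < r ->
  @is_pseries C_AbsRing C_NormedModule (em_coef s) h (em_remainder (s + h)).
Proof.
  intros Hr Hs Hh. pose proof (Cmod_ge_0 h) as Hh0.
  apply is_pseries_clim. set (q := Cmod h / r).
  assert (Hq : 0 <= q < 1) by (unfold q; split; [apply Rdiv_le_0_compat; lra|apply Rlt_div_l; lra]).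
  assert (Hsh : - 2 < Re (s + h)%C).
  { rewrite Re_plus. pose proof (Rabs_Re_le h) as H. apply Rabs_le_between in H. lra. }
  set (p := Re s + 3 - 2 * r).
  apply clim_le with (fun m => q ^ m / (p - 1)).
  - intros m.
    set (f := fun (k : nat) (x : R) => (em_integrand (s + h) k x - Csum (fun j => h ^ j * em_coef_integrand s j k x)%C m)%C).
    assert (Hfc : forall k x, 0 <= x <= 1 -> ccont (f k) x).
    { intros k x Hx. unfold f. apply ccont_minus; [apply ccont_em_integrand; lra|].
      induction m as [|m IH]; simpl; [apply ccont_const|]. apply ccont_plus; [exact IH|].
      apply (ccont_mult (fun _ => h ^ m)%C); [apply ccont_const|apply ccont_em_coef_integrand; lra]. }
    assert (Hfb : forall k x, 0 < x < 1 -> Cmod (f k x) <= q ^ m * exp (- p * ln (x + INR (S k)))).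
    { intros k x Hx. set (y := ln (x + INR (S k))).
      assert (Hy : 0 <= y) by (apply ln_shift_nonneg; lra).
      assert (E : f k x = (em_integrand s k x * (Cexp (- (h * y)) - Csum (fun j => (- (h * y)) ^ j / INR (fact j))%C m))%C).
      { unfold f. rewrite (Csum_ext _ (fun j => em_integrand s k x * ((- (h * y)) ^ j / INR (fact j)))%C).
        - rewrite Csum_scal.
          assert (E1 : em_integrand (s + h) k x = (em_integrand s k x * Cexp (- (h * y)))%C).
          { unfold em_integrand. fold y. replace (- (s + h + 3) * y)%C with (- (s + 3) * y + - (h * y))%C by ring.
            rewrite Cexp_plus. ring. }
          rewrite E1. ring.
        - intros j _. unfold em_coef_integrand. fold y.
          replace (- (h * y))%C with (h * RtoC (- y))%C by (rewrite RtoC_opp; ring). rewrite Cpow_mult_l. unfold Cdiv. ring. }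
      rewrite E, Cmod_mult. pose proof (em_integrand_bound s k x ltac:(lra)) as H1. fold y in H1.
      pose proof (Cexp_taylor (- (h * y)) m) as H2. rewrite Cmod_opp, Cmod_mult, Cmod_R, (Rabs_pos_eq y) in H2 by assumption.
      assert (H3 : (Cmod h * y) ^ m / INR (fact m) <= q ^ m * exp (r * y)).
      { replace (Cmod h * y) with (q * (r * y)) by (unfold q; field; lra). rewrite Rpow_mult_distr. unfold Rdiv.
        rewrite Rmult_assoc. apply Rmult_le_compat_l; [apply pow_le; lra|]. apply (pow_fact_le_exp (r * y)). nra. }
      assert (H4 : exp (Cmod h * y) <= exp (r * y)).
      { destruct Hy as [Hy| <-]; [left; apply exp_increasing; nra|rewrite !Rmult_0_r; lra]. }
      unfold p. replace (- (Re s + 3 - 2 * r) * y) with (- (Re s + 3) * y + (r * y + r * y)) by ring.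
      rewrite !exp_plus.
      replace (q ^ m * (exp (- (Re s + 3) * y) * (exp (r * y) * exp (r * y)))) with
        (exp (- (Re s + 3) * y) * ((q ^ m * exp (r * y)) * exp (r * y))) by ring.
      apply Rmult_le_compat; [apply Cmod_ge_0|apply Cmod_ge_0|exact H1|].
      eapply Rle_trans; [exact H2|]. apply Rmult_le_compat; [|left; apply exp_pos|exact H3|exact H4].
      apply Rdiv_le_0_compat; [apply pow_le; nra|apply INR_fact_lt_0]. }
    destruct (power_tail_sum f p (q ^ m) ltac:(unfold p; lra) ltac:(apply pow_le; lra) Hfc Hfb) as [HL HB].
    assert (Hcoef : forall j, clim (Csum (fun k => CInt (em_coef_integrand s j k) 0 1)) (em_coef s j)).
    { intros j. apply (power_tail_sum (em_coef_integrand s j) (Re s + 3 - r) (/ r ^ j)); try lra.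
      - left; apply Rinv_0_lt_compat; now apply pow_lt.
      - intros k x Hx. apply ccont_em_coef_integrand; lra.
      - intros k x Hx. apply em_coef_bound; lra. }
    assert (HL2 : clim (Csum (fun k => CInt (f k) 0 1)) (em_remainder (s + h) - Csum (fun j => h ^ j * em_coef s j)%C m)%C).
    { apply clim_ext with (fun n => Csum (fun k => CInt (em_integrand (s + h) k) 0 1) n -
         Csum (fun j => h ^ j * Csum (fun k => CInt (em_coef_integrand s j k) 0 1) n)%C m)%C.
      - intros n. rewrite (Csum_ext (fun j => _ * Csum _ n)%C (fun j => Csum (fun k => h ^ j * CInt (em_coef_integrand s j k) 0 1)%C n))
          by (intros j _; now rewrite Csum_scal).
        rewrite Csum_swap, <- Csum_minus. apply Csum_ext. intros k _. symmetry. apply is_CInt_value.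
        apply is_CInt_minus; [apply CInt_correct; [lra|intros; apply ccont_em_integrand; lra]|].
        apply (is_CInt_sum (fun j x => h ^ j * em_coef_integrand s j k x)%C). intros j _. apply is_CInt_scal.
        apply CInt_correct; [lra|intros; apply ccont_em_coef_integrand; lra].
      - apply clim_minus; [now apply clim_em_remainder|].
        apply (clim_Csum (fun n j => h ^ j * Csum (fun k => CInt (em_coef_integrand s j k) 0 1) n)%C).
        intros j _. apply clim_scal, Hcoef. }
    rewrite <- (clim_unique _ _ _ HL2 HL) in HB.
    replace (_ - _)%C with (- (em_remainder (s + h) - Csum (fun j => h ^ j * em_coef s j)%C m))%C by ring.
    rewrite Cmod_opp. exact HB.
  - replace (Finite 0) with (Rbar_mult 0 (/ (p - 1))) by (simpl; f_equal; ring).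
    apply is_lim_seq_scal_r. apply is_lim_seq_geom. rewrite Rabs_pos_eq; lra.
Qed.

Lemma analytic_em_remainder (s : C) : -2 < Re s -> analytic_at em_remainder s.
Proof.
  intros Hs. exists (em_coef s), ((Re s + 2) / 4). split; [lra|]. intros z Hz.
  replace z with (s + (z - s))%C at 2 by ring. apply em_remainder_pseries with ((Re s + 2) / 4); lra || assumption.
Qed.

(** * The identity theorem along a segment *)

Lemma analytic_const (c z : C) : analytic_at (fun _ => c) z.
Proof.
  exists (fun n => match n with O => c | _ => RtoC 0 end), 1. split; [lra|]. intros w _.
  apply is_pseries_clim. apply (clim_incr _ _ 1). apply clim_ext with (fun _ => c); [|apply clim_const].
  intros n. rewrite Nat.add_1_r. induction n as [|n IH]; [simpl; ring|].
  change (c = (Csum (fun k => (w - z) ^ k * match k with O => c | S _ => 0 end) (S n) + (w - z) ^ S n * 0)%C).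
  rewrite <- IH. ring.
Qed.

Lemma analytic_plus (f g : C -> C) (z : C) :
  analytic_at f z -> analytic_at g z -> analytic_at (fun w => f w + g w)%C z.
Proof.
  intros [a [r [Hr Ha]]] [b [r' [Hr' Hb]]].
  exists (fun n => a n + b n)%C, (Rmin r r'). split; [now apply Rmin_glb_lt|]. intros w Hw.
  pose proof (Rmin_l r r'). pose proof (Rmin_r r r').
  apply is_pseries_clim.
  eapply clim_ext; [|apply clim_plus; [apply is_pseries_clim, Ha; lra|apply is_pseries_clim, Hb; lra]].
  intros n. cbv beta. rewrite <- Csum_plus. apply Csum_ext. intros k _. ring.
Qed.

Lemma analytic_mult_const (c : C) (f : C -> C) (z : C) : analytic_at f z -> analytic_at (fun w => c * f w)%C z.
Proof.
  intros [a [r [Hr Ha]]]. exists (fun n => c * a n)%C, r. split; [assumption|]. intros w Hw.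
  apply is_pseries_clim. eapply clim_ext; [|apply clim_scal, is_pseries_clim, Ha, Hw].
  intros n. cbv beta. rewrite <- Csum_scal. apply Csum_ext. intros k _. ring.
Qed.

Lemma analytic_mult_linear (c : C) (f : C -> C) (z : C) :
  analytic_at f z -> analytic_at (fun w => (w - c) * f w)%C z.
Proof.
  intros [a [r [Hr Ha]]].
  exists (fun n => match n with O => (z - c) * a 0%nat | S m => a m + (z - c) * a (S m) end)%C, r.
  split; [assumption|]. intros w Hw. specialize (Ha w Hw). apply is_pseries_clim in Ha. apply is_pseries_clim.
  apply (clim_incr _ _ 1).
  assert (L := clim_plus _ _ _ _ (clim_scal (w - z) _ _ Ha) (clim_scal (z - c) _ _ (proj1 (clim_incr _ _ 1) Ha))).
  eapply clim_ext; [|eapply clim_eq; [exact L|ring]].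
  intros n. cbv beta. rewrite Nat.add_1_r. induction n as [|n IH].
  - simpl. ring.
  - cbn [Csum] in IH |- *.
    rewrite <- IH. cbn [Csum]. rewrite (Cpow_S (w - z) n). ring.
Qed.

Definition vanishes_near (f : C -> C) (z : C) : Prop :=
  exists rho, 0 < rho /\ forall w, Cmod (w - z) < rho -> f w = 0.

(** The Taylor coefficients vanish one after the other: if the first [m] do, the value at a zero [w]
    close to [z] shows that the next one is [O(|w - z|)]. *)
Lemma accumulating_zeros (f : C -> C) (z : C) :
  analytic_at f z -> (forall eps, 0 < eps -> exists w, 0 < Cmod (w - z) < eps /\ f w = 0) -> vanishes_near f z.
Proof.
  intros [a [r [Hr Ha]]] Hz. destruct (pseries_remainder a f z r Hr Ha) as [M [HM Hb]].
  assert (H0 : forall m, a m = 0).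
  { induction m as [m IH] using (well_founded_induction lt_wf).
    assert (Hsum : forall w, Csum (fun k => (w - z) ^ k * a k)%C (S m) = ((w - z) ^ m * a m)%C).
    { intros w. cbn [Csum]. rewrite (Csum_ext _ (fun k => 0 * 0)%C) by (intros k Hk; rewrite IH by assumption; ring).
      rewrite Csum_scal. ring. }
    destruct (Req_dec (Cmod (a m)) 0) as [E|E]; [now apply Cmod_eq_0|exfalso].
    pose proof (Cmod_ge_0 (a m)) as Hp.
    set (B := M / (r / 2) ^ S m). assert (HB : 0 < B) by (apply Rdiv_lt_0_compat; [assumption|apply pow_lt; lra]).
    destruct (Hz (Rmin (r / 4) (Cmod (a m) / B))) as [w [[Hw1 Hw2] Hw]].
    { apply Rmin_glb_lt; [lra|]. apply Rdiv_lt_0_compat; lra. }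
    pose proof (Rmin_l (r / 4) (Cmod (a m) / B)). pose proof (Rmin_r (r / 4) (Cmod (a m) / B)).
    specialize (Hb (S m) w ltac:(lra)). rewrite Hsum, Hw in Hb.
    replace (0 - (w - z) ^ m * a m)%C with (- ((w - z) ^ m * a m))%C in Hb by ring.
    rewrite Cmod_opp, Cmod_mult, Cmod_pow in Hb.
    assert (Hpm : 0 < Cmod (w - z) ^ m) by now apply pow_lt.
    assert (Hle : Cmod (a m) <= B * Cmod (w - z)).
    { apply Rmult_le_reg_l with (Cmod (w - z) ^ m); [assumption|]. eapply Rle_trans; [exact Hb|]. right.
      unfold B. unfold Rdiv at 1. rewrite Rpow_mult_distr, pow_inv. unfold Rdiv at 2. simpl. ring. }
    assert (Cmod (w - z) * B < Cmod (a m)) by (apply Rlt_div_r; lra). lra. }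
  exists r. split; [assumption|]. intros w Hw. specialize (Ha w Hw). apply is_pseries_clim in Ha.
  apply (clim_unique _ _ _ Ha). apply clim_ext with (fun _ => RtoC 0); [|apply clim_const].
  intros n. symmetry. rewrite (Csum_ext _ (fun k => 0 * 0)%C) by (intros k Hk; rewrite H0; ring). rewrite Csum_scal. ring.
Qed.

Lemma identity_segment (f : C -> C) (A B : C) :
  A <> B -> (forall t, 0 <= t <= 1 -> analytic_at f (A + RtoC t * (B - A))) ->
  vanishes_near f A -> vanishes_near f B.
Proof.
  intros HAB Han HA. set (g := fun t : R => (A + RtoC t * (B - A))%C).
  set (d := Cmod (B - A)).
  assert (Hd : 0 < d).
  { apply Cmod_gt_0. intros E. apply HAB. replace B with (A + (B - A))%C by ring. rewrite E. ring. }
  assert (Hg : forall t u, Cmod (g t - g u) = Rabs (t - u) * d).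
  { intros t u. unfold g, d. replace (A + RtoC t * (B - A) - (A + RtoC u * (B - A)))%C with (RtoC (t - u) * (B - A))%C
      by (rewrite RtoC_minus; ring). now rewrite Cmod_mult, Cmod_R. }
  set (E := fun t => 0 <= t <= 1 /\ forall u, 0 <= u <= t -> vanishes_near f (g u)).
  assert (HE0 : E 0).
  { split; [lra|]. intros u Hu. replace u with 0 by lra. unfold g. rewrite Cmult_0_l, Cplus_0_r. exact HA. }
  destruct (completeness E) as [tau [Hub Hlub]].
  { exists 1. intros t [Ht _]. lra. }
  { now exists 0. }
  assert (Htau : 0 <= tau <= 1).
  { split; [now apply Hub|]. apply Hlub. intros t [Ht _]. lra. }
  assert (Hbelow : forall u, 0 <= u < tau -> vanishes_near f (g u)).
  { intros u Hu. destruct (Classical_Prop.classic (exists t, E t /\ u < t)) as [[t [[Ht1 Ht2] Hut]]|Hn].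
    - apply Ht2; lra.
    - exfalso. assert (tau <= u); [|lra]. apply Hlub. intros t Ht. apply Rnot_lt_le. intros Hlt. apply Hn. now exists t. }
  assert (Hat : vanishes_near f (g tau)).
  { destruct (Req_dec tau 0) as [->|Hne]; [apply HE0; lra|].
    apply accumulating_zeros; [now apply Han|]. intros eps Heps.
    set (u := Rmax 0 (tau - eps / (2 * d))).
    assert (He : 0 < eps / (2 * d)) by (apply Rdiv_lt_0_compat; lra).
    assert (Hu : 0 <= u < tau /\ tau - u <= eps / (2 * d)).
    { unfold u. pose proof (Rmax_l 0 (tau - eps / (2 * d))). pose proof (Rmax_r 0 (tau - eps / (2 * d))).
      repeat split; try lra. apply Rmax_lub_lt; lra. }
    exists (g u). rewrite Hg, Rabs_left by lra. split.
    - split; [nra|]. assert ((tau - u) * d <= eps / 2); [|lra].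
      replace (eps / 2) with (eps / (2 * d) * d) by (field; lra). apply Rmult_le_compat_r; lra.
    - destruct (Hbelow u ltac:(lra)) as [rho [Hr Hf]]. apply Hf. unfold Cminus. rewrite Cplus_opp_r, Cmod_0. exact Hr. }
  assert (Hfin : tau = 1).
  { destruct (Req_dec tau 1) as [H1|H1]; [exact H1|exfalso].
    destruct Hat as [rho [Hr Hf]].
    set (v := Rmin 1 (tau + rho / (2 * d))).
    assert (He : 0 < rho / (2 * d)) by (apply Rdiv_lt_0_compat; lra).
    assert (Hv : tau < v /\ v <= 1 /\ v - tau <= rho / (2 * d)).
    { unfold v. pose proof (Rmin_l 1 (tau + rho / (2 * d))). pose proof (Rmin_r 1 (tau + rho / (2 * d))).
      repeat split; try lra. apply Rmin_glb_lt; lra. }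
    assert (Hev : E v).
    { split; [lra|]. intros u Hu. destruct (Rlt_or_le u tau) as [Hlt|Hle]; [apply Hbelow; lra|].
      exists (rho / 2). split; [lra|]. intros w Hw. apply Hf.
      replace (w - g tau)%C with ((w - g u) + (g u - g tau))%C by ring.
      eapply Rle_lt_trans; [apply Cmod_triangle|]. rewrite Hg, Rabs_pos_eq by lra.
      assert ((u - tau) * d <= rho / 2); [|lra].
      replace (rho / 2) with (rho / (2 * d) * d) by (field; lra). apply Rmult_le_compat_r; lra. }
    specialize (Hub v Hev). lra. }
  rewrite Hfin in Hat. unfold g in Hat. replace (A + RtoC 1 * (B - A))%C with B in Hat by ring. exact Hat.
Qed.

(** * The continued zeta function *)

(** The power [n ^ (- s)]. *)
Definition npow (s : C) (n : nat) : C := Cexp (- s * ln (INR n)).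

(** The Euler-Maclaurin expression for [(s - 1) * zeta s], with its polynomial coefficients split into
    factors [s - c] so that [analytic_mult_linear] applies. *)
Definition zeta_continued (s : C) : C :=
  (1 + (s - 1) * ((s - - 6) * (1 / 12)) + (s - 1) * ((s - 0) * ((s - - 1) * ((s - - 2) * (- (1 / 6) * em_remainder s)))))%C.

Lemma analytic_zeta_continued (s : C) : -2 < Re s -> analytic_at zeta_continued s.
Proof.
  intros Hs. unfold zeta_continued.
  apply analytic_plus; [apply analytic_plus; [apply analytic_const|]|].
  - apply analytic_mult_linear, (analytic_mult_linear (- 6) (fun _ => (1 / 12)%C)), analytic_const.
  - do 4 apply analytic_mult_linear. now apply analytic_mult_const, analytic_em_remainder.
Qed.

Lemma npow_shift (s : C) (n : nat) : (1 <= n)%nat -> npow (s - 1) n = (INR n * npow s n)%C.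
Proof.
  intros Hn. assert (H0 : 0 < INR n) by (apply lt_0_INR; lia). unfold npow.
  replace (- (s - 1) * ln (INR n))%C with (RtoC (ln (INR n)) + - s * ln (INR n))%C by ring.
  now rewrite Cexp_plus, Cexp_RtoC, exp_ln.
Qed.

(** One step of the Euler-Maclaurin formula for [x ^ (- s)], multiplied by [s - 1] so that no
    denominator depends on [s]. *)
Lemma em_step (s : C) (k : nat) :
  ((s - 1) * s * (s + 1) * (s + 2) * CInt (em_integrand s k) 0 1)%C =
  (- 6 * (INR (S (S k)) * npow s (S (S k)) - INR (S k) * npow s (S k))
   - 3 * (s - 1) * (npow s (S (S k)) + npow s (S k))
   - 1 / 2 * (s - 1) * s * (npow (s + 1) (S (S k)) - npow (s + 1) (S k)))%C.
Proof.
  set (K := INR (S k)).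
  set (e := fun (c : C) (x : R) => Cexp (- c * RtoC (ln (x + K)))).
  assert (Hpos : forall x, 0 <= x -> 0 < x + K) by (intros x Hx; pose proof (shift_pos k x Hx); unfold K; lra).
  assert (Hln : forall x, 0 <= x -> cderiv (fun u => RtoC (ln (u + K))) x (RtoC (/ (x + K)))).
  { intros x Hx. apply cderiv_real. specialize (Hpos x Hx). auto_derive; [exact Hpos|]. field. lra. }
  assert (He : forall c x, 0 <= x -> cderiv (e c) x (- c * e (c + 1) x)%C).
  { intros c x Hx. unfold e. specialize (Hpos x Hx). eapply cderiv_eq.
    - apply cderiv_Cexp, cderiv_scal, Hln, Hx.
    - cbv beta. replace (- (c + 1) * ln (x + K))%C with (- c * ln (x + K) + RtoC (- ln (x + K)))%C by (rewrite RtoC_opp; ring).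
      rewrite Cexp_plus, Cexp_RtoC, exp_Ropp, exp_ln by assumption. ring. }
  set (b2 := fun x : R => 3 * x ^ 2 - 3 * x + / 2). set (b1 := fun x : R => 6 * x - 3).
  assert (D3 : forall x, cderiv (fun u => RtoC (B3 u)) x (RtoC (b2 x))).
  { intros x. apply cderiv_real. unfold B3, b2. auto_derive; [exact I|]. field. }
  assert (D2 : forall x, cderiv (fun u => RtoC (b2 u)) x (RtoC (b1 x))).
  { intros x. apply cderiv_real. unfold b1, b2. auto_derive; [exact I|]. ring. }
  assert (D1 : forall x, cderiv (fun u => RtoC (b1 u)) x (RtoC 6)).
  { intros x. apply cderiv_real. unfold b1. auto_derive; [exact I|]. ring. }
  set (G := fun x : R => (- ((s - 1) * s * (s + 1)) * (RtoC (B3 x) * e (s + 2) x) + - ((s - 1) * s) * (RtoC (b2 x) * e (s + 1) x)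
     + - (s - 1) * (RtoC (b1 x) * e s x) + - RtoC 6 * e (s - 1) x)%C).
  assert (HG : is_CInt (fun x => (s - 1) * s * (s + 1) * (s + 2) * em_integrand s k x)%C 0 1 (G 1 - G 0)%C).
  { apply is_CInt_derive; [lra| |].
    - intros x Hx. unfold G. eapply cderiv_eq.
      + apply cderiv_plus; [apply cderiv_plus; [apply cderiv_plus|]|].
        * apply cderiv_scal, cderiv_mult; [apply D3|apply He; lra].
        * apply cderiv_scal, cderiv_mult; [apply D2|apply He; lra].
        * apply cderiv_scal, cderiv_mult; [apply D1|apply He; lra].
        * apply cderiv_scal, He; lra.
      + unfold em_integrand. fold K. change (Cexp (- (s + 3) * ln (x + K))) with (e (s + 3)%C x).
        replace (s + 2 + 1)%C with (s + 3)%C by (rewrite <- Cplus_assoc, <- RtoC_plus; do 2 f_equal; ring).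
        replace (s + 1 + 1)%C with (s + 2)%C by (rewrite <- Cplus_assoc, <- RtoC_plus; do 2 f_equal; ring).
        replace (s - 1 + 1)%C with s by ring. ring.
    - intros x Hx. apply (ccont_mult (fun _ => (s - 1) * s * (s + 1) * (s + 2))%C); [apply ccont_const|].
      apply ccont_em_integrand; lra. }
  assert (HV : is_CInt (em_integrand s k) 0 1 (CInt (em_integrand s k) 0 1))
    by (apply CInt_correct; [lra|intros; apply ccont_em_integrand; lra]).
  rewrite (is_CInt_unique _ _ _ _ _ (is_CInt_scal _ _ _ _ _ HV) HG).
  assert (E1 : forall c, e c 1 = npow c (S (S k))).
  { intros c. unfold e, npow, K. rewrite (S_INR (S k)), Rplus_comm. reflexivity. }
  assert (E0 : forall c, e c 0 = npow c (S k)).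
  { intros c. unfold e, npow, K. rewrite Rplus_0_l. reflexivity. }
  unfold G. rewrite !E1, !E0, !npow_shift by lia. fold K.
  replace (B3 1) with 0 by (unfold B3; field). replace (B3 0) with 0 by (unfold B3; field).
  replace (b2 1) with (1 / 2) by (unfold b2; field). replace (b2 0) with (1 / 2) by (unfold b2; field).
  replace (b1 1) with 3 by (unfold b1; field). replace (b1 0) with (- (3)) by (unfold b1; field).
  rewrite RtoC_div, (RtoC_opp 3) by lra. unfold Cdiv. ring.
Qed.

Lemma em_sum (s : C) (n : nat) :
  ((s - 1) * Csum (fun k => npow s (S k)) (S n) + INR (S n) * npow s (S n) - 1 / 2 * (s - 1) * npow s (S n)
    + (s - 1) * s * (1 / 12) * npow (s + 1) (S n))%C =
  (1 + (s - 1) * (1 / 2 + s * (1 / 12)) - 1 / 6 * ((s - 1) * s * (s + 1) * (s + 2)) * Csum (fun k => CInt (em_integrand s k) 0 1) n)%C.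
Proof.
  assert (H6 : RtoC 6 = (2 * 3)%C) by (rewrite <- RtoC_mult; f_equal; ring).
  assert (H12 : RtoC 12 = (2 * 2 * 3)%C) by (rewrite <- !RtoC_mult; f_equal; ring).
  induction n as [|n IH].
  - assert (E : forall c, npow c 1 = 1).
    { intros c. unfold npow. change (INR 1) with 1. rewrite ln_1, Cmult_0_r. apply Cexp_0. }
    simpl Csum. change (INR 1) with 1. rewrite !E, H12, H6. field; tauto.
  - change (Csum (fun k => npow s (S k)) (S (S n))) with (Csum (fun k => npow s (S k)) (S n) + npow s (S (S n)))%C.
    change (Csum (fun k => CInt (em_integrand s k) 0 1) (S n)) with (Csum (fun k => CInt (em_integrand s k) 0 1) n + CInt (em_integrand s n) 0 1)%C.
    pose proof (em_step s n) as ES.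
    transitivity (1 + (s - 1) * (1 / 2 + s * (1 / 12)) - 1 / 6 * ((s - 1) * s * (s + 1) * (s + 2)) * Csum (fun k => CInt (em_integrand s k) 0 1) n
      - 1 / 6 * ((s - 1) * s * (s + 1) * (s + 2) * CInt (em_integrand s n) 0 1))%C; [|ring].
    rewrite ES, <- IH, H12, H6. field; tauto.
Qed.

Lemma clim_npow (s : C) : 0 < Re s -> clim (fun n => npow s (S n)) 0.
Proof.
  intros Hs. apply clim_zero_le with (fun n => exp (- Re s * ln (INR (S n)))); [|now apply is_lim_neg_power].
  intros n. unfold npow. rewrite Cmod_Cexp, Re_mult, Re_opp, Re_RtoC, Im_RtoC. right. f_equal. ring.
Qed.

Lemma zeta_continued_eq (zeta : C -> C) (s : C) :
  is_riemann_zeta zeta -> 1 < Re s -> ((s - 1) * zeta s)%C = zeta_continued s.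
Proof.
  intros [_ Hz] Hs. specialize (Hz s Hs). apply is_series_clim in Hz.
  assert (L1 : clim (fun n => Csum (fun k => npow s (S k)) (S n)) (zeta s)).
  { apply (clim_incr _ _ 1) in Hz. eapply clim_ext; [|exact Hz]. intros n. cbv beta. now rewrite Nat.add_1_r. }
  assert (L2 : clim (fun n => INR (S n) * npow s (S n))%C 0).
  { apply clim_ext with (fun n => npow (s - 1) (S n)); [intros n; apply npow_shift; lia|].
    apply clim_npow. rewrite Re_minus, Re_RtoC. lra. }
  assert (L3 : clim (fun n => npow s (S n)) 0) by (apply clim_npow; lra).
  assert (L4 : clim (fun n => npow (s + 1) (S n)) 0) by (apply clim_npow; rewrite Re_plus, Re_RtoC; lra).
  assert (LL := clim_plus _ _ _ _ (clim_minus _ _ _ _ (clim_plus _ _ _ _ (clim_scal (s - 1) _ _ L1) L2)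
    (clim_scal (1 / 2 * (s - 1)) _ _ L3)) (clim_scal ((s - 1) * s * (1 / 12)) _ _ L4)).
  assert (LR := clim_minus _ _ _ _ (clim_const (1 + (s - 1) * (1 / 2 + s * (1 / 12)))%C)
    (clim_scal (1 / 6 * ((s - 1) * s * (s + 1) * (s + 2))) _ _ (clim_em_remainder s ltac:(lra)))).
  apply (clim_ext _ _ _ (em_sum s)) in LL.
  assert (E := clim_unique _ _ _ LL LR).
  unfold zeta_continued.
  transitivity ((s - 1) * zeta s + 0 - 1 / 2 * (s - 1) * 0 + (s - 1) * s * (1 / 12) * 0)%C; [ring|]. rewrite E.
  field; tauto.
Qed.

(** The segment from [2 + 3 i] to [-1] avoids the pole at 1 and stays in [Re s > -2]. *)
Lemma zeta_near_minus_one (zeta : C -> C) :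
  is_riemann_zeta zeta -> vanishes_near (fun s => (s - 1) * zeta s + - (1) * zeta_continued s)%C (-1).
Proof.
  intros Hz. apply (identity_segment _ (2, 3)).
  - intros E. apply (f_equal Re) in E. simpl in E. unfold Re in E; simpl in E. lra.
  - intros t Ht. set (w := ((2, 3) + RtoC t * (-1 - (2, 3)))%C).
    assert (E1 : Re w = 2 - 3 * t) by (unfold w; simpl; unfold Re; simpl; ring).
    assert (E2 : Im w = 3 - 3 * t) by (unfold w; simpl; unfold Im; simpl; ring).
    apply analytic_plus.
    + apply analytic_mult_linear. apply (proj1 Hz). intros E. rewrite E in E1, E2. simpl in E1, E2. unfold Re, Im in E1, E2; simpl in E1, E2. lra.
    + apply analytic_mult_const, analytic_zeta_continued. rewrite E1. lra.
  - exists 1. split; [lra|]. intros w Hw.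
    pose proof (Rabs_Re_le (w - (2, 3))) as H. rewrite Re_minus in H. change (Re (2, 3)) with 2 in H.
    assert (H1 : Rabs (Re w - 2) < 1) by lra. apply Rabs_lt_between in H1.
    rewrite (zeta_continued_eq zeta w Hz ltac:(lra)). ring.
Qed.

Lemma zeta_formula (zeta : C -> C) :
  is_riemann_zeta zeta -> exists rho, 0 < rho <= 1 /\ forall s, Cmod (s - -1) < rho ->
    zeta s = ((1 + (s - 1) * (1 / 2 + s * (1 / 12))) / (s - 1) - 1 / 6 * (s * (s + 1) * (s + 2)) * em_remainder s)%C.
Proof.
  intros Hz. destruct (zeta_near_minus_one zeta Hz) as [rho [Hr H]].
  exists (Rmin rho 1). pose proof (Rmin_l rho 1). pose proof (Rmin_r rho 1).
  split; [split; [apply Rmin_glb_lt|]; lra|]. intros s Hs. specialize (H s ltac:(lra)).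
  assert (Hs1 : (s - 1)%C <> 0).
  { intros E. assert (E2 : (s - -1)%C = 2).
    { replace (s - -1)%C with ((s - 1) + 2)%C by (replace (RtoC 2) with (1 - -1)%C by (rewrite <- RtoC_minus; f_equal; ring); ring).
      rewrite E. ring. }
    rewrite E2, Cmod_R, Rabs_pos_eq in Hs by lra. lra. }
  assert (E : ((s - 1) * zeta s)%C = zeta_continued s).
  { replace ((s - 1) * zeta s)%C with (((s - 1) * zeta s + - (1) * zeta_continued s) + zeta_continued s)%C by ring.
    rewrite H. ring. }
  assert (E2 : zeta s = (zeta_continued s / (s - 1))%C) by (rewrite <- E; field; exact Hs1).
  rewrite E2. unfold zeta_continued. field. exact Hs1.
Qed.

(** In the continued formula the term with [em_remainder] has a simple zero at [-1], so its derivative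
    there involves only the value of [em_remainder]. *)
Lemma zeta_derive_minus_one (zeta : C -> C) :
  is_riemann_zeta zeta -> C_derive zeta (-1) = (- (1 / 6) + em_remainder (-1) / 6)%C.
Proof.
  intros Hz. destruct (zeta_formula zeta Hz) as [rho [[Hr0 Hr1] Hf]].
  set (Q := fun x : R => (1 / 2 / (RtoC x - 1) + 1 / 12 + (- (1 / 6)) * (RtoC x * (RtoC x + 2)) * em_remainder (RtoC x))%C).
  assert (HQ : forall x : R, Rabs (x - -1) < rho -> x <> -1 -> ((zeta x - zeta (-1)) / (x - -1))%C = Q x).
  { intros x Hx Hne.
    assert (H0 : (RtoC x - -1)%C <> 0).
    { rewrite <- RtoC_minus. apply RtoC_neq_0. lra. }
    assert (H1 : (RtoC x - 1)%C <> 0).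
    { rewrite <- RtoC_minus. apply RtoC_neq_0. apply Rabs_lt_between in Hx. lra. }
    rewrite (Hf x) by (rewrite <- RtoC_minus, Cmod_R; exact Hx).
    rewrite (Hf (-1)) by (unfold Cminus; rewrite Cplus_opp_r, Cmod_0; exact Hr0).
    unfold Q. field. tauto. }
  assert (Hc : ccont Q (-1)).
  { assert (Hid : ccont (fun x => RtoC x) (-1)) by apply (cderiv_ccont _ _ _ (cderiv_id (-1))).
    unfold Q. apply ccont_plus; [apply ccont_plus; [|apply ccont_const]|].
    - apply (ccont_div (fun _ => 1 / 2)%C (fun x => RtoC x - 1)%C).
      + rewrite <- RtoC_minus. apply RtoC_neq_0; lra.
      + apply ccont_const.
      + apply (ccont_minus (fun x => RtoC x)); [exact Hid|apply ccont_const].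
    - apply ccont_mult; [apply (ccont_mult (fun _ => - (1 / 6))%C)|].
      + apply ccont_const.
      + apply ccont_mult; [exact Hid|apply ccont_plus; [exact Hid|apply ccont_const]].
      + apply ccontinuous_path; [|exact Hid]. apply analytic_continuous, analytic_em_remainder. simpl. lra. }
  transitivity (Q (-1)).
  - unfold C_derive, C_lim.
    assert (Hloc : forall p : C -> R, Rbar_locally' (-1) (fun x : R => p (Q x) = p ((zeta (x, snd (RtoC (-1))) - zeta (RtoC (-1))) / ((x, snd (RtoC (-1))) - RtoC (-1)))%C)).
    { intros p. exists (mkposreal _ Hr0). intros x Hx Hne. f_equal. symmetry. apply HQ; [exact Hx|exact Hne]. }
    destruct Hc as [C1 C2].
    assert (G : forall p : C -> R, continuous (fun x => p (Q x)) (-1) ->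
      real (Lim (fun x : R => p ((zeta (x, snd (RtoC (-1))) - zeta (RtoC (-1))) / ((x, snd (RtoC (-1))) - RtoC (-1)))%C) (-1)) = p (Q (-1))).
    { intros p Hp. erewrite is_lim_unique; [|apply (is_lim_ext_loc _ _ _ _ (Hloc p)); apply is_lim_continuity;
        apply continuity_pt_filterlim; exact Hp]. reflexivity. }
    apply C_ext; [exact (G Re C1)|exact (G Im C2)].
  - unfold Q. field.
Qed.

Definition hyper_seq (n : nat) : R :=
  log_hyper n - (INR n ^ 2 / 2 + INR n / 2 + 1 / 12) * ln (INR n) + INR n ^ 2 / 4.

(** At [s = -1] the integrand is the rational function [B3 x / (x + k + 1) ^ 2]. *)
Lemma em_integral_minus_one (k : nat) :
  CInt (em_integrand (-1) k) 0 1 = RtoC (- 6 * (hyper_seq (S (S k)) - hyper_seq (S k))).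
Proof.
  apply is_CInt_value. set (K := INR (S k)).
  set (P := fun x => - B3 x / (x + K) + (3 * x ^ 2 - 3 * x + / 2) * ln (x + K)
     - (6 * x - 3) * ((x + K) * ln (x + K) - (x + K)) + 6 * ((x + K) ^ 2 / 2 * ln (x + K) - 3 / 4 * (x + K) ^ 2)).
  assert (HK : 1 <= K) by (apply (le_INR 1); lia).
  assert (HP : is_CInt (fun x => RtoC (B3 x / (x + K) ^ 2)) 0 1 (RtoC (P 1) - RtoC (P 0))%C).
  { apply (is_CInt_derive (fun x => RtoC (P x))); [lra| |].
    - intros x Hx. apply cderiv_real. unfold P, B3. auto_derive; [repeat split; lra|]. field. lra.
    - intros x Hx. apply ccont_of_derive. unfold B3. auto_derive. repeat split; lra || nra. }
  replace (RtoC (- 6 * (hyper_seq (S (S k)) - hyper_seq (S k)))) with (RtoC (P 1) - RtoC (P 0))%C.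
  - apply is_CInt_ext with (3 := HP); [lra|]. intros x Hx. unfold em_integrand. fold K.
    replace (- (-1 + 3) * RtoC (ln (x + K)))%C with (RtoC (- ln (x + K) + - ln (x + K))).
    + rewrite Cexp_RtoC, exp_plus, !exp_Ropp, exp_ln by lra. rewrite <- RtoC_mult. f_equal. field. lra.
    + rewrite <- RtoC_plus, <- RtoC_opp, <- RtoC_mult. f_equal. ring.
  - rewrite <- RtoC_minus. f_equal. unfold hyper_seq.
    change (log_hyper (S (S k))) with (log_hyper (S k) + INR (S (S k)) * ln (INR (S (S k)))).
    rewrite (S_INR (S k)). fold K. unfold P, B3. rewrite Rplus_0_l, (Rplus_comm 1 K). field. lra.
Qed.

Lemma hyper_seq_limit (zeta : C -> C) :
  is_riemann_zeta zeta -> exists a : R, is_lim_seq hyper_seq a /\ log_glaisher zeta = RtoC a.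
Proof.
  intros Hz. assert (H := clim_em_remainder (-1) ltac:(simpl; lra)).
  assert (E : forall n, Csum (fun k => CInt (em_integrand (-1) k) 0 1) n = RtoC (- 6 * hyper_seq (S n) + 3 / 2)).
  { induction n as [|n IH].
    - simpl Csum. f_equal. unfold hyper_seq, log_hyper. simpl. rewrite ln_1. field.
    - cbn [Csum]. rewrite IH, em_integral_minus_one, <- RtoC_plus. f_equal. ring. }
  apply (clim_ext _ _ _ E) in H. destruct H as [H1 H2].
  set (J := em_remainder (-1)) in *.
  assert (HI : Im J = 0).
  { apply is_lim_seq_unique in H2. simpl in H2. rewrite Lim_seq_const in H2. now injection H2. }
  exists (1 / 4 - Re J / 6). split.
  - apply is_lim_seq_incr_1.
    assert (L := is_lim_seq_minus' _ _ _ _ (is_lim_seq_const (1 / 4)) (is_lim_seq_scal_l _ (/ 6) _ H1)).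
    replace (1 / 4 - Re J / 6) with (1 / 4 - / 6 * Re J) by field.
    apply is_lim_seq_ext with (2 := L). intros n. rewrite Re_RtoC. field.
  - unfold log_glaisher. rewrite (zeta_derive_minus_one zeta Hz). fold J.
    apply C_ext.
    + replace (1 / 12 - (- (1 / 6) + J / 6))%C with (RtoC (1 / 12 + 1 / 6) - RtoC (/ 6) * J)%C
        by (rewrite RtoC_plus, !RtoC_div, RtoC_inv by lra; field).
      rewrite Re_minus, Re_mult, !Re_RtoC, Im_RtoC. field.
    + replace (1 / 12 - (- (1 / 6) + J / 6))%C with (RtoC (1 / 12 + 1 / 6) - RtoC (/ 6) * J)%C
        by (rewrite RtoC_plus, !RtoC_div, RtoC_inv by lra; field).
      rewrite Im_minus, Im_mult, !Re_RtoC, !Im_RtoC, HI. ring.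
Qed.

(** * The bound for the remainder *)

Lemma Clog_term_neq_0 (w : C) (k : nat) : slit_plane w -> (1 + w / INR (S k))%C <> 0.
Proof. intros H. now apply slit_neq_0, slit_1_plus. Qed.

Lemma Im_Csum_0 (f : nat -> C) (n : nat) : (forall k, Im (f k) = 0) -> Im (Csum f n) = 0.
Proof. intros H. induction n as [|n IH]; [reflexivity|]. simpl Csum. rewrite Im_plus, IH, H. ring. Qed.

Lemma Im_clim_0 (u : nat -> C) (l : C) : (forall n, Im (u n) = 0) -> clim u l -> Im l = 0.
Proof.
  intros H [_ H2]. apply is_lim_seq_unique in H2.
  rewrite (Lim_seq_ext _ (fun _ => 0)) in H2 by apply H. rewrite Lim_seq_const in H2. now injection H2.
Qed.

Lemma Clog_real_term (x : R) (k : nat) : 0 < x -> Clog (1 + x / INR (S k)) = RtoC (ln (1 + x / INR (S k))).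
Proof.
  intros Hx. assert (0 < INR (S k)) by (apply lt_0_INR; lia).
  assert (0 < x / INR (S k)) by now apply Rdiv_lt_0_compat.
  rewrite <- RtoC_div, <- RtoC_plus by lra. apply Clog_RtoC. lra.
Qed.

Lemma log_barnes_branch (L : C -> C) (z : C) :
  is_log_branch (fun z => BarnesG (z + 1)%C) L -> slit_plane z -> L z = log_barnes z.
Proof.
  intros HL Hz. apply (log_branch_unique _ _ _ z HL Hz).
  - intros t Ht. set (w := (1 + RtoC t * (z - 1))%C).
    assert (Hw : slit_plane w) by now apply slit_segment.
    unfold BarnesG. replace (w + 1 - 1)%C with w by ring. unfold BarnesG_succ, log_barnes.
    unfold Cminus. rewrite !Cexp_plus. f_equal. symmetry.
    apply (Cinf_prod_exp _ (barnes_log_term w)); [|apply (proj1 barnes_log_series)].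
    intros k. unfold barnes_log_term.
    replace (INR (S k) * Clog (1 + w / INR (S k)) - w + w ^ 2 / (2 * INR (S k)))%C
      with (INR (S k) * Clog (1 + w / INR (S k)) + (- w + w ^ 2 / (2 * INR (S k))))%C by ring.
    now rewrite (Cexp_plus (INR (S k) * _)), <- Cexp_pow, Cexp_Clog by (now apply Clog_term_neq_0).
  - intros t Ht. assert (Hw := slit_segment z t Hz Ht). assert (Hl := cderiv_line 1 (z - 1) t).
    assert (Hc := cderiv_ccont _ _ _ Hl). unfold log_barnes.
    apply ccont_plus; [apply ccont_minus|].
    + apply ccont_mult; [|apply ccont_const]. apply ccont_mult; [exact Hc|apply ccont_const].
    + apply ccont_mult; [|apply ccont_const]. apply ccont_plus.
      * apply ccont_mult; [exact Hc|]. apply ccont_plus; [exact Hc|apply ccont_const].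
      * apply (ccont_mult (fun _ => RtoC euler_gamma)); [apply ccont_const|]. now apply ccont_pow.
    + apply (proj2 barnes_log_series (fun u => 1 + RtoC u * (z - 1))%C (z - 1)%C t Hw Hl).
  - unfold log_barnes.
    assert (H : Im (barnes_log_sum 1) = 0).
    { apply (Im_clim_0 _ _) with (2 := (proj1 barnes_log_series) 1). intros n. apply Im_Csum_0. intros k.
      unfold barnes_log_term. rewrite (Clog_real_term 1 k) by lra.
      assert (0 < INR (S k)) by (apply lt_0_INR; lia).
      rewrite <- RtoC_pow, <- !RtoC_mult, <- RtoC_minus, <- RtoC_div, <- RtoC_plus by lra. apply Im_RtoC. }
    rewrite Im_plus, H.
    rewrite <- RtoC_pow, <- !RtoC_plus, <- !RtoC_mult, <- !RtoC_plus, <- !RtoC_div, <- RtoC_mult, <- RtoC_minus by lra.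
    rewrite Im_RtoC. ring.
Qed.

Lemma log_gamma_branch (L : C -> C) (z : C) :
  is_log_branch (fun z => Gamma (z + 1)%C) L -> slit_plane z -> L z = log_gamma z.
Proof.
  intros HL Hz. apply (log_branch_unique _ _ _ z HL Hz).
  - intros t Ht. set (w := (1 + RtoC t * (z - 1))%C).
    assert (Hw : slit_plane w) by now apply slit_segment.
    assert (Hw1 : slit_plane (w + 1)) by (rewrite Cplus_comm; apply slit_plus; [exact Hw|lra]).
    unfold Gamma, log_gamma. rewrite Cexp_opp, !Cexp_plus, Cexp_Clog by now apply slit_neq_0.
    do 2 f_equal. symmetry.
    apply (Cinf_prod_exp _ (gamma_log_term (w + 1))); [|apply (proj1 gamma_log_series)].
    intros k. unfold gamma_log_term, Cminus.
    now rewrite Cexp_plus, Cexp_Clog by (now apply Clog_term_neq_0).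
  - intros t Ht. assert (Hw := slit_segment z t Hz Ht).
    assert (Hw1 : slit_plane ((1 + RtoC t * (z - 1)) + 1)) by (rewrite Cplus_comm; apply slit_plus; [exact Hw|lra]).
    assert (Hl := cderiv_plus _ _ _ _ _ (cderiv_line 1 (z - 1) t) (cderiv_const 1 t)).
    assert (Hc := cderiv_ccont _ _ _ Hl). unfold log_gamma.
    apply ccont_ext with (fun u => - (1) * (Clog ((1 + RtoC u * (z - 1)) + 1) + euler_gamma * ((1 + RtoC u * (z - 1)) + 1)
      + gamma_log_sum ((1 + RtoC u * (z - 1)) + 1)))%C; [intros; ring|].
    apply (ccont_mult (fun _ => - (1))%C); [apply ccont_const|].
    apply ccont_plus; [apply ccont_plus|].
    + eapply cderiv_ccont. apply (cderiv_Clog (fun u => (1 + RtoC u * (z - 1)) + 1)%C); [exact Hw1|exact Hl].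
    + apply (ccont_mult (fun _ => RtoC euler_gamma)); [apply ccont_const|exact Hc].
    + exact (proj2 gamma_log_series (fun u => (1 + RtoC u * (z - 1)) + 1)%C _ t Hw1 Hl).
  - unfold log_gamma. rewrite <- RtoC_plus.
    assert (H : Im (gamma_log_sum (RtoC (1 + 1))) = 0).
    { apply (Im_clim_0 _ _) with (2 := (proj1 gamma_log_series) (RtoC (1 + 1))). intros n. apply Im_Csum_0. intros k.
      unfold gamma_log_term. rewrite (Clog_real_term (1 + 1) k) by lra.
      assert (0 < INR (S k)) by (apply lt_0_INR; lia).
      rewrite <- RtoC_div, <- RtoC_minus by lra. apply Im_RtoC. }
    rewrite Im_opp, Im_plus, H, Clog_RtoC by lra.
    rewrite <- RtoC_mult, <- RtoC_plus, Im_RtoC. ring.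
Qed.

Lemma expansion_coef_eq (i : nat) :
  expansion_coef i = bernoulli (2 * S i + 2) / (2 * INR (S i) * (2 * INR (S i) + 1) * (2 * INR (S i) + 2)).
Proof.
  unfold expansion_coef. replace (2 * S i + 2)%nat with (2 * i + 4)%nat by lia.
  replace (fact (2 * i + 4)) with (fact (S (S (S (2 * i + 1))))) by (f_equal; lia).
  rewrite !fact_simpl, !mult_INR, !S_INR, plus_INR, mult_INR. simpl (INR 2). simpl (INR 1).
  pose proof (INR_fact_neq_0 (2 * i + 1)). pose proof (pos_INR i). field. repeat split; try assumption; lra.
Qed.

Lemma sum_n_m_Csum (f : nat -> C) (n : nat) :
  @sum_n_m C_AbelianMonoid f 1 n = Csum (fun k => f (S k)) n.
Proof.
  destruct n as [|n]; [rewrite sum_n_m_zero by lia; reflexivity|].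
  induction n as [|n IH].
  - rewrite sum_n_n. simpl. ring.
  - rewrite sum_n_Sm by lia. rewrite IH. reflexivity.
Qed.

(** [clim_euler_step_sum] turns the remainder for [N = 1] into the limit of the sums bounded in
    [euler_maclaurin_bound]; the second term of that bound disappears in the limit. *)
Lemma remainder_bound (logG1 logGamma1 zeta : C -> C) (N : nat) (z : C) (psi : R) :
  is_log_branch (fun z => BarnesG (z + 1)%C) logG1 ->
  is_log_branch (fun z => Gamma (z + 1)%C) logGamma1 ->
  is_riemann_zeta zeta ->
  (1 <= N)%nat -> slit_plane z -> 0 < cos psi -> sin (2 * psi) <> 0 -> 0 < Re (z * ray psi)%C ->
  Cmod (barnes_remainder logG1 logGamma1 zeta N z) <=
  Rabs (bernoulli (2 * N + 2)) / (2 * INR N * (2 * INR N + 1) * (2 * INR N + 2)) /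
    Re (z * ray psi)%C ^ (2 * N) / Rabs (sin (2 * psi)).
Proof.
  intros HG HGam Hz HN Hsl Hc Hs Hmu.
  destruct (hyper_seq_limit zeta Hz) as [a [Ha HA]].
  assert (Hlim := clim_euler_step_sum z a Hsl Ha).
  destruct N as [|M]; [lia|]. set (mu := Re (z * ray psi)%C) in *.
  assert (Hz0 := slit_neq_0 _ Hsl).
  assert (HR : barnes_remainder logG1 logGamma1 zeta (S M) z =
    (log_barnes z - z * log_gamma z - (1 / 4 * z ^ 2 - quad z * Clog z) + a
      - Csum (fun i => RtoC (expansion_coef i) / z ^ (2 * i + 2)) M)%C).
  { unfold barnes_remainder. rewrite (log_barnes_branch _ z HG Hsl), (log_gamma_branch _ z HGam Hsl), HA.
    replace (S M - 1)%nat with M by lia. rewrite sum_n_m_Csum.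
    rewrite (Csum_ext (fun k => _ / _)%C (fun i => RtoC (expansion_coef i) / z ^ (2 * i + 2))%C).
    - unfold quad. ring.
    - intros i _. rewrite expansion_coef_eq. pose proof (pos_INR (S i)). pose proof (lt_0_INR (S i) ltac:(lia)).
      rewrite RtoC_div, !RtoC_mult, !RtoC_plus, !RtoC_mult by nra.
      replace (2 * S i)%nat with (2 * i + 2)%nat by lia.
      field. repeat split; try (now apply Cpow_nz); try assumption;
        rewrite <- ?RtoC_mult, <- ?RtoC_plus; apply RtoC_neq_0; lra. }
  rewrite HR.
  assert (HS : forall j, is_CInt (fun x => RtoC (B2 x) / (RtoC x + (z + INR j)))%C 0 1 (- 2 * euler_step (z + INR j))%C).
  { intros j. apply is_CInt_B2. rewrite Cplus_comm. apply slit_plus; [exact Hsl|apply pos_INR]. }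
  assert (HB := fun n => euler_maclaurin_bound psi z n M _ Hc Hs Hmu (fun j _ => HS j)). fold mu in HB.
  set (s := Rabs (sin (2 * psi))) in *.
  assert (Hs0 : 0 < s) by now apply Rabs_pos_lt.
  apply (clim_Cmod_le (fun n => Csum (fun j => euler_step (z + INR j)) n - Csum (fun i => RtoC (expansion_coef i) / z ^ (2 * i + 2)) M)%C
    (fun n => Rabs (expansion_coef M) / mu ^ (2 * M + 2) / s + Rabs (expansion_coef 0) / (mu + INR n * cos psi) ^ 2 / s)).
  - apply clim_minus; [exact Hlim|apply clim_const].
  - replace (Finite _) with (Finite (Rabs (expansion_coef M) / mu ^ (2 * M + 2) / s + 0)).
    + apply is_lim_seq_plus'; [apply is_lim_seq_const|].
      apply (is_lim_seq_incr_1 (fun n => Rabs (expansion_coef 0) / (mu + INR n * cos psi) ^ 2 / s)).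
      set (e := Rabs (expansion_coef 0)). assert (He : 0 <= e) by apply Rabs_pos.
      apply is_lim_seq_abs_le with (fun n => (e / (cos psi * mu) / s) * (1 / INR (S n))).
      * intros n. assert (Hn : 0 < INR (S n)) by (apply lt_0_INR; lia). set (x := INR (S n)) in *.
        assert (H1 : 0 < mu + x * cos psi) by nra.
        rewrite Rminus_0_r, Rabs_pos_eq by (repeat (apply Rdiv_le_0_compat; [|try apply pow_lt; assumption]); assumption).
        unfold Rdiv. rewrite (Rmult_comm _ (/ s)), (Rmult_comm _ (/ s)), (Rmult_assoc (/ s)), (Rmult_assoc e).
        apply Rmult_le_compat_l; [left; now apply Rinv_0_lt_compat|]. apply Rmult_le_compat_l; [assumption|].
        rewrite Rmult_1_l, <- Rinv_mult. apply Rinv_le_contravar; [repeat apply Rmult_lt_0_compat; assumption|].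
        assert (0 < x * cos psi) by now apply Rmult_lt_0_compat. nra.
      * replace (Finite 0) with (Rbar_mult (e / (cos psi * mu) / s) 0) by (simpl; f_equal; ring).
        apply is_lim_seq_scal_l. apply (is_lim_seq_incr_1 (fun n => 1 / INR n)), is_lim_seq_div_INR.
    + f_equal. rewrite Rplus_0_r, expansion_coef_eq. replace (2 * S M)%nat with (2 * M + 2)%nat by lia.
      pose proof (lt_0_INR (S M) ltac:(lia)).
      unfold Rdiv at 3. rewrite Rabs_mult, (Rabs_pos_eq (/ _)); [reflexivity|].
      left. apply Rinv_0_lt_compat. repeat apply Rmult_lt_0_compat; lra.
  - intros n. specialize (HB n). eapply Rle_trans; [|exact HB]. right. f_equal. f_equal.
    rewrite Csum_scal, RtoC_inv by lra. field.
Qed.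

Theorem theorem1p3 :
  forall (logG1 logGamma1 zeta : C -> C),
    is_log_branch (fun z => BarnesG (z + 1)%C) logG1 ->
    is_log_branch (fun z => Gamma (z + 1)%C) logGamma1 ->
    is_riemann_zeta zeta ->
  forall (N : nat) (z : C) (theta : R),
    (1 <= N)%nat -> z <> 0 -> theta = Carg z ->
    (PI / 4 < theta < PI ->
     exists phi : R,
       unique (fun p : R =>
         0 < p < PI / 2 /\
         (3 * PI / 4 <= theta < PI -> - (PI / 2) + theta < p < PI / 2) /\
         (PI / 2 <= theta < 3 * PI / 4 ->
            - (PI / 2) + theta < p < - (PI / 4) + theta) /\
         (PI / 4 < theta < PI / 2 -> 0 < p < - (PI / 4) + theta) /\
         angle_equation N theta p) phi /\
       Cmod (barnes_remainder logG1 logGamma1 zeta N z) <=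
         csc (2 * (theta - phi)) / cos phi ^ (2 * N + 1) *
         (Rabs (bernoulli (2 * N + 2)) /
          (2 * INR N * (2 * INR N + 1) * (2 * INR N + 2) * Cmod z ^ (2 * N)))) /\
    (- PI < theta < - (PI / 4) ->
     exists phi : R,
       unique (fun p : R =>
         - (PI / 2) < p < 0 /\
         (- PI < theta <= - (3 * PI / 4) -> - (PI / 2) < p < PI / 2 + theta) /\
         (- (3 * PI / 4) < theta <= - (PI / 2) ->
            PI / 4 + theta < p < PI / 2 + theta) /\
         (- (PI / 2) < theta < - (PI / 4) -> PI / 4 + theta < p < 0) /\
         angle_equation N theta p) phi /\
       Cmod (barnes_remainder logG1 logGamma1 zeta N z) <=
         - (csc (2 * (theta - phi)) / cos phi ^ (2 * N + 1)) *
         (Rabs (bernoulli (2 * N + 2)) /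
          (2 * INR N * (2 * INR N + 1) * (2 * INR N + 2) * Cmod z ^ (2 * N)))).
Proof.
  intros logG1 logGamma1 zeta HG HGam Hzeta N z theta HN Hz Htheta.
  assert (Hr : 0 < Cmod z) by now apply Cmod_gt_0.
  destruct (Carg_spec z Hz) as [Hrange [Hre Him]]. rewrite <- Htheta in *.
  assert (Hbound : forall phi, theta < PI -> - (PI / 2) < phi < PI / 2 -> - (PI / 2) < theta - phi < PI / 2 -> theta - phi <> 0 ->
     Cmod (barnes_remainder logG1 logGamma1 zeta N z) <=
     / Rabs (sin (2 * (theta - phi))) / cos phi ^ (2 * N + 1) *
      (Rabs (bernoulli (2 * N + 2)) / (2 * INR N * (2 * INR N + 1) * (2 * INR N + 2) * Cmod z ^ (2 * N)))).
  { intros phi Hlt Hphi Hd Hd0. set (psi := theta - phi) in *.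
    assert (Hcphi : 0 < cos phi) by (apply cos_gt_0; lra).
    assert (Hcpsi : 0 < cos psi) by (apply cos_gt_0; lra).
    assert (Hs : sin (2 * psi) <> 0).
    { destruct (Rlt_or_le 0 psi).
      - apply Rgt_not_eq. apply sin_gt_0; lra.
      - apply Rlt_not_eq. apply sin_lt_0_var; lra. }
    assert (Hmu : Re (z * ray psi)%C = Cmod z * cos phi).
    { rewrite Re_mult. change (Re (ray psi)) with (cos psi). change (Im (ray psi)) with (- sin psi). rewrite Hre, Him.
      replace phi with (theta - psi) by (unfold psi; ring). rewrite cos_minus. ring. }
    assert (Hsl : slit_plane z).
    { intros [H1 H2]. rewrite Him in H2. apply Rmult_integral in H2. destruct H2 as [H2|H2]; [lra|].
      assert (H0 : theta = 0).
      { destruct (Rtotal_order theta 0) as [H|[H|H]]; [|assumption|].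
        - assert (sin theta < 0) by (apply sin_lt_0_var; lra). lra.
        - assert (0 < sin theta) by (apply sin_gt_0; lra). lra. }
      rewrite Hre, H0, cos_0 in H1. lra. }
    assert (H := remainder_bound logG1 logGamma1 zeta N z psi HG HGam Hzeta HN Hsl Hcpsi Hs).
    rewrite Hmu in H. specialize (H ltac:(now apply Rmult_lt_0_compat)).
    eapply Rle_trans; [exact H|].
    assert (HNp : 0 < INR N) by (apply lt_0_INR; lia).
    set (D := 2 * INR N * (2 * INR N + 1) * (2 * INR N + 2)).
    assert (HD : 0 < D) by (unfold D; repeat apply Rmult_lt_0_compat; lra).
    set (S0 := Rabs (sin (2 * psi))). assert (HS0 : 0 < S0) by now apply Rabs_pos_lt.
    set (b := Rabs (bernoulli (2 * N + 2))). assert (Hb : 0 <= b) by apply Rabs_pos.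
    assert (Hzn : 0 < Cmod z ^ (2 * N)) by now apply pow_lt.
    assert (Hcn : 0 < cos phi ^ (2 * N)) by now apply pow_lt.
    rewrite Rpow_mult_distr, pow_add, pow_1.
    replace (b / D / (Cmod z ^ (2 * N) * cos phi ^ (2 * N)) / S0) with
      ((/ S0 / cos phi ^ (2 * N) * (b / (D * Cmod z ^ (2 * N)))) * 1) by (field; lra).
    replace (/ S0 / (cos phi ^ (2 * N) * cos phi) * (b / (D * Cmod z ^ (2 * N)))) with
      ((/ S0 / cos phi ^ (2 * N) * (b / (D * Cmod z ^ (2 * N)))) * / cos phi) by (field; lra).
    apply Rmult_le_compat_l.
    - apply Rmult_le_pos; [|apply Rdiv_le_0_compat; [assumption|now apply Rmult_lt_0_compat]].
      apply Rdiv_le_0_compat; [|assumption]. left; now apply Rinv_0_lt_compat.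
    (* the exponent of [cos phi] increases by one because [cos phi <= 1] *)
    - rewrite <- Rinv_1. apply Rinv_le_contravar; [assumption|]. apply COS_bound. }
  split; intros Ht.
  - destruct (optimal_angle N theta Ht) as [phi [Hu [Hp Hd]]]. exists phi. split; [exact Hu|].
    specialize (Hbound phi ltac:(lra) ltac:(lra) ltac:(lra) ltac:(lra)).
    rewrite Rabs_pos_eq in Hbound by (left; apply sin_gt_0; lra). exact Hbound.
  - destruct (optimal_angle_neg N theta Ht) as [phi [Hu [Hp Hd]]]. exists phi. split; [exact Hu|].
    specialize (Hbound phi ltac:(lra) ltac:(lra) ltac:(lra) ltac:(lra)).
    assert (Hneg : sin (2 * (theta - phi)) < 0) by (apply sin_lt_0_var; lra).
    rewrite Rabs_left in Hbound by exact Hneg. unfold csc.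
    replace (- (/ sin (2 * (theta - phi)) / cos phi ^ (2 * N + 1))) with (/ - sin (2 * (theta - phi)) / cos phi ^ (2 * N + 1));
      [exact Hbound|]. unfold Rdiv. rewrite Rinv_opp. ring.
Qed.
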